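(* Let $\delta\in\{e_1,\dots,e_d\}$. For every eigenvalue $\lambda_{j,\beta}$ of the operator $L(P(s))$ with $\gamma=\beta+j\delta\in V_\delta(\rho^{\alpha_1})\setminus E_2$ (where $j\in\mathbb Z$, $\beta\in\Gamma_\delta$, $|\gamma|\sim\rho$), there exists an eigenvalue $\Lambda_N$ of the operator $L(V)$ satisfying $$\Lambda_N=\lambda_{j,\beta}+O(\rho^{-\alpha_2}).$$
   Context: Setting. Let $d\ge 2$, $m\ge 2$, $F=[0,a_1]\times\cdots\times[0,a_d]$. $V(x)=(v_{ik}(x))_{i,k=1}^m$ is a real symmetric matrix with $v_{ik}\in L_2(F)$. $L(V)$ is the operator in $L_2^m(F)$ given by $L(V)\phi=(-\Delta+V(x))\phi$ ($\Delta$ acts componentwise) with Neumann condition $\partial\phi/\partial n|_{\partial F}=0$; its eigenvalues are denoted $\Lambda_N$. Lattices. $\frac{\Gamma}{2}=\{(\frac{n_1\pi}{a_1},\dots,\frac{n_d\pi}{a_d}):n_k\in\mathbb Z\}$, $\Gamma=\{2\gamma:\gamma\in\frac\Gamma2\}$; $e_k$ is the vector with $k$-th entry $\pi/a_k$ and all other entries $0$. For $\gamma=(\gamma^1,\dots,\gamma^d)\in\frac\Gamma2$, $u_\gamma(x)=\prod_{k=1}^d\cos(\gamma^kx_k)$. Every $q\in L_2(F)$ satisfies $q=\sum_{\gamma\in\Gamma/2}q_\gamma u_\gamma$ with $q_\gamma=\frac1{\mu(F)}(q,u_\gamma)$, where $\mu$ is Lebesgue measure and $(\cdot,\cdot)$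 the $L_2(F)$ inner product. Let $v_{ik\gamma}$ be the coefficients of $v_{ik}$. Standing assumption: for all $i,k$, $\sum_{\gamma\in\Gamma/2}|v_{ik\gamma}|^2(1+|\gamma|^{2l})<\infty$ with $l>\frac{(d+20)(d-1)}2+d+3$. Parameters. $p=l-d$, $0<\alpha<\frac1{d+20}$, $\alpha_k=3^k\alpha$; $\rho$ is a large parameter; $|\gamma|\sim\rho$ means $c_1\rho<|\gamma|<c_2\rho$ with fixed constants $c_1,c_2>0$ independent of $\rho$. $O(\cdot)$ is as $\rho\to\infty$, with constants independent of $\rho$ (and of $j,\beta$). Domains. $V_b(\rho^{c})=\{x\in\mathbb R^d:\ ||x|^2-|x+b|^2|<\rho^{c}\}$; $\Gamma(p\rho^\alpha)=\{b\in\frac\Gamma2:0<|b|<p\rho^\alpha\}$; $E_2=E_2(\rho^{\alpha_2},p)=\bigcup\big(V_{\gamma_1}(\rho^{\alpha_2})\cap V_{\gamma_2}(\rho^{\alpha_2})\big)$, the union over linearly independent $\gamma_1,\gamma_2\in\Gamma(p\rho^\alpha)$ such that, for $i=1,2$, $|\gamma_i|$ does not exceed the length of any nonzero vector of $\Gamma\cap\gamma_i\mathbb R$. The operator $L(P(s))$. Fix $\delta=e_i$, let $\Gamma_\delta=\{\gamma\in\frac\Gamma2:\gamma\cdot\delta=0\}$ and $s=x\cdot\delta\in[0,\pi]$. Put $p_{ik}(s)=\sum_{n\in\mathbb Z}v_{ik(n\delta)}\cos ns$ and $P(s)=(p_{ik}(s))$. $L(P(s))$ is $-\Delta+P(s)$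 in $L_2^m(F)$ with the Neumann condition. $T(P(s))$ is the operator in $L_2^m[0,\pi]$ given by $T(P(s))Y=-|\delta|^2Y''+P(s)Y$, $Y'(0)=Y'(\pi)=0$; its eigenvalues are denoted $\lambda_j$, $j\in\mathbb Z$ ($\lambda_j$ being the eigenvalue with $|\lambda_j-|j\delta|^2|<\sup_s\|P(s)\|$), with corresponding eigenfunctions $\varphi_j$. The eigenvalues of $L(P(s))$ are $\lambda_{j,\beta}=\lambda_j+|\beta|^2$, $j\in\mathbb Z$, $\beta\in\Gamma_\delta$, with eigenfunctions $\chi_{j,\beta}(x)=u_\beta(x)\varphi_j(s)$. *)

(* Defs.v *)
From HB Require Import structures.
From mathcomp Require Import all_boot all_order all_algebra.
From mathcomp Require Import all_classical all_reals all_analysis.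

Set Implicit Arguments.
Unset Strict Implicit.
Unset Printing Implicit Defensive.

Import Order.TTheory GRing.Theory Num.Theory.
Import numFieldNormedType.Exports.

Local Open Scope classical_set_scope.
Local Open Scope ring_scope.

Section rV_measurable.
Variables (R : realType) (n : nat).

Let coor : 'I_n -> 'rV[R]_n -> measurableTypeR R := fun k x => x 0 k.

Let rV_set0 : g_sigma_preimage coor set0.
Proof. exact: sigma_algebra0. Qed.

Let rV_setC A : g_sigma_preimage coor A -> g_sigma_preimage coor (~` A).
Proof. exact: sigma_algebraC. Qed.

Let rV_bigcup (A : (set 'rV[R]_n)^nat) :
  (forall i, g_sigma_preimage coor (A i)) ->
  g_sigma_preimage coor (\bigcup_i A i).
Proof. exact: sigma_algebra_bigcup. Qed.

HB.instance Definition _ := @isMeasurable.Build default_measure_display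
  'rV[R]_n (g_sigma_preimage coor) rV_set0 rV_setC rV_bigcup.

End rV_measurable.

Section rV_lebesgue.
Variable R : realType.

Lemma measurable_coord n (k : 'I_n) :
  measurable_fun [set: 'rV[R]_n] (fun x => x 0 k : measurableTypeR R).
Proof.
move=> _ Y mY; rewrite setTI; apply: sub_sigma_algebra => /=.
rewrite -bigcup_seq/=; exists k => /=; first by rewrite mem_index_enum.
by exists Y => //; rewrite setTI.
Qed.

Lemma measurable_fun_coordP d (T : measurableType d) n (f : T -> 'rV[R]_n) :
  (forall k, measurable_fun [set: T] (fun x => f x 0 k : measurableTypeR R)) ->
  measurable_fun [set: T] f.
Proof.
move=> mf.
have : g_sigma_preimage (fun k x => f x 0 k : measurableTypeR R)
    `<=` measurable.
  apply: smallest_sub; first exact: sigma_algebra_measurable.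
  case: n f mf => [|n] f mf; first by rewrite big_ord0.
  rewrite -bigcup_mkord_ord; apply: bigcup_sub => i Ii.
  by move=> A [B mB <-]; exact: mf.
have -> : (fun k x => f x 0 k : measurableTypeR R) =
    (fun k => (fun y : 'rV[R]_n => y 0 k : measurableTypeR R) \o f) by [].
rewrite g_sigma_preimage_comp => fS _ A mA.
by apply: fS; exists A.
Qed.

Definition rV_cons n (p : measurableTypeR R * 'rV[R]_n) : 'rV[R]_n.+1 :=
  row_mx (const_mx p.1 : 'rV_1) p.2.

Definition rV_uncons n (x : 'rV[R]_n.+1) : measurableTypeR R * 'rV[R]_n :=
  (x 0 ord0, \row_k x 0 (lift ord0 k)).

Lemma rV_cons0 n p : @rV_cons n p 0 ord0 = p.1.
Proof.
rewrite /rV_cons mxE; case: splitP => [j _|k //].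
by rewrite mxE.
Qed.

Lemma rV_consS n p k : @rV_cons n p 0 (lift ord0 k) = p.2 0 k.
Proof.
rewrite /rV_cons mxE; case: splitP => [j|j /= /eqP].
  by rewrite ord1.
by rewrite /bump /= eqSS => /eqP/val_inj ->.
Qed.

Lemma rV_consK n : cancel (@rV_cons n) (@rV_uncons n).
Proof.
move=> p; rewrite [RHS]surjective_pairing /rV_uncons rV_cons0; congr pair.
by apply/rowP => k; rewrite mxE rV_consS.
Qed.

Lemma rV_unconsK n : cancel (@rV_uncons n) (@rV_cons n).
Proof.
move=> x; apply/rowP => k; case: (unliftP ord0 k) => [j|] ->.
  by rewrite rV_consS mxE.
by rewrite rV_cons0.
Qed.

Lemma measurable_rV_cons n : measurable_fun setT (@rV_cons n).
Proof.
apply: measurable_fun_coordP => k; case: (unliftP ord0 k) => [j|] ->.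
  under eq_fun do rewrite rV_consS.
  exact: (measurableT_comp (measurable_coord j) measurable_snd).
under eq_fun do rewrite rV_cons0.
exact: measurable_fst.
Qed.

Lemma measurable_rV_uncons n : measurable_fun setT (@rV_uncons n).
Proof.
apply: measurable_fun_pair; first exact: measurable_coord.
apply: measurable_fun_coordP => k; under eq_fun do rewrite mxE.
exact: measurable_coord.
Qed.

Section step.
Variables (n : nat) (mu : {sigma_finite_measure set 'rV[R]_n -> \bar R}).

Definition rV_lebesgue_step : set 'rV[R]_n.+1 -> \bar R :=
  pushforward (@lebesgue_measure R \x mu)%E (@rV_cons n).

Let step0 : rV_lebesgue_step set0 = 0%E.
Proof. by rewrite /rV_lebesgue_step /pushforward preimage_set0 measure0. Qed.

Let step_ge0 A : (0 <= rV_lebesgue_step A)%E.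
Proof. by rewrite /rV_lebesgue_step /pushforward; exact: measure_ge0. Qed.

Let step_sigma_additive : semi_sigma_additive rV_lebesgue_step.
Proof.
move=> F mF tF mUF; rewrite /rV_lebesgue_step /pushforward preimage_bigcup.
have mc A : measurable A -> measurable (@rV_cons n @^-1` A).
  by move=> mA; rewrite -[X in measurable X]setTI; exact: measurable_rV_cons.
apply: measure_semi_sigma_additive.
- by move=> k; exact: mc.
- apply/trivIsetP => /= i j _ _ ij; rewrite -preimage_setI.
  by move/trivIsetP : tF => /(_ _ _ _ _ ij) ->//; rewrite preimage_set0.
- by rewrite -preimage_bigcup; exact: mc.
Qed.

HB.instance Definition _ := isMeasure.Build _ _ _ rV_lebesgue_step
  step0 step_ge0 step_sigma_additive.

Let step_sigma_finite : sigma_finite setT rV_lebesgue_step.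
Proof.
have /sigma_finiteP[F [TF ndF Foo]] := sigma_finiteT (@lebesgue_measure R).
have /sigma_finiteP[G [TG ndG Goo]] := sigma_finiteT mu.
exists (fun k => @rV_uncons n @^-1` (F k `*` G k)).
  rewrite -preimage_bigcup; apply/esym; rewrite -subTset => x _ /=.
  have [i _ Fi] : (\bigcup_i F i) (rV_uncons x).1 by rewrite -TF.
  have [k _ Gk] : (\bigcup_i G i) (rV_uncons x).2 by rewrite -TG.
  exists (maxn i k) => //; split.
    by move: Fi; exact/subsetPset/ndF/leq_maxl.
  by move: Gk; exact/subsetPset/ndG/leq_maxr.
move=> k; have [mF Fk] := Foo k; have [mG Gk] := Goo k; split.
  rewrite -[X in measurable X]setTI; apply: measurable_rV_uncons => //.
  exact: measurableX.
rewrite /rV_lebesgue_step /pushforward -comp_preimage.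
have -> : @rV_uncons n \o @rV_cons n = id by apply/funext/rV_consK.
by rewrite preimage_id product_measure1E// lte_mul_pinfty// ge0_fin_numE.
Qed.

HB.instance Definition _ := Measure_isSigmaFinite.Build _ _ _ rV_lebesgue_step
  step_sigma_finite.

End step.

Fixpoint rV_lebesgue n : {sigma_finite_measure set 'rV[R]_n -> \bar R} :=
  match n with
  | 0 => \d_(0 : 'rV[R]_0)
  | n'.+1 => rV_lebesgue_step (rV_lebesgue n')
  end.
End rV_lebesgue.

Section box.
Variable R : realType.

Definition box n (a : 'I_n -> R) : set 'rV[R]_n :=
  [set x | forall k, 0 <= x 0 k <= a k].

Lemma measurable_box n (a : 'I_n -> R) : measurable (box a).
Proof.
have -> : box a = \bigcap_(k in [set: 'I_n])
    (setT `&` (fun x : 'rV[R]_n => x 0 k : measurableTypeR R) @^-1` `[0, a k]).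
  apply/seteqP; split => x /= xa k.
    by move=> _; split => //=; rewrite in_itv/=; exact: xa.
  by have [_ /=] := xa k I; rewrite in_itv.
apply: fin_bigcap_measurable => // k _.
by apply: measurable_coord => //; exact: measurable_itv.
Qed.

Lemma rV_lebesgue_box n (a : 'I_n -> R) : (forall k, 0 <= a k) ->
  rV_lebesgue R n (box a) = (\prod_k a k)%:E.
Proof.
elim: n a => [|n IH] a a0 /=.
  by rewrite big_ord0 /dirac indicE mem_set// => -[].
rewrite /rV_lebesgue_step /pushforward.
have -> : @rV_cons R n @^-1` box a =
    [set` `[0, a ord0]] `*` box (fun k => a (lift ord0 k)).
  apply/seteqP; split => [[t x] /= tx|[t x] /= [t0 tx] k].
    split; first by have := tx ord0; rewrite rV_cons0 /= in_itv.
    by move=> k; have := tx (lift ord0 k); rewrite rV_consS.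
  case: (unliftP ord0 k) => [j|] ->; first by rewrite rV_consS.
  by rewrite rV_cons0; move: t0; rewrite /= in_itv.
rewrite product_measure1E//=; last exact: measurable_box.
rewrite IH//= lebesgue_measure_itv /= lte_fin big_ord_recl EFinM.
case: ltgtP (a0 ord0) => // [a00 _|<- _]; first by rewrite oppr0 adde0.
by rewrite !mul0e.
Qed.

End box.

Section euclidean.
Variable R : realType.

Definition dot n (x y : 'rV[R]_n) : R := \sum_k x 0 k * y 0 k.

(* The library norm on ['rV] is the sup norm. *)
Definition enorm n (x : 'rV[R]_n) : R := Num.sqrt (dot x x).

Definition opnorm m (A : 'M[R]_m) : R :=
  sup [set enorm (x *m A^T) | x in [set x : 'rV[R]_m | enorm x = 1]].

End euclidean.

Section neumann.
Variables (R : realType) (n : nat) (a : 'I_n -> R).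

Local Notation mu := (rV_lebesgue R n).
Local Notation F := (box a).
Definition partial (k : 'I_n) (psi : 'rV[R]_n -> R) : 'rV[R]_n -> R :=
  fun x => 'D_(delta_mx 0 k) psi x.

Definition L2 (f : 'rV[R]_n -> R) : Prop :=
  measurable_fun F f /\ mu.-integrable F (fun x => (f x ^+ 2)%:E).

Definition L2_dot (f g : 'rV[R]_n -> R) : R := \int[mu]_(x in F) (f x * g x).

Definition C1 (psi : 'rV[R]_n -> R) : Prop :=
  forall k, (forall x, derivable psi x (delta_mx 0 k)) /\
            continuous (partial k psi).

Definition zero_on_boundary (psi : 'rV[R]_n -> R) : Prop :=
  forall x, F x -> (exists k, x 0 k = 0 \/ x 0 k = a k) -> psi x = 0.

(* [f] is in the Sobolev space H^1(F), with weak gradient [G].  Since the C^1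
   functions vanishing on the boundary are dense in H^1_0(F), this is the same
   as testing against compactly supported smooth functions. *)
Definition weak_gradient (f : 'rV[R]_n -> R) (G : 'I_n -> 'rV[R]_n -> R) :
    Prop :=
  [/\ L2 f, forall k, L2 (G k) &
      forall psi, C1 psi -> zero_on_boundary psi ->
        forall k, L2_dot f (partial k psi) = - L2_dot (G k) psi].

(* The graph of the Laplacian in L_2(F) with Neumann boundary condition: [f] is
   in H^1(F), its distributional Laplacian is [h] in L_2(F), and the boundary
   term (the integral of psi * df/dn over the boundary) of Green's formula
   vanishes for every test function [psi], which is not required to vanish on
   the boundary.  On a box this is {f in H^2(F) | df/dn = 0 on the boundary}. *)
Definition neumann_laplacian (f h : 'rV[R]_n -> R) : Prop :=
  L2 h /\ exists G, weak_gradient f G /\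
    forall psi, C1 psi -> \sum_k L2_dot (G k) (partial k psi) = - L2_dot h psi.

(* The graph of the operator - kappa * Delta + V(x) in L_2^m(F) with Neumann
   boundary condition, Delta acting componentwise. *)
Definition schrodinger m (kappa : R) (V : 'rV[R]_n -> 'M[R]_m)
    (Phi Psi : 'rV[R]_n -> 'cV[R]_m) : Prop :=
  (forall i, L2 (fun x => Psi x i 0)) /\
  exists H : 'rV[R]_n -> 'cV[R]_m,
    (forall i, neumann_laplacian (fun x => Phi x i 0) (fun x => H x i 0)) /\
    {ae mu, forall x, F x -> Psi x = - kappa *: H x + V x *m Phi x}.

(* As V is real symmetric, the eigenvalues are real and every eigenspace has
   a basis of real-valued eigenfunctions. *)
Definition schrodinger_eigenvalue m (kappa : R) (V : 'rV[R]_n -> 'M[R]_m)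
    (Lam : R) : Prop :=
  exists Phi : 'rV[R]_n -> 'cV[R]_m,
    ~ {ae mu, forall x, F x -> Phi x = 0} /\
    schrodinger kappa V Phi (fun x => Lam *: Phi x).

End neumann.

Section lattice.
Variables (R : realType) (d : nat) (a : 'I_d -> R).

Definition half_lattice_vec (n : 'rV[int]_d) : 'rV[R]_d :=
  \row_k ((n 0 k)%:~R * pi / a k).

Definition half_lattice : set 'rV[R]_d := range half_lattice_vec.

Definition lattice : set 'rV[R]_d := [set 2 *: g | g in half_lattice].

Definition evec (i : 'I_d) : 'rV[R]_d := (pi / a i) *: delta_mx 0 i.

Definition ufun (g x : 'rV[R]_d) : R := \prod_k cos (g 0 k * x 0 k).

Definition coef (q : 'rV[R]_d -> R) (g : 'rV[R]_d) : R :=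
  L2_dot a q (ufun g) / fine (rV_lebesgue R d (box a)).

Definition smooth_coefs (l : R) (q : 'rV[R]_d -> R) : Prop :=
  (\esum_(n in [set: 'rV[int]_d])
     (`|coef q (half_lattice_vec n)| ^+ 2 *
      (1 + enorm (half_lattice_vec n) `^ (2 * l)))%:E < +oo)%E.

(* V_b(t) *)
Definition resonance (b : 'rV[R]_d) (t : R) : set 'rV[R]_d :=
  [set x | `| enorm x ^+ 2 - enorm (x + b) ^+ 2 | < t].

(* Gamma(r) *)
Definition lattice_ball (r : R) : set 'rV[R]_d :=
  [set b | half_lattice b /\ 0 < enorm b < r].

Definition minimal_on_line (g : 'rV[R]_d) : Prop :=
  forall v, lattice v -> (exists t, v = t *: g) -> v != 0 ->
    enorm g <= enorm v.

(* E_2, with r = p * rho ^ alpha and t = rho ^ alpha_2 *)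
Definition double_resonance (r t : R) : set 'rV[R]_d :=
  [set x | exists g1 g2 : 'rV[R]_d,
    [/\ lattice_ball r g1 /\ lattice_ball r g2,
        minimal_on_line g1 /\ minimal_on_line g2,
        free [:: g1; g2] &
        resonance g1 t x /\ resonance g2 t x]].

(* The sum over the integers, as the limit of the symmetric partial sums. *)
Definition int_sum (c : int -> R) : R :=
  limn (fun N : nat => \sum_(t < N.*2.+1) c (t%:Z - N%:Z)).

Variables (m : nat) (V : 'rV[R]_d -> 'M[R]_m) (delta : 'rV[R]_d).

Definition Pmx (s : R) : 'M[R]_m :=
  \matrix_(i, k) int_sum (fun n =>
    coef (fun x => V x i k) (n%:~R *: delta) * cos (n%:~R * s)).

Definition Pmx_sup : R := sup [set opnorm (Pmx s) | s in `[0, pi]].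

(* The operator T(P(s)) in L_2^m[0, pi], as the one-dimensional case of
   [schrodinger]. *)
Definition T_eigenvalue (lam : R) : Prop :=
  schrodinger_eigenvalue (fun _ : 'I_1 => pi) (enorm delta ^+ 2)
    (fun s => Pmx (s 0 0)) lam.

(* [lam] is an eigenvalue of T(P(s)) that may carry the index j.  The bound is
   not strict: for a constant P (in particular P = 0) the shift of an
   eigenvalue can be equal to the norm of P. *)
Definition T_eigenvalue_at (j : int) (lam : R) : Prop :=
  T_eigenvalue lam /\ `| lam - enorm (j%:~R *: delta) ^+ 2 | <= Pmx_sup.

(* [lam] is the eigenvalue lambda_{j,beta} = lambda_j + |beta|^2 of L(P(s)),
   which is the operator of [schrodinger] with potential P(x . delta). *)
Definition LP_eigenvalue_at (j : int) (beta : 'rV[R]_d) (lam : R) : Prop :=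
  schrodinger_eigenvalue a 1 (fun x => Pmx (dot x delta)) lam /\
  exists2 lamj, T_eigenvalue_at j lamj & lam = lamj + enorm beta ^+ 2.

End lattice.

(* Main.v *)
Require Import Defs.
From mathcomp Require Import all_boot all_order all_algebra.
From mathcomp Require Import all_classical all_reals all_analysis.
From mathcomp Require Import measurable_realfun ring lra zify.
Set Implicit Arguments.
Unset Strict Implicit.
Unset Printing Implicit Defensive.
Import Order.TTheory GRing.Theory Num.Theory.
Import numFieldNormedType.Exports.
Local Open Scope classical_set_scope.
Local Open Scope ring_scope.

(* In the basis of cosines L(V) becomes the matrix with diagonal |gamma_z|^2 plus
   the convolution kernel W((z,i),(w,k)) = v_ik(z - w), z, w in Z^d, acting on
   the vectors invariant under the sign changes of the coordinates; an
   eigenfunction of T(P(s)) becomes an eigenvector y of the part of this matrix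
   that lives on the line b + Z e_i.  Put X = rho^alpha and T = X^9 =
   rho^alpha_2.  Keep y only at the sites of the line whose diagonal entry is
   O(T) away from lambda (what is cut off has norm O(1/T)), and add the first
   order correction - (W y) / (|gamma_z|^2 - lambda) at the sites off this piece
   of line with ||gamma_z|^2 - lambda| >= T/64.  The remaining sites are at
   distance at least X from the piece of line: a step b1 orthogonal to delta is a
   multiple of the shortest lattice vector g on its line, and gamma, being
   resonant for delta and outside E_2, is not resonant for g, so the step changes
   the diagonal entry by about T.  There W is O(1/T) by the decay of the Fourier
   coefficients.  Hence the residual is O(1/T).

   The truncations of the matrix to large cubes therefore have eigenvalues
   lambda + O(1/T), and their normalised eigenvectors converge, along an
   ultrafilter, to a nonzero eigenvector of the whole matrix; it decays fast
   enough for its cosine series to be an eigenfunction of L(V). *)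

(** The first order correction is forced: off the piece of line [W y] is of order 1, so the cut-off
    vector alone has a residual that does not tend to 0; division by diagonal differences of order T
    turns it into O(1/T). There is room for this because alpha_k = 3^k alpha: resonance with delta
    at the scale rho^alpha_1 = X^3 only allows a one-dimensional eigenvalue of order X^6, well below
    T = X^9. The corrected vector is concentrated near one line and is not invariant under sign
    changes, so it is replaced by the sum of its 2^d images. Nothing cancels on the line: a sign
    change either takes a site out of the piece of line or to a site with the same value, y being
    even. For a truncated matrix, the eigenvalue near lambda comes from minimising a quadratic form
    on the invariant vectors. The limit vector is not zero because W is bounded while the diagonal
    tends to infinity: a fixed share of the mass of every truncated eigenvector stays on one finite
    set of sites. Moments of order 2d + 9 of the Fourier coefficients serve both purposes: 2d for
    summability over Z^d, 9 for the factor X^-9. *)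

(** * Measurability of continuous functions of a row vector *)

Section measurability.
Variable R : realType.

Lemma cvg_rV (T : Type) (G : set_system T) (FG : Filter G) n
    (f : T -> 'rV[R]_n) (l : 'rV[R]_n) :
  (forall k, (fun t => f t 0 k) @ G --> l 0 k) -> f @ G --> l.
Proof.
move=> fl; apply/cvgrPdist_lt => e e0.
have : \forall t \near G, forall k : 'I_n, `|l 0 k - f t 0 k| < e.
  by apply: filter_forall => k; have /cvgrPdist_lt/(_ _ e0) := fl k.
apply: filterS => t /= ft; rewrite [X in X < _](_ : _ = mx_norm (l - f t))//.
rewrite mx_normrE; apply/bigmax_ltP; split=> // -[i k] _ /=.
by rewrite ord1 !mxE; exact: ft.
Qed.

Lemma floor_grid_itv (k : nat) (t : R) (z : int) :
  (Num.floor (t * k.+1%:R) = z) <->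
  t \in `[z%:~R / k.+1%:R, (z + 1)%:~R / k.+1%:R[.
Proof.
have k0 : 0 < k.+1%:R :> R by rewrite ltr0n.
rewrite in_itv/= ler_pdivrMr// ltr_pdivlMr//; split.
  by move=> <-; exact: floor_itv.
exact: floor_def.
Qed.

(** [f] is arbitrary here: rounding down to the grid takes countably many values, so every preimage
    is a countable union of half-open boxes. *)
Lemma measurable_grid_comp n (f : 'rV[R]_n -> R) (k : nat) :
  measurable_fun [set: 'rV[R]_n] (fun x => f (\row_i
    ((Num.floor (x 0 i * k.+1%:R))%:~R / k.+1%:R)) : R).
Proof.
move=> _ Y mY; rewrite setTI.
pose P (z : 'rV[int]_n) : set 'rV[R]_n :=
  [set x | Y (f (\row_i ((z 0 i)%:~R / k.+1%:R))) /\
     forall i : 'I_n, x 0 i \in `[(z 0 i)%:~R / k.+1%:R, (z 0 i + 1)%:~R / k.+1%:R[].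
rewrite (_ : _ @^-1` _ = \bigcup_z P z); last first.
  apply/seteqP; split => [x /= Yx|x [z _ [Yz xz]] /=].
    exists (\row_i Num.floor (x 0 i * k.+1%:R)) => //; split.
      congr Y : Yx; congr f; apply/rowP => i; rewrite !mxE//.
    by move=> i; rewrite !mxE; apply/floor_grid_itv.
  congr Y : Yz; congr f; apply/rowP => i; rewrite !mxE//.
  by have /floor_grid_itv -> := xz i.
apply: countable_bigcupT_measurable => [|z]; first exact: countableP.
have [Yz|nYz] := pselect (Y (f (\row_i ((z 0 i)%:~R / k.+1%:R)))); last first.
  by rewrite (_ : P z = set0)//; apply/seteqP; split => x // -[].
rewrite (_ : P z = \bigcap_(i in [set: 'I_n]) (setT `&`
   (fun x : 'rV[R]_n => x 0 i : measurableTypeR R) @^-1` 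
  `[(z 0 i)%:~R / k.+1%:R, (z 0 i + 1)%:~R / k.+1%:R[)).
  apply: fin_bigcap_measurable => // i _.
  by apply: measurable_coord => //; exact: measurable_itv.
apply/seteqP; split => [x [_ xz] i _ /=|x xz]; first by split => //; exact: xz.
by split => // i; have [] := xz i I.
Qed.

(** The sigma-algebra is the one generated by the coordinates, so open sets are not at hand; instead
    [f] is the pointwise limit of its values at the grid points of mesh 1/(k+1). *)
Lemma continuous_measurable_rV n (f : 'rV[R]_n -> R) :
  continuous f -> measurable_fun [set: 'rV[R]_n] f.
Proof.
move=> cf.
apply: (measurable_realfun.measurable_fun_cvg (measurable_grid_comp f)) => x _.
apply: (@continuous_cvg _ _ _ eventually _ (fun k : nat => 
  (\row_i ((Num.floor (x 0 i * k.+1%:R))%:~R / k.+1%:R) : 'rV[R]_n)) f x).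
  exact: cf.
apply: cvg_rV => i; under eq_fun do rewrite mxE.
apply/cvgrPdist_lt => e e0; near=> k.
have k0 : 0 < k.+1%:R :> R by rewrite ltr0n.
have /andP[] := floor_itv (x 0 i * k.+1%:R).
rewrite -ler_pdivrMr// => h1; rewrite -ltr_pdivlMr// => h2.
rewrite ger0_norm ?subr_ge0// ltrBlDl; apply: lt_le_trans h2 _.
rewrite intrD mulrDl lerD2l mul1r; near: k.
by apply: filterS (near_infty_natSinv_lt (PosNum e0)) => j /=; exact: ltW.
Unshelve. all: by end_near.
Qed.

End measurability.

(** * Integration over boxes *)

Section box_integral.
Variable R : realType.

Lemma rV_lebesgue_box_lty n (a : 'I_n -> R) : (forall k, 0 <= a k) ->
  (rV_lebesgue R n (box a) < +oo)%E.
Proof. by move=> a0; rewrite rV_lebesgue_box// ltry. Qed.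

Lemma integrable_bounded d (T : measurableType d) (mu : measure T R) (D : set T)
    (f : T -> R) (M : R) :
  measurable D -> (mu D < +oo)%E -> measurable_fun D f ->
  (forall x, D x -> `|f x| <= M) -> mu.-integrable D (EFin \o f).
Proof.
move=> mD Doo mf fM; apply: measurable_bounded_integrable => //.
exists M; split; first exact: num_real.
by move=> N MN x Dx /=; apply: le_trans (fM x Dx) (ltW MN).
Qed.

Lemma preimage_cons_box n (a : 'I_n.+1 -> R) :
  @rV_cons R n @^-1` box a =
    [set` `[0, a ord0]] `*` box (fun k => a (lift ord0 k)).
Proof.
apply/seteqP; split => [[t x] /= tx|[t x] /= [t0 tx] k].
  split; first by have := tx ord0; rewrite rV_cons0 /= in_itv.
  by move=> k; have := tx (lift ord0 k); rewrite rV_consS.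
case: (unliftP ord0 k) => [j|] ->; first by rewrite rV_consS.
by rewrite rV_cons0; move: t0; rewrite /= in_itv.
Qed.

Section fubini.
Variables (n : nat) (a : 'I_n.+1 -> R) (f : 'rV[R]_n.+1 -> R) (M : R).
Hypothesis a0 : forall k, 0 <= a k.
Hypothesis mf : measurable_fun [set: 'rV[R]_n.+1] f.
Hypothesis fM : forall x, box a x -> `|f x| <= M.

Let A := [set` `[0, a ord0]].
Let a' k := a (lift ord0 k).
Let B := box a'.
Let mu := rV_lebesgue R n.
Let h := (EFin \o (f \o @rV_cons R n)) \_ (A `*` B).

Let mA : measurable (A : set (measurableTypeR R)).
Proof. exact: measurable_itv. Qed.

Let Aoo : (@lebesgue_measure R A < +oo)%E.
Proof. by rewrite lebesgue_measure_itv/=; case: ifP => //; rewrite ltry. Qed.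

Let mB : measurable B. Proof. exact: measurable_box. Qed.

Let Boo : (mu B < +oo)%E.
Proof. by apply: rV_lebesgue_box_lty => k; exact: a0. Qed.

Let mAB : measurable (A `*` B : set (measurableTypeR R * 'rV[R]_n)).
Proof. exact: measurableX. Qed.

Let mfc : measurable_fun setT (f \o @rV_cons R n).
Proof. by apply: measurableT_comp => //; exact: measurable_rV_cons. Qed.

Let intf : (@lebesgue_measure R \x mu)%E.-integrable (A `*` B)
  (EFin \o (f \o @rV_cons R n)).
Proof.
apply: (@integrable_bounded _ _ _ _ _ M) => //.
- by rewrite /= product_measure1E// lte_mul_pinfty// ge0_fin_numE.
- by apply: measurable_funTS.
- by move=> x; rewrite -preimage_cons_box => /fM.
Qed.

Let inth : (@lebesgue_measure R \x mu)%E.-integrable setT h.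
Proof. by apply/(integrable_mkcond _ _).1. Qed.

Let eqint : (\int[rV_lebesgue R n.+1]_(x in box a) (f x)%:E =
  \int[@lebesgue_measure R \x mu]_x h x)%E.
Proof.
rewrite /= integral_pushforward//=.
- rewrite preimage_cons_box [LHS]integral_mkcond; exact: eq_integral.
- exact: measurable_rV_cons.
- exact/measurable_realfun.measurable_EFinP.
- by rewrite preimage_cons_box.
- exact: measurable_box.
Qed.

(** Both orders of integration are stated: the first coordinate outermost for inductions on the
    dimension, innermost for the fundamental theorem of calculus in that coordinate. *)
Lemma Rintegral_rV_cons :
  \int[rV_lebesgue R n.+1]_(x in box a) f x =
  \int[@lebesgue_measure R]_(t in `[0, a ord0])
    \int[rV_lebesgue R n]_(y in box (fun k => a (lift ord0 k))) f (rV_cons (t, y)).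
Proof.
rewrite /Rintegral eqint -integral12_prod_meas1//; congr fine.
rewrite [RHS]integral_mkcond; apply: eq_integral => t _.
rewrite /fubini_F /h !patchE; case: ifPn => tA.
  rewrite fineK; last first.
    apply: integrable_fin_num => //.
    apply: (@integrable_bounded _ _ _ _ _ M) => //.
    - apply: measurable_funTS; apply: measurableT_comp => //.
      by apply: measurableT_comp; [exact: measurable_rV_cons|exact: measurable_pair1].
    - move=> x Bx; apply: fM; have : (A `*` B) (t, x) by split => //; exact: set_mem.
      by rewrite -preimage_cons_box.
  rewrite [RHS]integral_mkcond; apply: eq_integral => y _ /=.
  by rewrite !patchE in_setX/= (_ : t \in A)//.
rewrite -[RHS](integral0 mu setT); apply: eq_integral => y _.
by rewrite patchE in_setX/= (negbTE (_ : t \notin A)).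
Qed.

Lemma Rintegral_rV_consC :
  \int[rV_lebesgue R n.+1]_(x in box a) f x =
  \int[rV_lebesgue R n]_(y in box (fun k => a (lift ord0 k)))
  \int[@lebesgue_measure R]_(t in `[0, a ord0]) f (rV_cons (t, y)).
Proof.
rewrite /Rintegral eqint -integral12_prod_meas1//; congr fine.
rewrite [LHS](Fubini inth).
rewrite [RHS]integral_mkcond; apply: eq_integral => y _.
rewrite /h !patchE; case: ifPn => yB.
  rewrite fineK; last first.
    apply: integrable_fin_num => //.
    apply: (@integrable_bounded _ _ _ _ _ M) => //.
    - apply: measurable_funTS; apply: measurableT_comp => //.
      by apply: measurableT_comp; [exact: measurable_rV_cons|exact: measurable_pair2].
    - move=> t At; apply: fM; have : (A `*` B) (t, y) by split => //; exact: set_mem.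
      by rewrite -preimage_cons_box.
  rewrite [RHS]integral_mkcond; apply: eq_integral => t _ /=.
  by rewrite !patchE in_setX/= (_ : y \in B)// andbT.
rewrite -[RHS](integral0 lebesgue_measure setT); apply: eq_integral => t _.
by rewrite patchE in_setX/= (negbTE (_ : y \notin B))// andbF.
Qed.

End fubini.
End box_integral.

(** * Integration by parts on a box *)

Section integration_by_parts.
Variable R : realType.

(** A directional derivative sees a function along one line only, and [phi] maps the line through
    [x] to a line of direction [v]: the two difference quotients are equal. *)
Lemma is_derive_comp_line (U V : normedModType R) (phi : U -> V) (u : U) (v : V)
    (x : U) (h : V -> R) (dh : R) :
  (forall e : R, phi (e *: u + x) = e *: v + phi x) ->
  is_derive (phi x) v h dh -> is_derive x u (h \o phi) dh.
Proof.
move=> phiE [hd hE].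
have E : (fun e : R => e^-1 *: ((h \o phi \o shift x) (e *: u) - (h \o phi) x)) =
    (fun e : R => e^-1 *: ((h \o shift (phi x)) (e *: v) - h (phi x))).
  by apply/funext => e /=; rewrite phiE.
by split; [rewrite /derivable E; exact: hd | rewrite /derive E; exact: hE].
Qed.

Lemma rV_cons_line n (t e : R) (y : 'rV[R]_n) :
  rV_cons (e *: (1 : R^o) + t, y) = e *: delta_mx 0 ord0 + rV_cons (t, y).
Proof.
apply/rowP => k; rewrite [RHS]mxE; case: (unliftP ord0 k) => [j|] ->.
  by rewrite !rV_consS !mxE eqxx /= mulr0 add0r.
by rewrite !rV_cons0 !mxE eqxx.
Qed.

Lemma rV_cons_lineS n (t e : R) (y : 'rV[R]_n) j :
  rV_cons (t, e *: delta_mx 0 j + y) =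
  e *: delta_mx 0 (lift ord0 j) + rV_cons (t, y).
Proof.
apply/rowP => k; rewrite [RHS]mxE; case: (unliftP ord0 k) => [i|] ->.
  by rewrite !rV_consS !mxE eqxx /= (inj_eq (@lift_inj _ _)).
by rewrite !rV_cons0 !mxE eqxx /= mulr0 add0r.
Qed.

Lemma compact_box n (a : 'I_n -> R) : compact (box a).
Proof.
rewrite (_ : box a = [set v : 'rV[R]_n | forall i, [set` `[0, a i]] (v ord0 i)]).
  by apply: (@rV_compact R n (fun k => [set` `[0, a k]])) => k; exact: segment_compact.
by apply/seteqP; split => x /= H k; have := H k; rewrite in_itv.
Qed.

Lemma continuous_bounded_box n (a : 'I_n -> R) (g : 'rV[R]_n -> R) :
  continuous g -> exists M, forall x, box a x -> `|g x| <= M.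
Proof.
move=> cg.
have /compact_bounded[M [_ gM]] : compact (g @` box a).
  apply: continuous_compact; last exact: compact_box.
  by apply: continuous_subspaceT.
by exists (M + 1) => x ax; apply: gM; [rewrite ltrDl|exists x].
Qed.

Lemma continuous_rV_consl n (y : 'rV[R]_n) :
  continuous (fun t : R => rV_cons (t, y)).
Proof.
move=> t; apply: cvg_rV => k; case: (unliftP ord0 k) => [j|] ->.
  under eq_fun do rewrite rV_consS /=.
  by rewrite rV_consS; exact: cvg_cst.
under eq_fun do rewrite rV_cons0 /=.
by rewrite rV_cons0.
Qed.

Lemma continuous_rV_consr n (t : R) :
  continuous (fun y : 'rV[R]_n => rV_cons (t, y)).
Proof.
move=> y; apply: (cvg_rV (nbhs_filter y)) => k; case: (unliftP ord0 k) => [j|] ->.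
  under eq_fun do rewrite rV_consS /=.
  by rewrite rV_consS /=; exact: coord_continuous.
under eq_fun do rewrite rV_cons0 /=.
by rewrite rV_cons0 /=; exact: (@cst_continuous _ _ t y).
Qed.

Lemma Rintegral_FTC0 (b : R) (h g : R -> R) : 0 < b -> continuous g ->
  (forall t : R, is_derive (t : R^o) (1 : R^o) (h : R^o -> R^o) (g t)) -> h 0 = h b ->
  \int[@lebesgue_measure R]_(t in `[0, b]) g t = 0.
Proof.
move=> b0 cg hg h0b.
have ch : continuous h.
  by move=> t; apply: differentiable_continuous; apply/derivable1_diffP;
    case: (hg t).
rewrite /Rintegral (@continuous_FTC2 _ g h)//.
- by rewrite h0b subee.
- by apply: continuous_subspaceT.
- split=> [t _||]; first by case: (hg t).
  + by apply: cvg_at_right_filter; exact: ch.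
  + by apply: cvg_at_left_filter; exact: ch.
- by move=> t _; rewrite derive1E; case: (hg t).
Qed.

(* The integral of a partial derivative only sees the two faces it crosses *)
Lemma Rintegral_partial_eq0 n (a : 'I_n -> R) (h g : 'rV[R]_n -> R) k :
  (forall j, 0 < a j) -> continuous g ->
  (forall x, is_derive x (delta_mx 0 k : 'rV[R]_n) h (g x)) ->
  (forall x, box a x -> x 0 k = 0 \/ x 0 k = a k -> h x = 0) ->
  \int[rV_lebesgue R n]_(x in box a) g x = 0.
Proof.
elim: n a h g k => [|n IH] a h g k a0 cg hg h0; first by case: k hg h0.
have [M gM] := continuous_bounded_box a cg.
have age0 j : 0 <= a j by exact: ltW.
have mg := continuous_measurable_rV cg.
(* For a later coordinate the first one is a parameter and induction applies to each slice; for the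
   first coordinate the inner integral is already 0, as both ends lie on the two faces. *)
case: (unliftP ord0 k) => [j|] kE; rewrite {}kE in hg h0 *.
  rewrite (Rintegral_rV_cons age0 mg gM).
  transitivity (\int[@lebesgue_measure R]_(t in `[0, a ord0]) 0 : R).
    apply: eq_Rintegral => t tA.
    apply: (IH _ (h \o (fun y => rV_cons (t, y))) _ j) => //.
    - by move=> y; apply: continuous_comp; [exact: continuous_rV_consr|exact: cg].
    - move=> y; apply: (is_derive_comp_line (v := delta_mx 0 (lift ord0 j))) => //.
      by move=> e; rewrite rV_cons_lineS.
    - move=> y yB yj /=; apply: h0; last by rewrite rV_consS.
      have : ([set` `[0, a ord0]] `*` box (fun k => a (lift ord0 k))) (t, y).
        by split => //; exact: set_mem.
      by rewrite -preimage_cons_box.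
  by rewrite Rintegral_cst// ?mul0r.
rewrite (Rintegral_rV_consC age0 mg gM).
transitivity (\int[rV_lebesgue R n]_(y in box (fun k => a (lift ord0 k))) 0 : R).
  apply: eq_Rintegral => y yB.
  apply: (Rintegral_FTC0 (h := h \o (fun t => rV_cons (t, y)))) => //.
  - by move=> t; apply: continuous_comp; [exact: continuous_rV_consl|exact: cg].
  - move=> t; apply: (is_derive_comp_line (v := delta_mx 0 ord0)) => //.
    by move=> e; rewrite rV_cons_line.
  - have H t : 0 <= t <= a ord0 -> box a (rV_cons (t, y)).
      move=> t0; have : ([set` `[0, a ord0]] `*` box (fun k => a (lift ord0 k))) (t, y).
        by split; [rewrite /= in_itv|exact: set_mem].
      by rewrite -preimage_cons_box.
    rewrite /= (h0 (rV_cons (0, y))) ?(h0 (rV_cons (a ord0, y))) ?rV_cons0//;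
    by [right|left|apply: H; rewrite lexx age0].
rewrite Rintegral_cst ?mul0r//; exact: measurable_box.
Qed.

End integration_by_parts.

(** * Sign changes and products of cosines *)

Section cosines.
Variable R : realType.

Definition flip (A : pzRingType) n (s : {ffun 'I_n -> bool}) (x : 'rV[A]_n) :=
  \row_k ((-1) ^+ s k * x 0 k).

Lemma flipK (A : pzRingType) n (s : {ffun 'I_n -> bool}) :
  involutive (@flip A n s).
Proof. by move=> x; apply/rowP => k; rewrite !mxE signrMK. Qed.

Lemma flipB (A : pzRingType) n (s : {ffun 'I_n -> bool}) (x y : 'rV[A]_n) :
  flip s (x - y) = flip s x - flip s y.
Proof. by apply/rowP => k; rewrite !mxE mulrBr. Qed.

Lemma flipN (A : pzRingType) n (x : 'rV[A]_n) : flip [ffun => true] x = - x.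
Proof. by apply/rowP => k; rewrite !mxE ffunE expr1 mulN1r. Qed.

Lemma flip0 (A : pzRingType) n (x : 'rV[A]_n) : flip [ffun => false] x = x.
Proof. by apply/rowP => k; rewrite !mxE ffunE expr0 mul1r. Qed.

Lemma half_lattice_vec_flip n (a : 'I_n -> R) s (z : 'rV[int]_n) :
  half_lattice_vec a (flip s z) = flip s (half_lattice_vec a z).
Proof.
apply/rowP => k; rewrite !mxE intrM -!mulrA; congr (_ * _).
by case: (s k); rewrite ?expr0 ?expr1 ?mulrN1z ?mulr1z.
Qed.

Lemma half_lattice_vecD n (a : 'I_n -> R) (z w : 'rV[int]_n) :
  half_lattice_vec a (z + w) = half_lattice_vec a z + half_lattice_vec a w.
Proof. by apply/rowP => k; rewrite !mxE intrD !mulrDl. Qed.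

Lemma half_lattice_vecB n (a : 'I_n -> R) (z w : 'rV[int]_n) :
  half_lattice_vec a (z - w) = half_lattice_vec a z - half_lattice_vec a w.
Proof. by apply/rowP => k; rewrite !mxE intrD intrN !mulrDl !mulNr. Qed.

Lemma ufun_flip n s (g x : 'rV[R]_n) : ufun (flip s g) x = ufun g x.
Proof.
apply: eq_bigr => k _; rewrite mxE.
by case: (s k); rewrite ?expr0 ?mul1r// expr1 mulN1r mulNr cosN.
Qed.

(** The formula for the product of two cosines in every coordinate; when the product over the
    coordinates is expanded, the choices of sign form the vector [s]. *)
Lemma ufunM n (g h x : 'rV[R]_n) :
  ufun g x * ufun h x =
  (2 ^+ n)^-1 * \sum_(s : {ffun 'I_n -> bool}) ufun (g + flip s h) x.
Proof.
have -> : \sum_(s : {ffun 'I_n -> bool}) ufun (g + flip s h) x =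
    \prod_k \sum_(b : bool) cos ((g 0 k + (-1) ^+ b * h 0 k) * x 0 k).
  rewrite bigA_distr_bigA; apply: eq_bigr => s _.
  by apply: eq_bigr => k _; rewrite !mxE.
have -> : (2 ^+ n)^-1 = \prod_(k < n) 2^-1 :> R.
  by rewrite prodr_const card_ord exprVn.
rewrite /ufun -!big_split/=.
apply: eq_bigr => k _; rewrite big_bool/= expr0 expr1 mul1r mulN1r.
rewrite mulrBl mulrDl cosB cosD.
have n2 : 2 != 0 :> R by rewrite pnatr_eq0.
by field.
Qed.

Lemma ufun_le1 n (g x : 'rV[R]_n) : `|ufun g x| <= 1.
Proof.
rewrite normr_prod; apply: le_trans (_ : \prod_(k < n) 1 <= _); last by rewrite big1.
by apply: ler_prod => k _; rewrite normr_ge0 cos_max.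
Qed.

Lemma ufun0 n (x : 'rV[R]_n) : ufun 0 x = 1.
Proof. by rewrite /ufun big1// => k _; rewrite mxE mul0r cos0. Qed.

Lemma continuous_prodr (T : topologicalType) (I : Type) (r : seq I) (P : pred I)
    (f : I -> T -> R) :
  (forall i, P i -> continuous (f i)) ->
  continuous (fun x => \prod_(i <- r | P i) f i x).
Proof. by move=> cf; apply: continuous_big => //; exact: mul_continuous. Qed.

Lemma continuous_coordM n (c : R) (k : 'I_n) :
  continuous (fun x : 'rV[R]_n => c * x 0 k).
Proof.
move=> x; apply: (@continuousM _ _ (fun=> c) (fun x : 'rV[R]_n => x 0 k)).
  exact: cst_continuous.
exact: coord_continuous.
Qed.

Lemma continuous_ufun n (g : 'rV[R]_n) : continuous (ufun g).
Proof.
apply: continuous_prodr => k _ x.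
apply: (@continuous_comp _ _ _ (fun x : 'rV[R]_n => g 0 k * x 0 k) cos).
  exact: continuous_coordM.
exact: continuous_cos.
Qed.

Definition dufun n (g : 'rV[R]_n) (k : 'I_n) (x : 'rV[R]_n) : R :=
  - (g 0 k * sin (g 0 k * x 0 k)) * \prod_(j | j != k) cos (g 0 j * x 0 j).

Lemma continuous_dufun n (g : 'rV[R]_n) k : continuous (dufun g k).
Proof.
have H (f : R -> R) (j : 'I_n) : continuous f ->
    continuous (fun x : 'rV[R]_n => f (g 0 j * x 0 j)).
  by move=> cf x; apply: (@continuous_comp _ _ _ (fun x : 'rV[R]_n => g 0 j * x 0 j) f);
    [exact: continuous_coordM|exact: cf].
rewrite /dufun => x; apply: (@continuousM _ _ (fun x : 'rV[R]_n => - (g 0 k * sin (g 0 k * x 0 k)))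
  (fun x : 'rV[R]_n => \prod_(j | j != k) cos (g 0 j * x 0 j))).
  apply: (H (fun t => - (g 0 k * sin t))) => t; apply: cvgN.
  by apply: cvgM; [exact: cvg_cst|exact: continuous_sin].
by apply: continuous_prodr => j _; apply: H; exact: continuous_cos.
Qed.

Lemma dufun_le n (g x : 'rV[R]_n) k : `|dufun g k x| <= `|g 0 k|.
Proof.
rewrite normrM normrN normrM -[leRHS]mulr1 -mulrA; apply: ler_wpM2l => //.
rewrite -[leRHS]mulr1; apply: ler_pM => //; first exact: sin_max.
rewrite normr_prod; apply: le_trans (_ : \prod_(j < n | j != k) 1 <= _).
  by apply: ler_prod => j _; rewrite normr_ge0 cos_max.
by rewrite big1.
Qed.

Lemma is_derive_coord n (c : R -> R) (dc : R) (r : 'rV[R]_n -> R) (x : 'rV[R]_n) k :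
  is_derive (x 0 k : R^o) (1 : R^o) (c : R^o -> R^o) dc ->
  (forall e : R, r (e *: delta_mx 0 k + x) = r x) ->
  is_derive x (delta_mx 0 k : 'rV[R]_n) (fun y => c (y 0 k) * r y) (dc * r x).
Proof.
move=> hc hr.
have h1 : is_derive x (delta_mx 0 k : 'rV[R]_n) (fun y => c (y 0 k)) dc.
  apply: (@is_derive_comp_line R _ R^o (fun y : 'rV[R]_n => y 0 k) _ 1) => //.
  by move=> e; rewrite !mxE !eqxx.
have h2 : is_derive x (delta_mx 0 k : 'rV[R]_n) r 0.
  have -> : r = (fun y : 'rV[R]_n => r y) by [].
  split; rewrite /derivable/= /derive.
    apply: cvgP (_ : _ --> (0 : R)).
    rewrite (_ : (fun _ => _) = fun=> 0); first exact: cvg_cst.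
    by apply/funext => e /=; rewrite hr subrr scaler0.
  rewrite (_ : (fun _ => _) = fun=> 0) ?lim_cst//.
  by apply/funext => e /=; rewrite hr subrr scaler0.
have := is_deriveM h1 h2; rewrite scaler0 add0r [r x *: dc]mulrC.
exact.
Qed.

Lemma prod_cos_line n (g x : 'rV[R]_n) k (e : R) :
  \prod_(j | j != k) cos (g 0 j * (e *: delta_mx 0 k + x) 0 j) =
  \prod_(j | j != k) cos (g 0 j * x 0 j).
Proof.
apply: eq_bigr => j jk; rewrite !mxE (negbTE jk) andbF mulr0 add0r//.
Qed.

Lemma is_derive_scale (f : R -> R) (c t df : R) :
  is_derive (c * t : R^o) (1 : R^o) (f : R^o -> R^o) df ->
  is_derive (t : R^o) (1 : R^o) ((fun u => f (c * u)) : R^o -> R^o) (c * df).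
Proof.
move=> hf; have hc : is_derive (t : R^o) (1 : R^o) (( *%R c) : R^o -> R^o) c.
  have := is_deriveM (is_derive_cst c (t : R^o) (1 : R^o)) (is_derive_id (t : R^o) (1 : R^o)).
  rewrite scaler0 addr0 [_ *: _]mulr1; exact.
by rewrite mulrC; exact: (is_derive1_comp hf hc).
Qed.

Lemma is_derive_ufun n (g x : 'rV[R]_n) k :
  is_derive x (delta_mx 0 k : 'rV[R]_n) (ufun g) (dufun g k x).
Proof.
rewrite (_ : ufun g = fun y : 'rV[R]_n => (fun t => cos (g 0 k * t)) (y 0 k) *
  \prod_(j | j != k) cos (g 0 j * y 0 j)); last first.
  by apply/funext => y; rewrite /ufun (bigD1 k).
apply: (@is_derive_coord _ (fun t => cos (g 0 k * t))) => [|e]; last exact: prod_cos_line.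
by rewrite -mulrN; apply: is_derive_scale; exact: is_derive_cos.
Qed.

Lemma is_derive_dufun n (g x : 'rV[R]_n) k :
  is_derive x (delta_mx 0 k : 'rV[R]_n) (dufun g k) (- g 0 k ^+ 2 * ufun g x).
Proof.
have -> : - g 0 k ^+ 2 * ufun g x = (g 0 k * (- g 0 k * cos (g 0 k * x 0 k))) *
    \prod_(j | j != k) cos (g 0 j * x 0 j).
  by rewrite /ufun (bigD1 k)//=; ring.
apply: (@is_derive_coord _ (fun t => - (g 0 k * sin (g 0 k * t)))) => [|e]; last exact: prod_cos_line.
apply: (is_derive_scale (f := fun t => - (g 0 k * sin t))).
have := is_deriveM (is_derive_cst (- g 0 k) (g 0 k * x 0 k : R^o) (1 : R^o)) (is_derive_sin (g 0 k * x 0 k)).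
rewrite scaler0 addr0; congr is_derive.
by apply/funext => t; rewrite /= -mulNr.
Qed.

Lemma sin_int_pi (z : int) : sin (z%:~R * pi) = 0 :> R.
Proof.
have sn (m : nat) : sin (m%:R * pi) = 0 :> R.
  elim: m => [|m IH]; first by rewrite mul0r sin0.
  by rewrite -natr1 mulrDl mul1r sinDpi IH oppr0.
by case: z => m; [exact: sn|rewrite NegzE mulrNz mulNr sinN sn oppr0].
Qed.

(** This is the Neumann condition: at the two faces the argument of the sine is 0 or a multiple of
    pi. *)
Lemma dufun_face n (a : 'I_n -> R) (z : 'rV[int]_n) k (x : 'rV[R]_n) :
  a k != 0 -> x 0 k = 0 \/ x 0 k = a k -> dufun (half_lattice_vec a z) k x = 0.
Proof.
move=> ak [xk|xk]; rewrite /dufun xk mxE.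
  by rewrite mulr0 sin0 mulr0 oppr0 mul0r.
by rewrite mulfVK// sin_int_pi mulr0 oppr0 mul0r.
Qed.

End cosines.

(** * Unordered sums *)

Section unordered_sums.
Variables (R : realType) (T : choiceType).
Implicit Types (c : T -> R) (s : seq T).

Lemma big_subseq_split c s0 s : uniq s0 -> uniq s -> {subset s0 <= s} ->
  \sum_(x <- s) c x = \sum_(x <- s0) c x + \sum_(x <- s | x \notin s0) c x.
Proof.
move=> us0 us s0s; rewrite (bigID (mem s0))/=; congr (_ + _).
rewrite -big_filter; apply: perm_big; apply: uniq_perm => //.
  exact: filter_uniq.
by move=> x; rewrite mem_filter; case: (boolP (x \in s0)) => //= /s0s ->.
Qed.

Lemma ler_sum_subset c s0 s : uniq s0 -> uniq s -> {subset s0 <= s} ->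
  (forall x, 0 <= c x) -> \sum_(x <- s0) c x <= \sum_(x <- s) c x.
Proof.
move=> us0 us s0s c0; rewrite (big_subseq_split c us0 us s0s).
by rewrite lerDl sumr_ge0.
Qed.

(** Absolute summability in a form that needs no enumeration of the index type. *)
Definition sums_le c (M : R) := forall s, uniq s -> \sum_(x <- s) `|c x| <= M.

Lemma sums_le_ge0 c M : sums_le c M -> 0 <= M.
Proof. by move=> /(_ [::] isT); rewrite big_nil. Qed.

Lemma sums_le_term c M x : sums_le c M -> `|c x| <= M.
Proof. by move=> /(_ [:: x] isT); rewrite big_seq1. Qed.

Lemma le_sums_le c c' M : (forall x, `|c' x| <= `|c x|) -> sums_le c M -> sums_le c' M.
Proof. by move=> cc cM s us; apply: le_trans (cM s us); apply: ler_sum. Qed.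

Definition psum c : R := sup [set \sum_(x <- s) c x | s in [set s | uniq s]].

(** Positive part minus negative part. By [usum_approx] this is, for absolutely summable [c], the
    limit along finite sets ordered by inclusion; its properties are derived from that. *)
Definition usum c : R :=
  psum (fun x => Num.max (c x) 0) - psum (fun x => Num.max (- c x) 0).

Section psum.
Variables (c : T -> R) (M : R).
Hypotheses (c0 : forall x, 0 <= c x) (cM : sums_le c M).

Let S : set R := [set \sum_(x <- s) c x | s in [set s | uniq s]].

Let SM : has_sup S.
Proof.
split; first by exists 0, [::] => //=; rewrite big_nil.
exists M => _ [s us <-]; apply: le_trans (cM us); apply: ler_sum => x _.
exact: ler_norm.
Qed.

Lemma psum_ub s : uniq s -> \sum_(x <- s) c x <= psum c.
Proof. by move=> us; apply: ub_le_sup; [case: SM|exists s]. Qed.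

Lemma psum_le : psum c <= M.
Proof.
apply: ge_sup; first by case: SM.
move=> _ [s us <-]; apply: le_trans (cM us); apply: ler_sum => x _.
exact: ler_norm.
Qed.

Lemma psum_approx (e : R) : 0 < e -> exists2 s0, uniq s0 & forall s, uniq s ->
  {subset s0 <= s} -> psum c - e <= \sum_(x <- s) c x.
Proof.
move=> e0; have [_ [s0 us0 <-] h] := sup_adherent e0 SM.
exists s0 => // s us s0s; apply: le_trans (ltW h) _.
exact: ler_sum_subset.
Qed.

End psum.

(** A list disjoint from [s0] can be appended to it without leaving the supremum, which [s0] already
    reaches up to [e]. *)
Lemma sums_le_tail c M (e : R) : sums_le c M -> 0 < e ->
  exists2 s0, uniq s0 & forall s, uniq s -> (forall x, x \in s -> x \notin s0) ->
    \sum_(x <- s) `|c x| <= e.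
Proof.
move=> cM e0; have cM' : sums_le (fun x => `|c x|) M.
  by move=> s us; under eq_bigr do rewrite normr_id; exact: cM.
have n0 x : 0 <= `|c x| by [].
have [s0 us0 h] := psum_approx n0 cM' e0; exists s0 => // s us ss0.
have := h s0 us0 (fun _ => id).
have us' : uniq (s0 ++ s).
  rewrite cat_uniq us0 us andbT /=; apply/hasPn => x xs; exact: ss0.
have := psum_ub cM' us'; rewrite big_cat/=; lra.
Qed.

Lemma usum_approx c M (e : R) : sums_le c M -> 0 < e ->
  exists2 s0, uniq s0 & forall s, uniq s -> {subset s0 <= s} ->
    `|\sum_(x <- s) c x - usum c| <= e.
Proof.
move=> cM e0.
have p0 x : 0 <= Num.max (c x) 0 by rewrite le_max lexx orbT.
have n0 x : 0 <= Num.max (- c x) 0 by rewrite le_max lexx orbT.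
have pM : sums_le (fun x => Num.max (c x) 0) M.
  apply: le_sums_le cM => x; rewrite ger0_norm// ge_max normr_ge0 andbT.
  exact: ler_norm.
have nM : sums_le (fun x => Num.max (- c x) 0) M.
  apply: le_sums_le cM => x; rewrite ger0_norm// ge_max normr_ge0 andbT.
  by rewrite -normrN ler_norm.
have [s1 us1 h1] := psum_approx p0 pM e0.
have [s2 us2 h2] := psum_approx n0 nM e0.
exists (undup (s1 ++ s2)); first exact: undup_uniq.
move=> s us ss.
have /(h1 _ us) H1 : {subset s1 <= s}.
  by move=> x xs; apply: ss; rewrite mem_undup mem_cat xs.
have /(h2 _ us) H2 : {subset s2 <= s}.
  by move=> x xs; apply: ss; rewrite mem_undup mem_cat xs orbT.
have H3 := psum_ub pM us; have H4 := psum_ub nM us.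
have -> : \sum_(x <- s) c x =
    \sum_(x <- s) Num.max (c x) 0 - \sum_(x <- s) Num.max (- c x) 0.
  rewrite -sumrB; apply: eq_bigr => x _.
  by case: (leP (c x) 0) => h; [rewrite max_l ?oppr_ge0//; lra|rewrite max_r ?oppr_le0 ?subr0// ltW].
rewrite /usum ler_norml; apply/andP; split; lra.
Qed.

Lemma usum_le c M : sums_le c M -> `|usum c| <= M.
Proof.
move=> cM; apply/ler_addgt0Pl => e e0.
have [s us h] := usum_approx cM e0; have {}h := h s us (fun _ => id).
have : `|\sum_(x <- s) c x| <= M by apply: le_trans (ler_norm_sum _ _ _) (cM s us).
move: h; rewrite !ler_norml => /andP[? ?] /andP[? ?]; apply/andP; split; lra.
Qed.

(** Any exhaustion by finite lists computes the sum. Sequences are what dominated convergence needs,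
    and cubes are what sign changes preserve. *)
Lemma cvg_usum c M (s : nat -> seq T) : sums_le c M -> (forall k, uniq (s k)) ->
  (forall x, \forall k \near \oo, x \in s k) ->
  \sum_(x <- s k) c x @[k --> \oo] --> usum c.
Proof.
move=> cM us sx; apply/cvgrPdist_le => e e0.
have [s0 us0 h] := usum_approx cM e0.
have : \forall k \near \oo, {subset s0 <= s k}.
  elim: s0 {us0 h} => [|x s0 IH]; first by apply: nearW => k y; rewrite in_nil.
  apply: filterS2 (sx x) IH => k xk sk y; rewrite inE => /predU1P[->//|].
  exact: sk.
by apply: filterS => k ks; rewrite distrC; exact: h.
Qed.

Lemma sums_leZ c M (b : R) : sums_le c M -> sums_le (fun x => b * c x) (`|b| * M).
Proof.
move=> cM s us; under eq_bigr do rewrite normrM.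
by rewrite -mulr_sumr ler_wpM2l// cM.
Qed.

Lemma sums_leD c M c' M' : sums_le c M -> sums_le c' M' ->
  sums_le (fun x => c x + c' x) (M + M').
Proof.
move=> cM cM' s us; apply: le_trans (lerD (cM s us) (cM' s us)).
by rewrite -big_split/=; apply: ler_sum => x _; exact: ler_normD.
Qed.

Lemma sums_leM_bounded c M (b : T -> R) B : (forall x, `|b x| <= B) -> sums_le c M ->
  sums_le (fun x => b x * c x) (`|B| * M).
Proof.
move=> bB cM; apply: le_sums_le (sums_leZ B cM) => x.
by rewrite !normrM ler_wpM2r// (le_trans (bB x))// ler_norm.
Qed.

Lemma sums_le_inj (T' : choiceType) (f : T' -> T) c M : injective f ->
  sums_le c M -> forall t : seq T', uniq t -> \sum_(x <- t) `|c (f x)| <= M.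
Proof.
move=> fI cM t ut; rewrite -(big_map f xpredT (fun x => `|c x|)).
by apply: cM; rewrite map_inj_uniq.
Qed.

End unordered_sums.

(** * Exhaustion of Z^n by cubes *)

Section cube.

(** The cubes are symmetric, so that truncation to a cube commutes with the sign changes of the
    coordinates. *)
Definition cube n (N : nat) : seq 'rV[int]_n :=
  [seq \row_k ((f k : nat)%:Z - N%:Z) | f : {ffun 'I_n -> 'I_(N.*2.+1)}].

Lemma cube_uniq n N : uniq (cube n N).
Proof.
rewrite map_inj_uniq ?enum_uniq// => f h /rowP fh; apply/ffunP => k.
by have := fh k; rewrite !mxE => /addIr[]/val_inj.
Qed.

Lemma mem_cube n N (z : 'rV[int]_n) :
  (z \in cube n N) = [forall k, `|z 0 k| <= N%:Z].
Proof.
apply/mapP/forallP => [[f _ ->] k|zN].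
  rewrite mxE ler_norml; have fk := ltn_ord (f k).
  by apply/andP; split; move: fk; move: (f k : nat) => m; lia.
have H k : (absz (z ord0 k + N%:Z)%R < N.*2.+1)%N.
  by have : `|z ord0 k| <= N%:Z := zN k; move: (z ord0 k) => t; rewrite ler_norml; lia.
exists [ffun k => Ordinal (H k)]; first by rewrite mem_enum.
apply/rowP => k; rewrite mxE ffunE /=.
by have : `|z ord0 k| <= N%:Z := zN k; move: (z ord0 k) => t; rewrite ler_norml; lia.
Qed.

Lemma near_mem_cube n (z : 'rV[int]_n) : \forall N \near \oo, z \in cube n N.
Proof.
exists (\sum_k absz (z ord0 k))%N => // N /= zN.
rewrite mem_cube; apply/forallP => k; rewrite -abszE lez_nat.
by apply: leq_trans zN; rewrite (bigD1 k)//= leq_addr.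
Qed.

Lemma mem_cube_flip n N s (z : 'rV[int]_n) : (flip s z \in cube n N) = (z \in cube n N).
Proof.
rewrite !mem_cube; apply: eq_forallb => k; rewrite mxE.
by case: (s k); rewrite ?expr0 ?expr1 ?mul1r// mulN1r normrN.
Qed.

Lemma sum_cube_flip (R : nmodType) n N s (f : 'rV[int]_n -> R) :
  \sum_(z <- cube n N) f (flip s z) = \sum_(z <- cube n N) f z.
Proof.
rewrite -(big_map (flip s) xpredT f); apply: perm_big; apply: uniq_perm.
- by rewrite map_inj_uniq ?cube_uniq//; exact: (can_inj (flipK s)).
- exact: cube_uniq.
move=> z; rewrite -[in LHS](flipK s z) mem_map; last exact: (can_inj (flipK s)).
exact: mem_cube_flip.
Qed.

Lemma cvg_cube (R : realType) n (c : 'rV[int]_n -> R) M : sums_le c M ->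
  \sum_(z <- cube n N) c z @[N --> \oo] --> usum c.
Proof.
move=> cM; apply: cvg_usum cM _ _ => [N|z]; first exact: cube_uniq.
exact: near_mem_cube.
Qed.

End cube.

(** * Completeness of the cosines *)

Lemma bernoulli_ineq (R : realDomainType) (h : R) k : -1 <= h ->
  1 + k%:R * h <= (1 + h) ^+ k.
Proof.
move=> h1; elim: k => [|k IH]; first by rewrite mul0r addr0 expr0.
rewrite exprS; apply: le_trans (_ : (1 + h) * (1 + k%:R * h) <= _); last first.
  by rewrite ler_wpM2l//; lra.
rewrite -natr1; have : 0 <= k%:R * h ^+ 2 by rewrite mulr_ge0 ?sqr_ge0.
by nra.
Qed.

Section step_function.
Variable R : realType.

(** With x = (1 + h)^-2, the Bernoulli inequality (1 + h)^k >= k h gives k x^k <= k / (k h)^2 = 1 /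
    (k h^2). *)
Lemma cvg_natM_expr (x : R) : 0 <= x < 1 -> (k%:R * x ^+ k) @[k --> \oo] --> 0.
Proof.
move=> /andP[x0 x1].
have [->|xn0] := eqVneq x 0.
  apply/cvgrPdist_lt => e e0; near=> k.
  by rewrite sub0r normrN expr0n (_ : (k == 0)%N = false) ?mulr0 ?normr0//;
    apply/negbTE; rewrite -lt0n; near: k; exists 1%N.
have {}x0 : 0 < x by rewrite lt_neqAle eq_sym xn0.
pose h := (Num.sqrt x)^-1 - 1.
have sx0 : 0 < Num.sqrt x by rewrite sqrtr_gt0.
have h0 : 0 < h by rewrite subr_gt0 invf_gt1// -[ltRHS]sqrtr1 ltr_sqrt.
apply: (@squeeze_cvgr _ _ _ _ (fun=> 0) (fun k : nat => k.+1%:R^-1 * (h ^- 2 * 2))) => //.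
- near=> k; have k1 : (0 < k)%N by near: k; exists 1%N.
  apply/andP; split; first by rewrite mulr_ge0 ?ler0n// exprn_ge0// ltW.
  have b : k%:R * h <= (1 + h) ^+ k.
    by apply: le_trans (bernoulli_ineq _ _); lra.
  have kh0 : 0 < k%:R * h by rewrite mulr_gt0// ltr0n.
  have -> : x ^+ k = ((1 + h) ^+ k) ^- 2.
    rewrite /h addrC subrK -!exprVn invrK -!exprM mulnC exprM.
    by rewrite sqr_sqrtr ?ltW.
  apply: (@le_trans _ _ (k%:R * (k%:R * h) ^- 2)).
    have h1 : 0 < 1 + h by lra.
    have q0 : 0 < (1 + h) ^+ k := lt_le_trans kh0 b.
    rewrite ler_wpM2l ?ler0n// lef_pV2 ?posrE ?exprn_gt0//.
    by rewrite lerXn2r ?nnegrE//; exact: ltW.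
  have kr : 1 <= k%:R :> R by rewrite ler1n.
  rewrite -natr1.
  have kn0 : k%:R != 0 :> R by lra.
  have hn0 : h != 0 by lra.
  have -> : k%:R * (k%:R * h) ^- 2 = h ^- 2 * k%:R^-1 
    by rewrite exprMn invfM mulrA expr2 invfM mulrA divff// mul1r mulrC.
  rewrite mulrCA ler_wpM2l ?invr_ge0 ?sqr_ge0//.
  rewrite -[leLHS]mul1r ler_pdivrMr; last by lra.
  by rewrite -mulrA [leRHS]mulrC ler_pdivlMr; lra.
- exact: cvg_cst.
- rewrite -[X in _ --> X](mul0r (h ^- 2 * 2)); apply: cvgM; last exact: cvg_cst.
  exact: cvg_harmonic.
Unshelve. all: by end_near. Qed.

(* Stone's polynomials [(1 - w ^ k) ^ (k 2 ^ k)] are sharper versions of the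
   usual ones: the limit at the threshold is 0 as well. *)
Lemma cvg_stone (w : R) : 0 <= w <= 1 ->
  (1 - w ^+ k) ^+ (k * 2 ^ k) @[k --> \oo] --> ((w < 2^-1)%R%:R : R).
Proof.
move=> /andP[w0 w1].
have wk k : 0 <= w ^+ k <= 1 by rewrite exprn_ge0// exprn_ile1.
have [wlt|wge] := ltP w 2^-1.
  apply: (@squeeze_cvgr _ _ _ _ (fun k : nat => 1 - k%:R * (2 * w) ^+ k) (fun=> 1)).
  - near=> k; have /andP[wk0 wk1] := wk k; apply/andP; split; last first.
      by rewrite exprn_ile1; lra.
    apply: le_trans (bernoulli_ineq (k * 2 ^ k) (_ : -1 <= - w ^+ k)); last by lra.
    by rewrite natrM natrX exprMn mulrN -!mulrA.
  - rewrite -[X in _ --> X]subr0; apply: cvgB; first exact: cvg_cst.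
    by apply: cvg_natM_expr; lra.
  - exact: cvg_cst.
apply: (@squeeze_cvgr _ _ _ _ (fun=> 0) (fun k : nat => (2^-1) ^+ k)); last 2 first.
- exact: cvg_cst.
- by apply: cvg_expr; rewrite ger0_norm; lra.
near=> k; have /andP[wk0 wk1] := wk k; apply/andP; split.
  by rewrite exprn_ge0; lra.
(* For w >= 1/2, (1 + w^k)^(2^k) >= 1 + (2 w)^k >= 2, and (1 - w^k)(1 + w^k) <= 1; hence (1 -
   w^k)^(2^k) <= 1/2, which is raised to the power k. *)
have b := bernoulli_ineq (2 ^ k) (_ : -1 <= w ^+ k).
have {}b : 2 <= (1 + w ^+ k) ^+ (2 ^ k).
  apply: le_trans (b _); last by lra.
  rewrite natrX -exprMn; apply: (_ : 1 + 1 <= _); rewrite lerD2l exprn_ege1//; lra.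
have c : (1 - w ^+ k) ^+ (2 ^ k) * (1 + w ^+ k) ^+ (2 ^ k) <= 1.
  by rewrite -exprMn exprn_ile1//; nra.
have d : 0 <= (1 - w ^+ k) ^+ (2 ^ k) by rewrite exprn_ge0; lra.
have e : (1 - w ^+ k) ^+ (2 ^ k) <= 2^-1 by nra.
by rewrite mulnC exprM lerXn2r ?nnegrE// invr_ge0.
Unshelve. all: by end_near. Qed.

End step_function.

Section completeness.
Variables (R : realType) (n : nat) (a : 'I_n -> R).
Hypothesis a0 : forall k, 0 < a k.
Local Notation mu := (rV_lebesgue R n).
Local Notation F := (box a).

Definition bounded_on (f : 'rV[R]_n -> R) := exists M, forall x, F x -> `|f x| <= M.

Lemma bounded_onP (f : 'rV[R]_n -> R) : bounded_on f -> [bounded f x | x in F].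
Proof.
move=> [M fM]; exists M; split; first exact: num_real.
by move=> N MN x Fx; apply: le_trans (fM x Fx) (ltW MN).
Qed.

Lemma bounded_onD f g : bounded_on f -> bounded_on g ->
  bounded_on (fun x => f x + g x).
Proof.
move=> [M fM] [N gN]; exists (M + N) => x Fx.
by apply: le_trans (ler_normD _ _) _; rewrite lerD ?fM ?gN.
Qed.

Lemma bounded_onM f g : bounded_on f -> bounded_on g ->
  bounded_on (fun x => f x * g x).
Proof.
move=> [M fM] [N gN]; exists (M * N) => x Fx.
by rewrite normrM ler_pM ?fM ?gN.
Qed.

Lemma bounded_on_cst c : bounded_on (fun=> c).
Proof. by exists `|c|. Qed.

Lemma bounded_on_ufun z : bounded_on (ufun z).
Proof. by exists 1 => x _; exact: ufun_le1. Qed.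

Lemma measurable_ufun D z : measurable_fun D (@ufun R n z).
Proof.
by apply: measurable_funTS; apply: continuous_measurable_rV; exact: continuous_ufun.
Qed.

Lemma integrable_boundedM (g f : 'rV[R]_n -> R) : mu.-integrable F (EFin \o g) ->
  measurable_fun F f -> bounded_on f ->
  mu.-integrable F (EFin \o (fun x => g x * f x)).
Proof.
move=> ig mf bf.
have := integrableMl (measurable_box a) ig mf (bounded_onP bf).
by apply: eq_integrable => //; exact: measurable_box.
Qed.

Variable g : 'rV[R]_n -> R.
Hypothesis ig : mu.-integrable F (EFin \o g).
Hypothesis g0 : forall z : 'rV[int]_n,
  \int[mu]_(x in F) (g x * ufun (half_lattice_vec a z) x) = 0.

Let mF : measurable F. Proof. exact: measurable_box. Qed.

(** The bounded [f] for which g f is still orthogonal to all cosines. The aim is to reach the sign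
    of [g]. *)
Let annih (f : 'rV[R]_n -> R) := [/\ measurable_fun F f, bounded_on f &
  forall z : 'rV[int]_n, \int[mu]_(x in F) (g x * f x * ufun (half_lattice_vec a z) x) = 0].

Let int_gfu f (z : 'rV[R]_n) : measurable_fun F f -> bounded_on f ->
  mu.-integrable F (EFin \o (fun x => g x * f x * ufun z x)).
Proof.
move=> mf bf; apply: integrable_boundedM; last exact: bounded_on_ufun.
  exact: integrable_boundedM.
exact: measurable_ufun.
Qed.

Let annih1 : annih (fun=> 1).
Proof.
split; [exact: measurable_cst|exact: bounded_on_cst|move=> z].
by under eq_Rintegral do rewrite mulr1; exact: g0.
Qed.

Let annih_lin (c : R) f h : annih f -> annih h -> annih (fun x => c * f x + h x).
Proof.
move=> [mf bf f0] [mh bh h0]; split.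
- by apply: measurable_funD => //; apply: measurable_funM => //; exact: measurable_cst.
- by apply: bounded_onD => //; apply: bounded_onM => //; exact: bounded_on_cst.
move=> z; have E x : g x * (c * f x + h x) * ufun (half_lattice_vec a z) x =
    c * (g x * f x * ufun (half_lattice_vec a z) x) +
    g x * h x * ufun (half_lattice_vec a z) x by ring.
under eq_Rintegral do rewrite E.
rewrite RintegralD//; last 2 first.
- apply: (eq_integrable mF) (integrableZl mF c (int_gfu (half_lattice_vec a z) mf bf)) => //.
- exact: int_gfu.
by rewrite RintegralZl// ?f0 ?h0 ?mulr0 ?addr0//; exact: int_gfu.
Qed.

Let annih_eq f h : measurable_fun F h -> (forall x, F x -> f x = h x) -> annih f -> annih h.
Proof.
move=> mh fh [mf [M fM] f0]; split => //.
  by exists M => x Fx; rewrite -fh// fM.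
move=> z; rewrite -[RHS](f0 z); apply: eq_Rintegral => x xF.
by rewrite fh//; exact: set_mem.
Qed.

Let annih_cvg (f : nat -> 'rV[R]_n -> R) (h : 'rV[R]_n -> R) (M : R) :
  (forall k, annih (f k)) -> (forall k x, F x -> `|f k x| <= M) ->
  (forall x, F x -> f k x @[k --> \oo] --> h x) -> annih h.
Proof.
move=> kf fM fh.
have mh : measurable_fun F h.
  by apply: (measurable_realfun.measurable_fun_cvg (h := f)) => // k; case: (kf k).
have bh : bounded_on h.
  exists M => x Fx; have cn : `|f k x| @[k --> \oo] --> `|h x| by apply: cvg_norm; exact: fh.
  by apply: (cvgr_to_le cn); apply: nearW => k; exact: fM.
split => // z.
have ik k : mu.-integrable F
    (EFin \o (fun x => g x * f k x * ufun (half_lattice_vec a z) x)).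
  by have [mf bf _] := kf k; exact: int_gfu.
have := @dominated_cvg _ _ R mu F mF
  (fun k x => (g x * f k x * ufun (half_lattice_vec a z) x)%:E)
  (fun x => (g x * h x * ufun (half_lattice_vec a z) x)%:E)
  (fun x => (M * `|g x|)%:E) _ _ _ _ _.
have -> : (fun k => \int[mu]_(x in F) (g x * f k x * ufun (half_lattice_vec a z) x)%:E)%E
    = fun=> 0%E.
  apply/funext => k; rewrite -[LHS]fineK; last exact: (integrable_fin_num mF (ik k)).
  by case: (kf k) => _ _ /(_ z) fk0; congr EFin.
move=> H; rewrite /Rintegral -[RHS]/(fine 0%E); congr fine.
apply: (cvg_unique _ (H _ _ _ _ _) (cvg_cst _)); first exact: ereal_hausdorff.
- by move=> k; apply: (measurable_int mu); exact: ik.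
- move=> x Fx; apply: cvg_EFin; first exact: nearW.
  apply: cvgM; last exact: cvg_cst.
  by apply: cvgM; [exact: cvg_cst|exact: fh].
- by [].
- by apply: (eq_integrable mF) (integrableZl mF M (integrable_norm ig)).
- move=> k x Fx; rewrite lee_fin !normrM mulrC mulrA.
  rewrite [leRHS]mulrC -[leRHS]mul1r -mulrA [X in _ * X]mulrC.
  by apply: ler_pM => //; [exact: ufun_le1|rewrite mulrC ler_wpM2l// fM].
Qed.

(** The multipliers of [annih]. Unlike [annih] itself they are visibly closed under products, which
    gives polynomials, hence Stone's, and intersections of sets. *)
Let mult w := forall f, annih f -> annih (fun x => f x * w x).

Let mult_lin c v w : mult v -> mult w -> mult (fun x => c * v x + w x).
Proof.
move=> mv mw f af; have := annih_lin c (mv _ af) (mw _ af).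
by congr annih; apply/funext => x; ring.
Qed.

Let mult1 : mult (fun=> 1).
Proof. by move=> f; congr annih; apply/funext => x; rewrite mulr1. Qed.

Let mult_cst c : mult (fun=> c).
Proof.
have := mult_lin (c - 1) mult1 mult1.
by congr mult; apply/funext => x; rewrite mulr1 subrK.
Qed.

Let multM v w : mult v -> mult w -> mult (fun x => v x * w x).
Proof.
move=> mv mw f af; have := mw _ (mv _ af).
by congr annih; apply/funext => x; rewrite mulrA.
Qed.

Let multX w k : mult w -> mult (fun x => w x ^+ k).
Proof.
move=> mw; elim: k => [|k IH]; first exact: mult1.
by have := multM mw IH; congr mult; apply/funext => x; rewrite exprS.
Qed.

Lemma Rintegral_sum (I : Type) (r : seq I) (f : I -> 'rV[R]_n -> R) :
  (forall i, mu.-integrable F (EFin \o f i)) ->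
  \int[mu]_(x in F) (\sum_(i <- r) f i x) = \sum_(i <- r) \int[mu]_(x in F) f i x.
Proof.
move=> intf; elim: r => [|i r IH].
  by under eq_Rintegral do rewrite big_nil; rewrite Rintegral_cst// mul0r big_nil.
under eq_Rintegral do rewrite big_cons.
rewrite big_cons -IH RintegralD//.
have := integrable_sum mF r (P := xpredT) (fun i _ => intf i).
by apply: eq_integrable => // x _ /=; rewrite sumEFin.
Qed.

Let mult_ufun (e : 'rV[int]_n) : mult (ufun (half_lattice_vec a e)).
Proof.
move=> f [mf bf f0]; split.
- by apply: measurable_funM => //; exact: measurable_ufun.
- by apply: bounded_onM => //; exact: bounded_on_ufun.
move=> z; pose N := (2 ^+ n)^-1 : R.
have E x : g x * (f x * ufun (half_lattice_vec a e) x) * ufun (half_lattice_vec a z) x =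
    N * \sum_(s : {ffun 'I_n -> bool})
      (g x * f x * ufun (half_lattice_vec a (z + flip s e)) x).
  transitivity (g x * f x *
      (ufun (half_lattice_vec a z) x * ufun (half_lattice_vec a e) x)); first by ring.
  rewrite ufunM mulrCA mulr_sumr; congr (_ * _); apply: eq_bigr => s _.
  by rewrite half_lattice_vecD half_lattice_vec_flip.
under eq_Rintegral do rewrite E.
rewrite RintegralZl//; last first.
  have := integrable_sum mF (index_enum _) (P := xpredT) (fun (s : {ffun 'I_n -> bool}) _ =>
     int_gfu (half_lattice_vec a (z + flip s e)) mf bf).
  by apply: eq_integrable => // x _ /=; rewrite sumEFin.
rewrite Rintegral_sum; last by move=> s; exact: int_gfu.
by rewrite big1 ?mulr0// => s _; exact: f0.
Qed.

(** Stone's polynomials in [w] take values in [0, 1] and converge at every point, so the limit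
    passes under the integral by dominated convergence. *)
Let mult_stone w : mult w -> (forall x, F x -> 0 <= w x <= 1) ->
  mult (fun x => (w x < 2^-1)%R%:R).
Proof.
move=> mw w01 f af; have [mf [M fM] _] := af.
apply: (annih_cvg (f := fun k x => f x * (1 - w x ^+ k) ^+ (k * 2 ^ k)) (M := M)).
- move=> k; apply: (multX (k * 2 ^ k) (w := fun x => 1 - w x ^+ k)) => //.
  have := mult_lin (-1) (multX k mw) mult1.
  by congr mult; apply/funext => x; ring.
- move=> k x Fx; have /andP[wx0 wx1] := w01 x Fx.
  have wk0 : 0 <= w x ^+ k by rewrite exprn_ge0.
  have wk1 : w x ^+ k <= 1 by rewrite exprn_ile1.
  have M0 : 0 <= M := le_trans (normr_ge0 _) (fM x Fx).
  rewrite normrM -[leRHS]mulr1 ler_pM// ?fM// ger0_norm ?exprn_ge0 ?exprn_ile1//;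
    by rewrite ?subr_ge0// lerBlDr lerDl.
- move=> x Fx; apply: cvgM; first exact: cvg_cst.
  by apply: cvg_stone; exact: w01.
Qed.

Let ufun_delta k x :
  ufun (half_lattice_vec a (delta_mx 0 k)) x = cos (pi * x 0 k / a k).
Proof.
rewrite /ufun (bigD1 k)//= big1 ?mulr1.
  by rewrite !mxE !eqxx/= mul1r mulrAC.
by move=> j jk; rewrite !mxE (negbTE jk) andbF !mul0r cos0.
Qed.

Let measurable_ltcoord k t : measurable [set x : 'rV[R]_n | x 0 k < t].
Proof.
rewrite (_ : [set x | _] = setT `&`
    (fun x : 'rV[R]_n => x 0 k : measurableTypeR R) @^-1` `]-oo, t[).
  by apply: measurable_coord => //; exact: measurable_itv.
by apply/seteqP; split => x /=; rewrite ?in_itv//= => -[].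
Qed.

Let mult_eq v w : measurable_fun F w -> (forall x, F x -> v x = w x) ->
  mult v -> mult w.
Proof.
move=> mw vw mv f af; apply: annih_eq (mv f af).
  by case: af => mf _ _; exact: measurable_funM.
by move=> x Fx; rewrite vw.
Qed.

Let mult_ltcoord k t : mult (\1_[set x : 'rV[R]_n | x 0 k < t]).
Proof.
have mI : measurable_fun F (\1_[set x : 'rV[R]_n | x 0 k < t] : _ -> R).
  by apply: measurable_funTS; exact: measurable_indic.
have IE (x : 'rV[R]_n) : \1_[set x : 'rV[R]_n | x 0 k < t] x = (x 0 k < t)%R%:R :> R.
  by rewrite indicE mem_setE.
have [t0|t0] := leP t 0.
  apply: (mult_eq mI _ (mult_cst 0)) => x /(_ k)/andP[xk0 _].
  by rewrite IE ltNge (le_trans t0).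
have [at_|ta] := ltP (a k) t.
  apply: (mult_eq mI _ mult1) => x /(_ k)/andP[_ xka].
  by rewrite IE (le_lt_trans xka).
pose c := cos (pi * t / a k).
have tge0 := ltW t0; have age0 := ltW (a0 k).
(* The cosine decreases on [0, pi], so x_k < t means cos (pi x_k / a_k) > c. The function 1/2 + (c -
   cos (pi x_k / a_k)) / 4 is below 1/2 exactly there, and the factor 1/4 keeps it in [0, 1]. *)
apply: (mult_eq mI _ (mult_stone (w := fun x =>
    - 4^-1 * ufun (half_lattice_vec a (delta_mx 0 k)) x + (2^-1 + c / 4)) _ _)).
- move=> x /(_ k)/andP[xk0 xka]; rewrite IE; congr (nat_of_bool _)%:R.
  rewrite ufun_delta -/c.
  have h : (c < cos (pi * x 0 k / a k)) = (x 0 k < t).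
    rewrite /c ltr_cos.
    + by rewrite !(mulrC pi) -!mulrA ltr_pM2r// divr_gt0// pi_gt0.
    + rewrite in_itv/= divr_ge0 ?mulr_ge0 ?pi_ge0//=.
      by rewrite ler_pdivrMr// ler_wpM2l// pi_ge0.
    + rewrite in_itv/= divr_ge0 ?mulr_ge0 ?pi_ge0//=.
      by rewrite ler_pdivrMr// ler_wpM2l// pi_ge0.
  rewrite -h; apply/idP/idP => H; lra.
- by apply: mult_lin; [exact: mult_ufun|exact: mult_cst].
- move=> x _.
  have := ufun_le1 (half_lattice_vec a (delta_mx 0 k)) x.
  have := cos_max (pi * t / a k); rewrite -/c !ler_norml => /andP[? ?] /andP[? ?].
  by apply/andP; split; lra.
Qed.

Let multset (A : set 'rV[R]_n) := measurable A /\ mult (\1_A).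

Let sigma_algebra_multset : sigma_algebra setT multset.
Proof.
split.
- split; first exact: measurable0.
  by have := mult_cst 0; congr mult; rewrite indic0.
- move=> A [mA iA]; rewrite setTD; split; first exact: measurableC.
  have := mult_lin (-1) iA mult1; congr mult; apply/funext => x.
  by rewrite !indicE in_setC; case: (x \in A) => /=; ring.
- move=> A AM; split; first by apply: bigcupT_measurable => k; case: (AM k).
  (* Finite products of indicators of complements are multipliers, and they converge to the
     indicator of the complement of the whole union. *)
  pose p k x : R := \prod_(i < k) (1 - \1_(A i) x).
  have mp k : mult (p k).
    elim: k => [|k IH].
      by have := mult1; congr mult; apply/funext => x; rewrite /p big_ord0.
    have := multM IH (mult_lin (-1) (AM k).2 mult1).
    by congr mult; apply/funext => x; rewrite /p big_ord_recr/= mulN1r [- _ + _]addrC.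
  have pE k x : p k x = 0 \/ p k x = 1.
    rewrite /p; elim/big_rec: _ => [|i y _ [->|->]]; [by right|by left; rewrite mulr0|].
    by rewrite mulr1 indicE; case: (x \in A i); rewrite ?subrr ?subr0; [left|right].
  have m1 : mult (fun x => 1 - \1_(\bigcup_k A k) x).
    move=> f af; have [mf [M fM] _] := af.
    apply: (annih_cvg (f := fun k x => f x * p k x) (M := M)) => [k|k x Fx|x Fx].
    + exact: mp.
    + have M0 : 0 <= M := le_trans (normr_ge0 _) (fM x Fx).
      by have [->|->] := pE k x; rewrite ?mulr0 ?normr0// mulr1 fM.
    apply: cvgM; first exact: cvg_cst.
    rewrite indicE; have [/set_mem[i _ Aix]|nA] := boolP (x \in \bigcup_k A k).
      rewrite subrr; apply: (@cvg_trans _ ((fun=> 0) @ \oo)); last exact: cvg_cst.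
      apply: near_eq_cvg; near=> k.
      have ik : (i < k)%N by near: k; exists i.+1.
      by rewrite /p (bigD1 (Ordinal ik))//= indicE mem_set// subrr mul0r.
    rewrite subr0 (_ : p^~ x = fun=> 1); first exact: cvg_cst.
    apply/funext => k; rewrite /p big1// => i _; rewrite indicE memNset ?subr0//.
    by move=> Aix; move/negP: nA; apply; apply/mem_set; exists i.
  have := mult_lin (-1) m1 mult1; congr mult; apply/funext => x; ring.
Unshelve. all: by end_near. Qed.

Let measurable_multset (A : set 'rV[R]_n) : measurable A -> mult (\1_A).
Proof.
suff H : measurable `<=` multset by move=> mA; case: (H A mA).
apply: smallest_sub; first exact: sigma_algebra_multset.
rewrite -bigcup_seq/= => B [k _ [Y mY <-]].
have : Y \in [set Y : set (measurableTypeR R) |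
    multset (setT `&` (fun x : 'rV[R]_n => x 0 k) @^-1` Y)].
  have {}mY : (@RGenInftyO.G R).-sigma.-measurable Y.
    by rewrite -RGenInftyO.measurableE; exact: mY.
  apply/mem_set; move: Y mY.
  apply: smallest_sub; last first.
    move=> _ [t ->] /=.
    rewrite (_ : setT `&` _ = [set x : 'rV[R]_n | x 0 k < t]).
      by split; [exact: measurable_ltcoord|exact: mult_ltcoord].
    by apply/seteqP; split => x /=; rewrite in_itv/= => //; case.
  have [s0 sC sU] := sigma_algebra_multset; split => /=.
  - by rewrite preimage_set0 setI0.
  - move=> Y /sC; rewrite !setTD; congr multset.
    by rewrite !setTI preimage_setC.
  - move=> Y /sU; congr multset.
    by rewrite setTI preimage_bigcup; apply: eq_bigcupr => i _; rewrite setTI.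
by rewrite inE.
Qed.

(** Indicators of all measurable sets are multipliers, so [annih] contains the sign of [g]; the
    frequency 0 then says that |g| has integral 0. *)
Lemma cosines_complete : {ae mu, forall x, F x -> g x = 0}.
Proof.
have mg : measurable_fun F g.
  by have := measurable_int mu ig => /measurable_EFinP.
have mP : measurable (F `&` g @^-1` `]0, +oo[).
  by apply: mg => //; exact: measurable_itv.
have mN : measurable (F `&` g @^-1` `]-oo, 0[).
  by apply: mg => //; exact: measurable_itv.
have [_ _ /(_ 0)] :=
  annih_lin (-1) (measurable_multset mN annih1) (measurable_multset mP annih1).
have E x : F x -> g x * (-1 * (1 * \1_(F `&` g @^-1` `]-oo, 0[) x) +
    1 * \1_(F `&` g @^-1` `]0, +oo[) x) * ufun (half_lattice_vec a 0) x = `|g x|.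
  move=> Fx; rewrite (_ : half_lattice_vec a 0 = 0) ?ufun0 ?mulr1; last first.
    by apply/rowP => k; rewrite !mxE !mul0r.
  have memE (A : set R) : (x \in g @^-1` A) = (g x \in A).
    by apply/idP/idP; rewrite !inE.
  rewrite !indicE !in_setI !mul1r (mem_set Fx) !memE !mem_setE !in_itv/= andbT.
  case: ltgtP => [h|h|h]; [rewrite ltr0_norm//|rewrite gtr0_norm//|rewrite h normr0];
    rewrite /=; ring.
rewrite (eq_Rintegral _ (fun x xF => E x (set_mem xF))) => gn0.
have : (\int[mu]_(x in F) `|(g x)%:E| = 0)%E.
  have ing := integrable_norm ig.
  by rewrite -[LHS]fineK ?(integrable_fin_num mF ing)//; congr EFin.
have mEg : measurable_fun F (EFin \o g) by exact: (measurable_int mu).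
move=> /(ae_eq_integral_abs mu mF mEg).
by apply: filterS => x Hx Fx; have [] := Hx Fx.
Qed.

End completeness.

(** * Cosine series and the Neumann Laplacian *)

Section C1_continuity.
Variable R : realType.

Lemma partial_MVT n (psi : 'rV[R]_n -> R) k (p : 'rV[R]_n) (h : R) :
  (forall x, derivable psi x (delta_mx 0 k : 'rV[R]_n)) ->
  exists2 c, 0 <= c <= 1 & psi (h *: delta_mx 0 k + p) - psi p =
    h * partial k psi ((h * c) *: delta_mx 0 k + p).
Proof.
move=> dpsi.
pose g (t : R) := psi ((h * t) *: delta_mx 0 k + p).
have dg (t : R) : is_derive (t : R^o) (1 : R^o) (g : R^o -> R^o)
    (h * partial k psi ((h * t) *: delta_mx 0 k + p)).
  apply: (is_derive_scale (f := fun s => psi (s *: delta_mx 0 k + p))).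
  apply: (is_derive_comp_line (phi := fun s : R^o => s *: delta_mx 0 k + p)
    (v := delta_mx 0 k)).
    by move=> e; rewrite [_ *: 1]mulr1 scalerDl addrA.
  by apply: DeriveDef => //; exact: dpsi.
have cg : {within `[0, 1], continuous g}.
  apply: continuous_subspaceT => t.
  by apply: differentiable_continuous; apply/derivable1_diffP; case: (dg t).
have [c] := MVT_segment (@ler01 R) (fun t _ => dg t) cg.
rewrite in_itv/= => c01; rewrite subr0 mulr1 /g mulr1 mulr0 scale0r add0r => E.
by exists c.
Qed.

(** [C1] speaks of partial derivatives only. From x to y one coordinate is changed at a time, and
    the mean value theorem bounds each step by a local bound of one partial derivative. *)
Lemma C1_continuous n (psi : 'rV[R]_n -> R) : C1 psi -> continuous psi.
Proof.
move=> psiC x.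
pose B k := `|partial k psi x| + 1.
have : \forall y \near x, forall k, `|partial k psi y| <= B k.
  apply: (@filter_forall _ _ _ (nbhs x) (nbhs_filter x)) => k; have [_ /(_ x)/cvgrPdist_le/(_ 1 ltr01)] := psiC k.
  apply: filterS => y h; rewrite /B.
  have := ler_normB (partial k psi x) (partial k psi x - partial k psi y).
  by rewrite opprB addrC subrK => /le_trans; apply; rewrite lerD2l.
move=> /nbhs_ballP[r /= r0 hr].
pose p (y : 'rV[R]_n) (k : nat) := \row_(j < n) (if (j < k)%N then y 0 j else x 0 j).
have step (y : 'rV[R]_n) (k : 'I_n) : (forall j, `|y 0 j - x 0 j| < r) ->
    `|psi (p y k.+1) - psi (p y k)| <= `|y 0 k - x 0 k| * B k.
  move=> yx; have [dk _] := psiC k.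
  have [c /andP[c0 c1]] := partial_MVT (p y k) (y 0 k - x 0 k) dk.
  have -> : (y 0 k - x 0 k) *: delta_mx 0 k + p y k = p y k.+1.
    apply/rowP => j; rewrite !mxE [in RHS]ltnS [in RHS]leq_eqVlt (_ : (j == k :> nat) = (j == k))//.
    by have [->|jk] := eqVneq j k; rewrite ?ltnn ?eqxx/= ?mulr1 ?subrK// mulr0 add0r.
  move=> ->; rewrite normrM ler_wpM2l//; apply: hr.
  split=> // i j; rewrite (ord1 i) -ball_normE /= !mxE eqxx /= distrC.
  have [->|jk] := eqVneq j k.
    rewrite ltnn mulr1 addrK normrM (ger0_norm c0).
    by apply: le_lt_trans (yx k); rewrite -[leRHS]mulr1 ler_wpM2l.
  rewrite mulr0 add0r; case: ifP => _; first exact: yx.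
  by rewrite subrr normr0.
have path (y : 'rV[R]_n) : (forall j, `|y 0 j - x 0 j| < r) ->
    `|psi y - psi x| <= \sum_k `|y 0 k - x 0 k| * B k.
  move=> yx; have -> : psi y - psi x = \sum_(k < n) (psi (p y k.+1) - psi (p y k)).
    rewrite -(big_mkord xpredT (fun k => psi (p y k.+1) - psi (p y k))) telescope_sumr//.
    by congr (psi _ - psi _); apply/rowP => j; rewrite mxE ?ltn_ord.
  by apply: le_trans (ler_norm_sum _ _ _) _; apply: ler_sum => k _; exact: step.
apply/(@cvgrPdist_le _ _ _ _ (nbhs_filter x)) => e e0.
pose D := \sum_k B k + 1.
have B0 k : 0 <= B k by rewrite addr_ge0.
have D0 : 0 < D by rewrite ltr_wpDl// sumr_ge0.
have d0 : 0 < Num.min r (e / D) by rewrite lt_min r0 divr_gt0.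
apply/nbhs_ballP; exists (Num.min r (e / D)) => //= y [_ xy].
have {}xy j : `|y 0 j - x 0 j| < Num.min r (e / D).
  by have := xy 0 j; rewrite -ball_normE /= distrC.
rewrite distrC; apply: le_trans (path y _) _ => [j|].
  by apply: lt_le_trans (xy j) _; rewrite ge_min lexx.
apply: le_trans (_ : \sum_k (e / D) * B k <= _).
  apply: ler_sum => k _; rewrite ler_wpM2r//.
  by apply: le_trans (ltW (xy k)) _; rewrite ge_min lexx orbT.
rewrite -mulr_sumr mulrAC ler_pdivrMr// ler_wpM2l ?ltW//.
by rewrite ltrDl.
Qed.

End C1_continuity.

Section series.
Variables (R : realType) (n : nat) (a : 'I_n -> R).
Hypothesis a0 : forall k, 0 < a k.
Local Notation mu := (rV_lebesgue R n).
Local Notation F := (box a).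

Let mF : measurable F. Proof. exact: measurable_box. Qed.

Lemma box_lty : (mu F < +oo)%E.
Proof. by apply: rV_lebesgue_box_lty => k; exact: ltW. Qed.

Lemma integrable_bounded_on f : measurable_fun F f -> bounded_on a f ->
  mu.-integrable F (EFin \o f).
Proof. by move=> mf [M fM]; apply: integrable_bounded fM => //; exact: box_lty. Qed.

Lemma L2_bounded f : measurable_fun F f -> bounded_on a f -> L2 a f.
Proof.
move=> mf bf; split=> //; apply: (@integrable_bounded_on (fun x => f x ^+ 2)).
  exact: measurable_funX.
have [M fM] := bounded_onM bf bf; exists M => x Fx.
by rewrite expr2; exact: fM.
Qed.

Lemma L2_integrable f : L2 a f -> mu.-integrable F (EFin \o f).
Proof.
move=> [mf if2].
have i1 : mu.-integrable F (EFin \o (fun=> 1 : R)).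
  by apply: integrable_bounded_on => //; exact: bounded_on_cst.
apply: le_integrable (integrableD mF i1 if2) => //; first exact/measurable_EFinP.
move=> x Fx /=; rewrite lee_fin [leRHS]ger0_norm; last by rewrite addr_ge0// sqr_ge0.
have := sqr_ge0 (`|f x| - 1); rewrite sqrrB expr1n mulr1 real_normK ?num_real//.
have := normr_ge0 (f x); lra.
Qed.

Lemma continuous_bounded_on (f : 'rV[R]_n -> R) : continuous f -> bounded_on a f.
Proof. exact: continuous_bounded_box. Qed.

Lemma continuous_measurable_on (f : 'rV[R]_n -> R) D : continuous f -> measurable_fun D f.
Proof. by move=> cf; apply: measurable_funTS; exact: continuous_measurable_rV. Qed.

Section family.
Variables (b : 'rV[int]_n -> 'rV[R]_n -> R) (m : 'rV[int]_n -> R) (M : R).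
Hypothesis bm : forall z x, `|b z x| <= m z.
Hypothesis mM : sums_le m M.
Hypothesis mb : forall z, measurable_fun F (b z).

Definition series_fun x := usum (b^~ x).

Lemma family_sums_le x : sums_le (b^~ x) M.
Proof. by apply: le_sums_le mM => z; apply: le_trans (bm z x) (ler_norm _). Qed.

Lemma series_bounded : bounded_on a series_fun.
Proof. by exists M => x _; apply: usum_le; exact: family_sums_le. Qed.

Lemma series_measurable : measurable_fun F series_fun.
Proof.
apply: (measurable_realfun.measurable_fun_cvg (h := fun N x => \sum_(z <- cube n N) b z x)).
  by move=> N; apply: measurable_sum.
by move=> x _; apply: cvg_cube; exact: family_sums_le.
Qed.

Lemma series_L2 : L2 a series_fun.
Proof. exact: L2_bounded series_measurable series_bounded. Qed.

(** Dominated convergence: all partial sums are at most [M] in absolute value, so M |g| is a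
    majorant. *)
Lemma cvg_series_L2_dot g : mu.-integrable F (EFin \o g) ->
  \sum_(z <- cube n N) L2_dot a (b z) g @[N --> \oo] --> L2_dot a series_fun g.
Proof.
move=> ig.
have mg : measurable_fun F g by have := measurable_int mu ig => /measurable_EFinP.
have ibg z : mu.-integrable F (EFin \o (fun x => b z x * g x)).
  have bb : bounded_on a (b z) by exists (m z) => x _; exact: bm.
  have := integrable_boundedM ig (mb z) bb.
  by congr (mu.-integrable _ _); apply/funext => x /=; rewrite mulrC.
have isg : mu.-integrable F (EFin \o (fun x => series_fun x * g x)).
  have := integrable_boundedM ig series_measurable series_bounded.
  by congr (mu.-integrable _ _); apply/funext => x /=; rewrite mulrC.
have iS N : mu.-integrable F (EFin \o (fun x => (\sum_(z <- cube n N) b z x) * g x)).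
  have := integrable_sum mF (cube n N) (P := xpredT) (fun z _ => ibg z).
  by apply: eq_integrable => // x _ /=; rewrite sumEFin mulr_suml.
have -> : (fun N => \sum_(z <- cube n N) L2_dot a (b z) g) =
    (fun N => fine (\int[mu]_(x in F) ((\sum_(z <- cube n N) b z x) * g x)%:E)%E).
  apply/funext => N; rewrite -[RHS]/(Rintegral _ _ _) /L2_dot -Rintegral_sum//.
  by apply: eq_Rintegral => x _; rewrite mulr_suml.
apply: fine_cvg; rewrite fineK; last exact: (integrable_fin_num mF isg).
apply: (@dominated_cvg _ _ R mu F mF _ _ (fun x => (M * `|g x|)%:E)).
- by move=> N; apply: (measurable_int mu); exact: iS.
- move=> x Fx; apply: cvg_EFin; first exact: nearW.
  apply: cvgM; last exact: cvg_cst.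
  by apply: cvg_cube; exact: family_sums_le.
- by [].
- by apply: (eq_integrable mF) (integrableZl mF M (integrable_norm ig)).
- move=> N x Fx; rewrite lee_fin normrM ler_wpM2r//.
  apply: le_trans (ler_norm_sum _ _ _) _.
  by apply: family_sums_le; exact: cube_uniq.
Qed.

End family.

(** Only the product h psi has to vanish on the two faces. This covers both uses: a cosine against a
    test function vanishing on the boundary, and the derivative of a cosine against an arbitrary
    one. *)
Lemma L2_dot_partial0 (h psi : 'rV[R]_n -> R) (dh : 'rV[R]_n -> R) k :
  continuous h -> continuous dh ->
  (forall x, is_derive x (delta_mx 0 k : 'rV[R]_n) h (dh x)) ->
  C1 psi ->
  (forall x, F x -> x 0 k = 0 \/ x 0 k = a k -> h x * psi x = 0) ->
  L2_dot a h (partial k psi) = - L2_dot a dh psi.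
Proof.
move=> ch cdh hdh psiC h0; have cpsi := C1_continuous psiC.
have [dpsi cdpsi] := psiC k.
have i1 : mu.-integrable F (EFin \o (fun x => h x * partial k psi x)).
  apply: integrable_bounded_on.
    by apply: measurable_funM; exact: continuous_measurable_on.
  by apply: bounded_onM; exact: continuous_bounded_on.
have i2 : mu.-integrable F (EFin \o (fun x => dh x * psi x)).
  apply: integrable_bounded_on.
    by apply: measurable_funM; exact: continuous_measurable_on.
  by apply: bounded_onM; exact: continuous_bounded_on.
apply/eqP; rewrite -addr_eq0 /L2_dot -RintegralD//.
apply/eqP; apply: (Rintegral_partial_eq0 a0 (h := fun x => h x * psi x) (k := k)) => //.
  move=> x; apply: (@continuousD _ _ _ (fun x => h x * partial k psi x) (fun x => dh x * psi x)).
    by apply: (@continuousM _ _ h (partial k psi)); [exact: ch|exact: cdpsi].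
  by apply: (@continuousM _ _ dh psi); [exact: cdh|exact: cpsi].
move=> x; have := is_deriveM (hdh x) (DeriveDef (dpsi x) (erefl _)).
by rewrite [psi x *: _]mulrC; exact.
Qed.

End series.

Lemma eq_seq_cvg (R : realType) (u v : nat -> R) (l : R) :
  (forall N, v N = u N) -> u N @[N --> \oo] --> l -> v N @[N --> \oo] --> l.
Proof. by move=> /funext ->. Qed.

Section cosine_series.
Variables (R : realType) (n : nat) (a : 'I_n -> R).
Hypothesis a0 : forall k, 0 < a k.
Local Notation mu := (rV_lebesgue R n).
Local Notation F := (box a).
Local Notation hl := (half_lattice_vec a).

Let mF : measurable F. Proof. exact: measurable_box. Qed.

Lemma L2_dotZl (c : R) f g : mu.-integrable F (EFin \o (fun x => f x * g x)) ->
  L2_dot a (fun x => c * f x) g = c * L2_dot a f g.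
Proof.
by move=> ifg; rewrite /L2_dot -RintegralZl//; apply: eq_Rintegral => x _; rewrite mulrA.
Qed.

Lemma L2_dotC f g : L2_dot a f g = L2_dot a g f.
Proof. by apply: eq_Rintegral => x _; rewrite mulrC. Qed.

Lemma integrable_continuousM (f g : 'rV[R]_n -> R) : continuous f -> continuous g ->
  mu.-integrable F (EFin \o (fun x => f x * g x)).
Proof.
move=> cf cg; apply: (integrable_bounded_on a0).
  by apply: measurable_funM; exact: continuous_measurable_on.
by apply: bounded_onM; exact: continuous_bounded_on.
Qed.

Lemma partial_ufun (g : 'rV[R]_n) k : partial k (ufun g) = dufun g k.
Proof. by apply/funext => x; have [_ <-] := is_derive_ufun g x k. Qed.

Lemma partial_dufun (g : 'rV[R]_n) k :
  partial k (dufun g k) = fun x => - g 0 k ^+ 2 * ufun g x.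
Proof. by apply/funext => x; have [_ <-] := is_derive_dufun g x k. Qed.

Lemma C1_ufun (g : 'rV[R]_n) : C1 (ufun g).
Proof.
move=> k; split=> [x|]; first by have [] := is_derive_ufun g x k.
by rewrite partial_ufun; exact: continuous_dufun.
Qed.

Lemma enorm_sqr (x : 'rV[R]_n) : enorm x ^+ 2 = dot x x.
Proof. by rewrite sqr_sqrtr// sumr_ge0// => k _; rewrite -expr2 sqr_ge0. Qed.

Lemma coord_sqr_le (x : 'rV[R]_n) k : x 0 k ^+ 2 <= enorm x ^+ 2.
Proof.
rewrite enorm_sqr /dot (bigD1 k)//= -expr2 lerDl sumr_ge0// => j _.
by rewrite -expr2 sqr_ge0.
Qed.

(** If z_k is not 0, the cosine is up to a nonzero factor the k-th derivative of [dufun (hl z) k],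
    which vanishes on the faces x_k = 0 and x_k = a_k. *)
Lemma Rintegral_ufun (z : 'rV[int]_n) :
  \int[mu]_(x in F) ufun (hl z) x = (z == 0)%:R * fine (mu F).
Proof.
have [->|z0] := eqVneq z 0.
  have -> : hl 0 = 0 by apply/rowP => k; rewrite !mxE !mul0r.
  by under eq_Rintegral do rewrite ufun0; rewrite Rintegral_cst// !mul1r.
rewrite mul0r.
have [k zk] : exists k, z 0 k != 0.
  apply/existsP; apply: contraNT z0 => /existsPn zn0; apply/eqP/rowP => k.
  by rewrite mxE; apply/eqP; have := zn0 k; rewrite negbK.
have gk : hl z 0 k != 0.
  by rewrite mxE mulf_neq0 ?mulf_neq0 ?intr_eq0 ?invr_eq0 ?(gt_eqF (pi_gt0 R)) ?(gt_eqF (a0 k)).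
have iu : mu.-integrable F (EFin \o ufun (hl z)).
  apply: (integrable_bounded_on a0); first exact: measurable_ufun.
  exact: bounded_on_ufun.
have := Rintegral_partial_eq0 (h := dufun (hl z) k)
  (g := fun x => - hl z 0 k ^+ 2 * ufun (hl z) x) (k := k) a0 _ _ _.
rewrite RintegralZl// => H.
have /eqP : - hl z 0 k ^+ 2 * \int[mu]_(x in F) ufun (hl z) x = 0.
  apply: H.
  - move=> x; apply: (@continuousM _ _ (fun=> - hl z 0 k ^+ 2) (ufun (hl z))).
      exact: cst_continuous.
    exact: continuous_ufun.
  - by move=> x; exact: is_derive_dufun.
  - by move=> x _; apply: dufun_face; rewrite gt_eqF.
by rewrite mulf_eq0 oppr_eq0 expf_eq0 (negbTE gk) => /eqP.
Qed.

Definition cos_series (c : 'rV[int]_n -> R) : 'rV[R]_n -> R :=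
  series_fun (fun z x => c z * ufun (hl z) x).

Section coefficients.
Variables (c : 'rV[int]_n -> R) (M : R).
Hypothesis cM : sums_le c M.

Let cb z x : `|c z * ufun (hl z) x| <= `|c z|.
Proof. by rewrite normrM -[leRHS]mulr1 ler_wpM2l// ufun_le1. Qed.

Let cM' : sums_le (fun z => `|c z|) M.
Proof. by apply: le_sums_le cM => z; rewrite normr_id. Qed.

Let mc z : measurable_fun F (fun x => c z * ufun (hl z) x).
Proof. by apply: measurable_funM; [exact: measurable_cst|exact: measurable_ufun]. Qed.

Lemma cos_series_bounded : bounded_on a (cos_series c).
Proof. exact: (series_bounded a cb cM'). Qed.

Lemma cos_series_measurable : measurable_fun F (cos_series c).
Proof. exact: (series_measurable cb cM' mc). Qed.

Lemma cos_series_L2 : L2 a (cos_series c).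
Proof. exact: (series_L2 a0 cb cM' mc). Qed.

Lemma cvg_cos_series_L2_dot g : mu.-integrable F (EFin \o g) ->
  \sum_(z <- cube n N) c z * L2_dot a (ufun (hl z)) g @[N --> \oo] -->
  L2_dot a (cos_series c) g.
Proof.
move=> ig; apply: eq_seq_cvg (cvg_series_L2_dot cb cM' mc ig) => N.
apply: eq_bigr => z _.
rewrite L2_dotZl//.
have := integrable_boundedM ig (measurable_ufun (hl z)) (bounded_on_ufun a (hl z)).
by congr (mu.-integrable _ _); apply/funext => x /=; rewrite mulrC.
Qed.

Hypothesis c_even : forall s z, c (flip s z) = c z.

(** Multiplication becomes convolution. The product formula gives an average over the frequencies k
    + flip s z; as [c] is even and the cubes are symmetric, every sign vector contributes the same
    sum as k - z. *)
Lemma cos_series_mul_coef g k : mu.-integrable F (EFin \o g) ->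
  L2_dot a (cos_series c) (fun x => g x * ufun (hl k) x) =
  usum (fun z => c z * L2_dot a g (ufun (hl (k - z)))).
Proof.
move=> ig.
have igu (z : 'rV[R]_n) : mu.-integrable F (EFin \o (fun x => g x * ufun z x)).
  by apply: integrable_boundedM => //; [exact: measurable_ufun|exact: bounded_on_ufun].
have gB z : `|L2_dot a g (ufun (hl z))| <= \int[mu]_(x in F) `|g x|.
  apply: le_trans (le_normr_Rintegral mF (igu _)) _; apply: le_Rintegral => //.
  - exact: integrable_norm (igu _).
  - exact: integrable_norm ig.
  by move=> x _; rewrite /= normrM -[leRHS]mulr1 ler_wpM2l// ufun_le1.
have sM : sums_le (fun z => c z * L2_dot a g (ufun (hl (k - z))))
    (`|\int[mu]_(x in F) `|g x| | * M).
  by under eq_fun do rewrite mulrC; apply: sums_leM_bounded => // z; exact: gB.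
apply: (cvg_unique (@Rhausdorff R) (cvg_cos_series_L2_dot (igu (hl k)))).
apply: eq_seq_cvg (cvg_cube sM) => N.
pose q z := L2_dot a g (ufun (hl z)).
have termE z : L2_dot a (ufun (hl z)) (fun x => g x * ufun (hl k) x) =
    (2 ^+ n)^-1 * \sum_(s : {ffun 'I_n -> bool}) q (k + flip s z).
  rewrite /q /L2_dot -Rintegral_sum//.
  rewrite -RintegralZl//; last first.
    have := integrable_sum mF (index_enum _) (P := xpredT)
      (fun (s : {ffun 'I_n -> bool}) _ => igu (hl (k + flip s z))).
    by apply: eq_integrable => // x _ /=; rewrite sumEFin.
  apply: eq_Rintegral => x _.
  transitivity (g x * (ufun (hl k) x * ufun (hl z) x)); first by ring.
  rewrite ufunM mulrCA mulr_sumr; congr (_ * _); apply: eq_bigr => s _.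
  by rewrite half_lattice_vecD half_lattice_vec_flip.
under eq_bigr do rewrite termE mulrCA mulr_sumr.
rewrite -mulr_sumr exchange_big/=.
have E s : \sum_(z <- cube n N) c z * q (k + flip s z) = \sum_(z <- cube n N) c z * q (k - z).
  rewrite -(sum_cube_flip N s) -(sum_cube_flip N [ffun => true] (fun z => c z * q (k - z))).
  by apply: eq_bigr => z _; rewrite !c_even flipK flipN opprK.
under eq_bigr do rewrite E.
rewrite sumr_const card_ffun card_bool card_ord -[X in _ * X]mulr_natl natrX mulKf//.
Qed.

Lemma usum_single (T : choiceType) (b : T -> R) k :
  (forall z, z != k -> b z = 0) -> usum b = b k.
Proof.
move=> b0.
have bM : sums_le b `|b k|.
  move=> s us; case: (boolP (k \in s)) => ks.
    by rewrite (bigD1_seq k)//= big1 ?addr0// => z zk; rewrite b0 ?normr0.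
  by rewrite big_seq big1// => z zs; rewrite b0 ?normr0//; apply: contraNneq ks => <-.
apply/eqP; rewrite -subr_eq0 -normr_le0; apply/ler_addgt0Pl => e e0.
have [s us h] := usum_approx bM e0.
have sub : {subset s <= undup (k :: s)}.
  by move=> z zs; rewrite mem_undup inE zs orbT.
have := h _ (undup_uniq (k :: s)) sub; rewrite addr0 distrC.
rewrite (bigD1_seq k) ?undup_uniq ?mem_undup ?inE ?eqxx//= big1 ?addr0//.
Qed.

Lemma cos_series_coef k : L2_dot a (cos_series c) (ufun (hl k)) = c k * fine (mu F).
Proof.
have i1 : mu.-integrable F (EFin \o (fun=> 1 : R)).
  by apply: (integrable_bounded_on a0) => //; exact: bounded_on_cst.
have := cos_series_mul_coef k i1.
rewrite (_ : (fun x => 1 * ufun (hl k) x) = ufun (hl k)); last first.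
  by apply/funext => x; rewrite mul1r.
move=> ->; rewrite (usum_single (k := k)) => [|z zk].
  have := Rintegral_ufun 0; rewrite eqxx mul1r subrr => <-; congr (_ * _).
  by apply: eq_Rintegral => x _; rewrite mul1r.
rewrite (_ : L2_dot _ _ _ = 0) ?mulr0//.
transitivity (\int[mu]_(x in F) ufun (hl (k - z)) x).
  by apply: eq_Rintegral => x _; rewrite mul1r.
by rewrite Rintegral_ufun subr_eq0 eq_sym (negbTE zk) mul0r.
Qed.

End coefficients.

End cosine_series.

Section neumann_series.
Variables (R : realType) (n : nat) (a : 'I_n -> R).
Hypothesis a0 : forall k, 0 < a k.
Local Notation mu := (rV_lebesgue R n).
Local Notation F := (box a).
Local Notation hl := (half_lattice_vec a).

Section series.
Variables (y : 'rV[int]_n -> R) (M : R).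
Hypothesis yM : sums_le (fun z => (1 + enorm (hl z) ^+ 2) * y z) M.

Let y1 : sums_le y M.
Proof.
apply: le_sums_le yM => z; rewrite normrM -[leLHS]mul1r ler_wpM2r//.
by rewrite ger0_norm ?lerDl ?addr_ge0// sqr_ge0.
Qed.

Let y2 : sums_le (fun z => - enorm (hl z) ^+ 2 * y z) M.
Proof.
apply: le_sums_le yM => z; rewrite !normrM ler_wpM2r// normrN.
by rewrite !ger0_norm ?lerDr ?addr_ge0// sqr_ge0.
Qed.

Let ydufun k z x : `|y z * dufun (hl z) k x| <= `|(1 + enorm (hl z) ^+ 2) * y z|.
Proof.
rewrite normrM [leRHS]normrM [leLHS]mulrC ler_wpM2r//; apply: le_trans (dufun_le _ _ _) _.
rewrite ger0_norm ?addr_ge0 ?sqr_ge0//.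
apply: le_trans (_ : 1 + `|hl z 0 k| ^+ 2 <= _).
  have := sqr_ge0 (`|hl z 0 k| - 1); have := normr_ge0 (hl z 0 k); nra.
by rewrite lerD2l real_normK ?num_real// coord_sqr_le.
Qed.

Let yMn : sums_le (fun z => `|(1 + enorm (hl z) ^+ 2) * y z|) M.
Proof. by apply: le_sums_le yM => z; rewrite normr_id. Qed.

Let mdufun k z : measurable_fun F (fun x => y z * dufun (hl z) k x).
Proof.
apply: measurable_funM; first exact: measurable_cst.
by apply: continuous_measurable_on; exact: continuous_dufun.
Qed.

Let G k := series_fun (fun z x => y z * dufun (hl z) k x).

Let cvg_G k (g : 'rV[R]_n -> R) : continuous g ->
  \sum_(z <- cube n N) y z * L2_dot a (dufun (hl z) k) g @[N --> \oo] -->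
  L2_dot a (G k) g.
Proof.
move=> cg; have ig : mu.-integrable F (EFin \o g).
  apply: (integrable_bounded_on a0); first exact: continuous_measurable_on.
  exact: continuous_bounded_on.
apply: eq_seq_cvg (cvg_series_L2_dot (ydufun k) yMn (mdufun k) ig) => N.
apply: eq_bigr => z _; rewrite L2_dotZl//.
by apply: integrable_continuousM => //; exact: continuous_dufun.
Qed.

Let cvg_u (c : 'rV[int]_n -> R) (g : 'rV[R]_n -> R) : sums_le c M -> continuous g ->
  \sum_(z <- cube n N) c z * L2_dot a (ufun (hl z)) g @[N --> \oo] -->
  L2_dot a (cos_series a c) g.
Proof.
move=> cM cg; apply: (cvg_cos_series_L2_dot cM).
apply: (integrable_bounded_on a0); first exact: continuous_measurable_on.
exact: continuous_bounded_on.
Qed.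

(** Integration by parts term by term. In the weak gradient the boundary terms vanish because of the
    test function, in Green's formula because of the sines. *)
Lemma neumann_cos_series : neumann_laplacian a (cos_series a y)
  (cos_series a (fun z => - enorm (hl z) ^+ 2 * y z)).
Proof.
split; first exact: (cos_series_L2 a0 y2).
exists G; split.
  split.
  - exact: (cos_series_L2 a0 y1).
  - by move=> k; exact: (series_L2 a0 (ydufun k) yMn (mdufun k)).
  move=> psi psiC psi0 k; have [_ cdpsi] := psiC k.
  apply: (cvg_unique (@Rhausdorff R) (cvg_u y1 cdpsi)).
  apply: (@eq_seq_cvg _
    (fun N => - \sum_(z <- cube n N) y z * L2_dot a (dufun (hl z) k) psi)); last first.
    by apply: cvgN; apply: cvg_G; exact: C1_continuous.
  move=> N.
  rewrite -sumrN; apply: eq_bigr => z _; rewrite -mulrN; congr (_ * _).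
  apply: L2_dot_partial0 => //.
  - exact: continuous_ufun.
  - exact: continuous_dufun.
  - by move=> x; exact: is_derive_ufun.
  - by move=> x Fx xk; rewrite psi0 ?mulr0//; exists k.
move=> psi psiC; have cpsi := C1_continuous psiC.
have H : \sum_k \sum_(z <- cube n N) y z * L2_dot a (dufun (hl z) k) (partial k psi)
    @[N --> \oo] --> \sum_k L2_dot a (G k) (partial k psi).
  apply: cvg_big => [|k _]; first exact: add_continuous.
  by apply: cvg_G; case: (psiC k).
apply: (cvg_unique (@Rhausdorff R) H).
apply: (@eq_seq_cvg _ (fun N => - \sum_(z <- cube n N)
    (- enorm (hl z) ^+ 2 * y z) * L2_dot a (ufun (hl z)) psi)); last first.
  by apply: cvgN; exact: (cvg_u y2 cpsi).
move=> N.
rewrite exchange_big/= -sumrN; apply: eq_bigr => z _.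
rewrite -mulr_sumr [RHS](_ : _ =
  y z * (enorm (hl z) ^+ 2 * L2_dot a (ufun (hl z)) psi)); last by ring.
congr (_ * _).
rewrite enorm_sqr /dot mulr_suml; apply: eq_bigr => k _.
have -> : L2_dot a (dufun (hl z) k) (partial k psi) =
    - L2_dot a (fun x => - hl z 0 k ^+ 2 * ufun (hl z) x) psi.
  apply: L2_dot_partial0 => //.
  - exact: continuous_dufun.
  - move=> x; apply: (@continuousM _ _ (fun=> - hl z 0 k ^+ 2) (ufun (hl z))).
      exact: cst_continuous.
    exact: continuous_ufun.
  - by move=> x; exact: is_derive_dufun.
  - by move=> x _ xk; rewrite dufun_face ?mul0r// gt_eqF.
rewrite L2_dotZl; first by rewrite mulNr opprK expr2.
by apply: integrable_continuousM => //; exact: continuous_ufun.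
Qed.

End series.

End neumann_series.

(* On an interval the derivatives of the cosines are themselves admissible in
   the definition of the weak derivative. *)
Lemma neumann_laplacian_coef1 (R : realType) (a : 'I_1 -> R) f h z :
  (forall k, 0 < a k) -> neumann_laplacian a f h ->
  L2_dot a h (ufun (half_lattice_vec a z)) =
  - enorm (half_lattice_vec a z) ^+ 2 * L2_dot a f (ufun (half_lattice_vec a z)).
Proof.
move=> a0 [hL2 [G [[fL2 GL2 Gw] Gn]]]; set u := ufun _.
have := Gn u (C1_ufun _); rewrite big_ord1 partial_ufun => E.
have C1d : C1 (dufun (half_lattice_vec a z) ord0).
  move=> k; rewrite (ord1 k); split=> [x|].
    by have [] := is_derive_dufun (half_lattice_vec a z) x ord0.
  rewrite partial_dufun => x.
  apply: (@continuousM _ _ (fun=> - half_lattice_vec a z 0 ord0 ^+ 2) u).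
    exact: cst_continuous.
  exact: continuous_ufun.
have d0 : zero_on_boundary a (dufun (half_lattice_vec a z) ord0).
  by move=> x _ [k]; rewrite (ord1 k) => xk; rewrite dufun_face// gt_eqF.
have := Gw _ C1d d0 ord0; rewrite partial_dufun E opprK => <-.
rewrite L2_dotC L2_dotZl; last first.
  have := integrable_boundedM (L2_integrable a0 fL2) (measurable_ufun (half_lattice_vec a z))
    (bounded_on_ufun a (half_lattice_vec a z)).
  by congr (_.-integrable _ _); apply/funext => x /=; rewrite mulrC.
by rewrite L2_dotC enorm_sqr /dot big_ord1 expr2.
Qed.

(** * Eigenvalues of infinite symmetric matrices *)

Section ultralimits.
Variable R : realType.

(** An ultrafilter finer than the tails makes all bounded coordinate sequences converge at once,
    which replaces the extraction of a diagonal subsequence. *)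
Lemma ultra_nat : exists U : set_system nat, UltraFilter U /\ \oo `<=` U.
Proof. exact: ultraFilterLemma. Qed.

Lemma ultra_cvg (I : Type) (U : set_system I) (u : I -> R) (M : R) :
  UltraFilter U -> (forall k, `|u k| <= M) -> exists l : R, u k @[k --> U] --> l.
Proof.
move=> UU uM.
have PU : ProperFilter U by exact: ultra_proper.
have uU : UltraFilter (u @ U).
  split; first exact: fmap_proper_filter.
  move=> G PG uG; apply/seteqP; split => A; last exact: uG.
  move=> GA; have [//|nA] := in_ultra_setVsetC (u @^-1` A) UU.
  exfalso; apply: (@filter_not_empty _ G _); rewrite -(setICr A).
  by apply: filterI => //; apply: uG.
have := @segment_compact R (- M) M; rewrite compact_ultra => /(_ (u @ U) uU)[|l [_ ul]].
  by apply: (@filterE _ U) => k; rewrite /= in_itv/= -ler_norml.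
by exists l.
Qed.

End ultralimits.

(** * An eigenvalue of a finite symmetric matrix near a given number *)

Section finite_spectral.
Variables (R : realType) (T : choiceType) (s : seq T) (S : T -> T -> R).
Variables (U : (T -> R) -> Prop) (lambda : R).
Hypothesis Ssym : forall a b, S a b = S b a.
Hypothesis Ulin : forall c y z, U y -> U z -> U (fun x => c * y x + z x).
Hypothesis Usupp : forall y x, U y -> x \notin s -> y x = 0.
Hypothesis Uop : forall y, U y ->
  U (fun a => if a \in s then \sum_(b <- s) S a b * y b else 0).
Hypothesis Ulim : forall (F : set_system nat) (y : nat -> T -> R) z, ProperFilter F ->
  (forall k, U (y k)) -> (forall x, y k x @[k --> F] --> z x) -> U z.

Let ip (y z : T -> R) := \sum_(x <- s) y x * z x.
Let A (y : T -> R) a :=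
  if a \in s then \sum_(b <- s) S a b * y b - lambda * y a else 0.
Let q y := ip (A y) (A y).

Let UA y : U y -> U (A y).
Proof.
move=> Uy; have := Ulin (- lambda) Uy (Uop Uy).
congr U; apply/funext => a; rewrite /A; case: ifPn => as_; first by ring.
by rewrite (Usupp Uy as_) mulr0 addr0.
Qed.

Let ipDl c y z w : ip (fun x => c * y x + z x) w = c * ip y w + ip z w.
Proof.
rewrite /ip mulr_sumr -big_split/=; apply: eq_bigr => x _; ring.
Qed.

Let ipC y z : ip y z = ip z y.
Proof. by apply: eq_bigr => x _; rewrite mulrC. Qed.

Let ip_ge0 y : 0 <= ip y y.
Proof. by apply: sumr_ge0 => x _; rewrite -expr2 sqr_ge0. Qed.

Let AD c y z : A (fun x => c * y x + z x) = (fun x => c * A y x + A z x).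
Proof.
apply/funext => a; rewrite /A; case: ifP => _; last by rewrite mulr0 addr0.
rewrite mulrBr mulr_sumr mulrDr opprD.
under eq_bigr do rewrite mulrDr mulrCA.
by rewrite big_split/=; ring.
Qed.

Let A_sym y z : ip (A y) z = ip y (A z).
Proof.
have E u v : ip (A u) v = \sum_(a <- s) \sum_(b <- s) S a b * u b * v a - lambda * ip u v.
  rewrite /ip mulr_sumr -sumrB big_seq [RHS]big_seq; apply: eq_bigr => a as_.
  by rewrite /A as_ mulrBl mulr_suml mulrA.
rewrite [RHS]ipC !E (ipC z); congr (_ - _).
rewrite exchange_big/=; apply: eq_bigr => a _; apply: eq_bigr => b _.
by rewrite Ssym; ring.
Qed.

Let q_expand t y z : q (fun x => t * z x + y x) =
  t ^+ 2 * q z + 2 * t * ip (A y) (A z) + q y.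
Proof.
rewrite /q AD ipDl [ip (A z) _]ipC [ip (A y) _]ipC !ipDl.
by rewrite (ipC (A z) (A y)); ring.
Qed.

Let ip_expand t y z : ip (fun x => t * z x + y x) (fun x => t * z x + y x) =
  t ^+ 2 * ip z z + 2 * t * ip y z + ip y y.
Proof. by rewrite ipDl [ip z _]ipC [ip y _]ipC !ipDl (ipC z y); ring. Qed.

Let lin_quad_ge0 (B C : R) : (forall t, 0 <= t ^+ 2 * C + 2 * t * B) -> B = 0.
Proof.
move=> h; apply/eqP; rewrite -normr_le0 leNgt; apply/negP => B0.
have C1 : 0 < `|C| + 1 by rewrite ltr_wpDl.
have := h (- B / (`|C| + 1)); apply/negP; rewrite -ltNge.
have -> : (- B / (`|C| + 1)) ^+ 2 * C + 2 * (- B / (`|C| + 1)) * B =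
   (B / (`|C| + 1)) ^+ 2 * (C - 2 * (`|C| + 1)).
  by field; rewrite gt_eqF.
have Bn0 : B != 0 by rewrite -normr_gt0.
have Cn0 : `|C| + 1 != 0 by rewrite gt_eqF.
rewrite nmulr_llt0; first by rewrite exprn_even_gt0//= mulf_neq0 ?invr_eq0.
by have := ler_norm C; lra.
Qed.

Variable x0 : T -> R.
Hypotheses (Ux0 : U x0) (x0_gt0 : 0 < ip x0 x0).

Let normalize y : U y -> 0 < ip y y ->
  exists2 c, 0 < c & ip (fun x => c * y x) (fun x => c * y x) = 1 /\ c ^+ 2 * ip y y = 1.
Proof.
move=> Uy y0; exists (Num.sqrt (ip y y))^-1; first by rewrite invr_gt0 sqrtr_gt0.
have E : (Num.sqrt (ip y y))^-1 ^+ 2 * ip y y = 1.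
  by rewrite exprVn sqr_sqrtr ?ltW// mulVf// gt_eqF.
split => //; rewrite -[RHS]E /ip mulr_sumr; apply: eq_bigr => x _; ring.
Qed.

Let U0 : U (fun=> 0).
Proof.
have := Ulin (-1) Ux0 Ux0; congr U; apply/funext => x; ring.
Qed.

Let UZ c y : U y -> U (fun x => c * y x).
Proof. by move=> Uy; have := Ulin c Uy U0; congr U; apply/funext => x; rewrite addr0. Qed.

Let qZ c y : q (fun x => c * y x) = c ^+ 2 * q y.
Proof.
have := q_expand c (fun=> 0) y.
have A0 : A (fun=> 0) = fun=> 0.
  apply/funext => a; rewrite /A; case: ifP => // _.
  by rewrite mulr0 subr0 big1// => b _; rewrite mulr0.
rewrite /q A0 (_ : ip (fun=> 0) (A y) = 0) ?mulr0 ?addr0.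
  rewrite (_ : ip (fun=> 0) (fun=> 0) = 0) ?addr0; first by move=> <-; congr (ip (A _) (A _)); apply/funext => x; rewrite addr0.
  by rewrite /ip big1// => x _; rewrite mulr0.
by rewrite /ip big1// => x _; rewrite mul0r.
Qed.

Let Q : set R := [set q y | y in [set y | U y /\ ip y y = 1]].

Let Q_inf : has_inf Q.
Proof.
split; last by exists 0 => _ [y _ <-]; exact: ip_ge0.
have [c c0 [E _]] := normalize Ux0 x0_gt0.
by exists (q (fun x => c * x0 x)), (fun x => c * x0 x) => //; split => //; exact: UZ.
Qed.

Let mu2 := inf Q.

Let mu2_ge0 : 0 <= mu2.
Proof. by apply: lb_le_inf; [case: Q_inf|move=> _ [y _ <-]; exact: ip_ge0]. Qed.

Let mu2_le y : U y -> mu2 * ip y y <= q y.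
Proof.
move=> Uy; have [y0|] := ltP 0 (ip y y).
  have [c c0 [E1 E2]] := normalize Uy y0.
  have : mu2 <= q (fun x => c * y x).
    by apply: ge_inf; [case: Q_inf|exists (fun x => c * y x) => //; split => //; exact: UZ].
  rewrite qZ => h; have y2 : 0 < c ^+ 2 by rewrite exprn_gt0.
  rewrite -(ler_pM2l y2); apply: le_trans h; rewrite mulrCA E2 mulr1 lexx//.
move=> y0; have -> : ip y y = 0 by apply/eqP; rewrite eq_le y0 ip_ge0.
by rewrite mulr0 ip_ge0.
Qed.

(** Unit vectors have coordinates bounded by 1 and [s] is finite, so norm and form pass to the
    ultralimit of a minimising sequence. *)
Let minimizer : exists y, [/\ U y, ip y y = 1 & q y = mu2].
Proof.
have /choice[y yP] : forall k : nat, exists y, [/\ U y, ip y y = 1 &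
    q y <= mu2 + k.+1%:R^-1].
  move=> k; have k0 : (0 : R) < k.+1%:R^-1 by rewrite invr_gt0 ltr0n.
  have [_ [y [Uy y1] <-] h] := inf_adherent k0 Q_inf.
  by exists y; split => //; exact: ltW.
have [F [FU oF]] := ultra_nat; have PF : ProperFilter F by exact: ultra_proper.
have y1 k x : `|y k x| <= 1.
  have [Uy E _] := yP k; case: (boolP (x \in s)) => xs; last by rewrite (Usupp Uy xs) normr0.
  have : y k x ^+ 2 <= ip (y k) (y k).
    rewrite /ip (big_rem x)//= -expr2 lerDl sumr_ge0// => b _.
    by rewrite -expr2 sqr_ge0.
  by rewrite E -[X in _ <= X](expr1n _ 2) -real_normK ?num_real// ler_pXn2r ?nnegrE.
have /choice[z zP] : forall x, exists l : R, y k x @[k --> F] --> l.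
  by move=> x; exact: (ultra_cvg FU (y1^~ x)).
have cvg_ip (u v : nat -> T -> R) u' v' : (forall x, u k x @[k --> F] --> u' x) ->
    (forall x, v k x @[k --> F] --> v' x) -> ip (u k) (v k) @[k --> F] --> ip u' v'.
  by move=> uu vv; apply: cvg_big => [|x _]; [exact: add_continuous|apply: cvgM].
have cvgA x : A (y k) x @[k --> F] --> A z x.
  rewrite /A; case: ifP => _; last exact: cvg_cst.
  apply: cvgB; last by apply: cvgM; [exact: cvg_cst|exact: zP].
  apply: cvg_big => [|b _]; first exact: add_continuous.
  by apply: cvgM; [exact: cvg_cst|exact: zP].
exists z; split.
- by apply: Ulim PF _ zP => k; case: (yP k).
- apply: (cvg_unique (@Rhausdorff R) (cvg_ip _ _ _ _ zP zP)).
  rewrite (_ : (fun k => ip _ _) = fun=> 1); first exact: cvg_cst.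
  by apply/funext => k; case: (yP k).
apply/eqP; rewrite eq_le; apply/andP; split.
  have H : mu2 + k.+1%:R^-1 @[k --> F] --> mu2.
    rewrite -[X in _ --> X]addr0; apply: cvgD; first exact: cvg_cst.
    by move=> B /(@cvg_harmonic R) hB; exact: oF.
  apply: (ler_cvg_to (cvg_ip _ _ _ _ cvgA cvgA) H).
  by apply: nearW => k; case: (yP k).
have Uz : U z by apply: Ulim PF _ zP => k; case: (yP k).
have := mu2_le Uz; rewrite (_ : ip z z = 1) ?mulr1//.
apply: (cvg_unique (@Rhausdorff R) (cvg_ip _ _ _ _ zP zP)).
rewrite (_ : (fun k => ip _ _) = fun=> 1); first exact: cvg_cst.
by apply/funext => k; case: (yP k).
Qed.

(** Let A = S - lambda and let mu^2 be the minimum of |A y|^2 over the unit vectors of [U]. The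
    minimiser satisfies A^2 y = mu^2 y, and A^2 - mu^2 factors: either v = (A + mu) y is an
    eigenvector of A for mu, or v = 0 and y is one for - mu. The trial vector [x0] bounds mu^2. [U]
    will be the space of vectors invariant under sign changes. *)
Lemma finite_spectral : exists Lambda y, [/\ U y, \sum_(x <- s) y x ^+ 2 = 1,
  forall a, a \in s -> \sum_(b <- s) S a b * y b = Lambda * y a &
  (Lambda - lambda) ^+ 2 * \sum_(x <- s) x0 x ^+ 2 <=
    \sum_(a <- s) (\sum_(b <- s) S a b * x0 b - lambda * x0 a) ^+ 2].
Proof.
have [y [Uy y1 qy]] := minimizer.
pose w x := - mu2 * y x + A (A y) x.
have Uw : U w by apply: Ulin => //; apply: UA; apply: UA.
have orth z : U z -> ip (A y) (A z) - mu2 * ip y z = 0.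
  move=> Uz; apply: (lin_quad_ge0 (C := q z - mu2 * ip z z)) => t.
  have Utz : U (fun x => t * z x + y x) by exact: Ulin.
  have := mu2_le Utz; rewrite q_expand ip_expand qy y1; lra.
(* Stationarity is known only against vectors of [U], but [w] is such a vector, so its own square
   norm is 0. *)
have w0 x : x \in s -> w x = 0.
  have : ip w w = 0.
    by rewrite {1}/w ipDl A_sym -[X in _ + X]/(ip (A y) (A w)) mulNr addrC orth.
  move=> /eqP; rewrite psumr_eq0 => [/allP h xs|z _]; last by rewrite -expr2 sqr_ge0.
  by have := h x xs; rewrite /= mulf_eq0 orbb => /eqP.
have AAy x : A (A y) x = mu2 * y x.
  case: (boolP (x \in s)) => xs.
    by have := w0 x xs; rewrite /w mulNr addrC => /eqP; rewrite subr_eq0 => /eqP.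
  by rewrite (Usupp Uy xs) mulr0 /A (negbTE xs).
pose mu := Num.sqrt mu2.
have mu2E : mu ^+ 2 = mu2 by rewrite sqr_sqrtr.
have bound : mu2 * \sum_(x <- s) x0 x ^+ 2 <=
    \sum_(a <- s) (\sum_(b <- s) S a b * x0 b - lambda * x0 a) ^+ 2.
  have := mu2_le Ux0; rewrite /ip /q /ip; under eq_bigr do rewrite -expr2.
  move=> /le_trans; apply; rewrite big_seq [leRHS]big_seq.
  by apply: ler_sum => a as_; rewrite /A as_ expr2.
pose v x := mu * y x + A y x.
have Uv : U v by apply: Ulin => //; exact: UA.
have eig c z : (forall x, A z x = c * z x) -> forall a, a \in s ->
    \sum_(b <- s) S a b * z b = (lambda + c) * z a.
  move=> h a as_; have := h a; rewrite /A as_ mulrDl => <-; ring.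
have [v0|] := ltP 0 (ip v v); last first.
  move=> v0; have {}v0 x : x \in s -> v x = 0.
    have : ip v v = 0 by apply/eqP; rewrite eq_le v0 ip_ge0.
    move=> /eqP; rewrite psumr_eq0 => [/allP h xs|z _]; last by rewrite -expr2 sqr_ge0.
    by have := h x xs; rewrite /= mulf_eq0 orbb => /eqP.
  exists (lambda + - mu), y; split => //.
  - apply: eig => x; case: (boolP (x \in s)) => xs.
      by have := v0 x xs; rewrite /v mulNr addrC => /eqP; rewrite addr_eq0 => /eqP.
    by rewrite (Usupp Uy xs) mulr0 /A (negbTE xs).
  - by rewrite addrAC subrr add0r sqrrN mu2E.
have [c c0 [E _]] := normalize Uv v0.
exists (lambda + mu), (fun x => c * v x); split.
- exact: UZ.
- by rewrite -[X in _ = X]E; apply: eq_bigr => x _; rewrite expr2.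
- move=> a as_; under eq_bigr do rewrite mulrCA.
  rewrite -mulr_sumr mulrCA; congr (_ * _); apply: eig => // x.
  by rewrite /v AD AAy -mu2E; ring.
- by rewrite addrAC subrr add0r mu2E.
Qed.

End finite_spectral.

Section schur.
Variables (R : realType) (T : choiceType).

Lemma weighted_cauchy (I : Type) (s : seq I) (p z : I -> R) : (forall b, 0 <= p b) ->
  (\sum_(b <- s) p b * z b) ^+ 2 <=
  (\sum_(b <- s) p b) * (\sum_(b <- s) p b * z b ^+ 2).
Proof.
move=> p0.
have P0 t : 0 <= \sum_(b <- t) p b by exact: sumr_ge0.
have Q0 t : 0 <= \sum_(b <- t) p b * z b ^+ 2.
  by apply: sumr_ge0 => b _; rewrite mulr_ge0 ?sqr_ge0.
elim: s => [|x s IH]; first by rewrite !big_nil expr0n mul0r.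
rewrite !big_cons; move: IH (P0 s) (Q0 s) (p0 x).
move: (\sum_(b <- s) p b * z b) (\sum_(b <- s) p b) (\sum_(b <- s) p b * z b ^+ 2).
move=> Sz P Q; move: (p x) (z x) => p1 z1 h P1 Q1 p10.
suff : 0 <= P * z1 ^+ 2 + Q - 2 * Sz * z1.
  move=> h1; have : 0 <= p1 * (P * z1 ^+ 2 + Q - 2 * Sz * z1) by exact: mulr_ge0.
  nra.
have [PE|Pn0] := eqVneq P 0.
  have Sz0 : Sz = 0 by apply/eqP; rewrite -sqrf_eq0 eq_le sqr_ge0 andbT; move: h; rewrite PE mul0r.
  by rewrite PE Sz0; lra.
have Pgt : 0 < P by rewrite lt_neqAle eq_sym Pn0.
rewrite -(pmulr_rge0 _ Pgt); have := sqr_ge0 (P * z1 - Sz); nra.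
Qed.

(** Cauchy-Schwarz with the weights |W a b| brings out the row sums; after an exchange of the sums
    the column sums appear. *)
Lemma schur_test (s t : seq T) (W : T -> T -> R) (y : T -> R) B1 B2 :
  (forall a, a \in s -> \sum_(b <- t) `|W a b| <= B1) ->
  (forall b, b \in t -> \sum_(a <- s) `|W a b| <= B2) -> 0 <= B1 ->
  \sum_(a <- s) (\sum_(b <- t) W a b * y b) ^+ 2 <= B1 * B2 * \sum_(b <- t) y b ^+ 2.
Proof.
move=> h1 h2 B10.
apply: le_trans (_ : \sum_(a <- s) B1 * (\sum_(b <- t) `|W a b| * y b ^+ 2) <= _).
  rewrite big_seq [leRHS]big_seq; apply: ler_sum => a as_.
  have Q0 : 0 <= \sum_(b <- t) `|W a b| * y b ^+ 2.
    by apply: sumr_ge0 => b _; rewrite mulr_ge0 ?sqr_ge0.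
  apply: le_trans (ler_wpM2r Q0 (h1 a as_)).
  have := @weighted_cauchy T t (fun b => `|W a b|) (fun b => `|y b|) (fun b => normr_ge0 _).
  have -> : \sum_(b <- t) `|W a b| * `|y b| ^+ 2 = \sum_(b <- t) `|W a b| * y b ^+ 2.
    by apply: eq_bigr => b _; rewrite real_normK ?num_real.
  apply: le_trans; rewrite -real_normK ?num_real// ler_pXn2r ?nnegrE ?sumr_ge0//.
    by apply: le_trans (ler_norm_sum _ _ _) _; apply: ler_sum => b _; rewrite normrM.
rewrite -mulr_sumr -mulrA ler_wpM2l// exchange_big/= mulr_sumr.
rewrite big_seq [leRHS]big_seq; apply: ler_sum => b bt.
by rewrite -mulr_suml ler_wpM2r ?sqr_ge0// h2.
Qed.

End schur.

(** * From truncated matrices to the infinite matrix *)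

Section limit.
Variables (R : realType) (T : choiceType) (G : Type) (act : G -> T -> T).
Variables (W : T -> T -> R) (D : T -> R) (B : R) (s : nat -> seq T).
Hypothesis actK : forall g, involutive (act g).
Hypothesis Wsym : forall a b, W a b = W b a.
Hypothesis Wact : forall g a b, W (act g a) (act g b) = W a b.
Hypothesis Dact : forall g a, D (act g a) = D a.
Hypothesis WB : forall a, sums_le (W a) B.
Hypothesis Dfin : forall r, exists2 t, uniq t & forall a, D a <= r -> a \in t.
Hypothesis s_uniq : forall N, uniq (s N).
Hypothesis s_act : forall N g a, (act g a \in s N) = (a \in s N).
Hypothesis s_exh : forall a, \forall N \near \oo, a \in s N.

Definition act_invariant y := forall g a, y (act g a) = y a :> R.

Let S a b := (a == b)%:R * D a + W a b.

Let sumS N y a : a \in s N ->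
  \sum_(b <- s N) S a b * y b = D a * y a + \sum_(b <- s N) W a b * y b.
Proof.
move=> as_; under eq_bigr do rewrite mulrDl.
rewrite big_split/=; congr (_ + _); rewrite (bigD1_seq a)//= eqxx mul1r big1 ?addr0//.
by move=> b ba; rewrite eq_sym (negbTE ba) !mul0r.
Qed.

Let finite_eigenpair N lambda eps x : act_invariant x -> (forall a, a \notin s N -> x a = 0) ->
  0 < \sum_(a <- s N) x a ^+ 2 ->
  0 <= eps ->
  \sum_(a <- s N) (D a * x a + \sum_(b <- s N) W a b * x b - lambda * x a) ^+ 2 <=
    eps ^+ 2 * \sum_(a <- s N) x a ^+ 2 ->
  exists Lambda y, [/\ `|Lambda - lambda| <= eps, act_invariant y,
    (forall a, a \notin s N -> y a = 0), \sum_(a <- s N) y a ^+ 2 = 1 &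
    forall a, a \in s N -> D a * y a + \sum_(b <- s N) W a b * y b = Lambda * y a].
Proof.
move=> xinv xs x0 eps0 xres.
pose U y := act_invariant y /\ forall a, a \notin s N -> y a = 0.
have := @finite_spectral R T (s N) S U lambda _ _ _ _ _ x _ _.
case.
- move=> a b; rewrite /S Wsym eq_sym; congr (_ + _).
  by have [->|] := eqVneq b a; rewrite ?mul0r.
- move=> c y z [yi ys] [zi zs]; split=> [g a|a as_]; first by rewrite yi zi.
  by rewrite ys// zs// mulr0 addr0.
- by move=> y a [_]; exact.
- move=> y [yi ys]; split=> [g a|a as_]; last by rewrite (negbTE as_).
  rewrite s_act; case: ifP => // as_; rewrite !sumS ?s_act// Dact yi; congr (_ + _).
  transitivity (\sum_(b <- s N) W a (act g b) * y (act g b)).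
    by apply: eq_bigr => b _; rewrite -(Wact g a) actK yi.
  rewrite -(big_map (act g) xpredT (fun b => W a b * y b)); apply: perm_big.
  apply: uniq_perm => //; first by rewrite map_inj_uniq//; exact: (can_inj (actK g)).
  by move=> b; rewrite -[in LHS](actK g b) (mem_map (can_inj (actK g))) s_act.
- move=> F y z PF Uy yz; split=> [g a|a as_].
    apply: (cvg_unique (@Rhausdorff R) (yz (act g a))).
    rewrite (_ : (fun k => _) = (fun k => y k a)); first exact: yz.
    by apply/funext => k; have [-> _] := Uy k.
  apply: (cvg_unique (@Rhausdorff R) (yz a)).
  rewrite (_ : (fun k => _) = (fun=> 0)); first exact: cvg_cst.
  by apply/funext => k; have [_ ->] := Uy k.
- by [].
- by under eq_bigr do rewrite -expr2.
move=> Lambda [y [[yi ys] y1 yeq yres]]; exists Lambda, y; split => //.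
  rewrite -(ler_pXn2r (n := 2)) ?nnegrE// real_normK ?num_real//.
  rewrite -(ler_pM2r x0); apply: le_trans yres _; apply: le_trans xres.
  rewrite big_seq [leRHS]big_seq; apply: ler_sum => a as_; by rewrite sumS.
by move=> a as_; rewrite -sumS// yeq.
Qed.

(** No mass escapes to infinity: at these sites |D - Lambda| >= 2 B + 1, while (Lambda - D) y = W y
    has norm at most B, so the mass is at most (B / (2 B + 1))^2 <= 1/4. *)
Let tail_small lambda eps N Lambda y : `|Lambda - lambda| <= eps ->
  \sum_(a <- s N) y a ^+ 2 = 1 ->
  (forall a, a \in s N -> D a * y a + \sum_(b <- s N) W a b * y b = Lambda * y a) ->
  \sum_(a <- s N | `|lambda| + eps + 2 * B + 1 < D a) y a ^+ 2 <= 4^-1.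
Proof.
move=> Le y1 yeq.
have [B0|nB] := pselect (0 <= B); last first.
  have Tempty (a : T) : False by apply: nB; exact: sums_le_ge0 (WB a).
  by case: (s N) y1 => [|a]; [rewrite !big_nil|case: (Tempty a)].
have schur : \sum_(a <- s N) (\sum_(b <- s N) W a b * y b) ^+ 2 <= B * B * 1.
  rewrite -y1; apply: schur_test => // [a _|b _]; first exact: WB.
  by under eq_bigr do rewrite Wsym; exact: WB.
have h : (2 * B + 1) ^+ 2 * \sum_(a <- s N | `|lambda| + eps + 2 * B + 1 < D a) y a ^+ 2
    <= \sum_(a <- s N) (\sum_(b <- s N) W a b * y b) ^+ 2.
  rewrite mulr_sumr [leRHS](bigID (fun a => `|lambda| + eps + 2 * B + 1 < D a))/=.
  apply: (@le_trans _ _ (\sum_(a <- s N | `|lambda| + eps + 2 * B + 1 < D a)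
      (\sum_(b <- s N) W a b * y b) ^+ 2)); last first.
    by rewrite lerDl sumr_ge0// => a _; rewrite sqr_ge0.
  rewrite big_seq_cond [leRHS]big_seq_cond; apply: ler_sum => a /andP[as_ Da].
  have -> : \sum_(b <- s N) W a b * y b = (Lambda - D a) * y a.
    by rewrite mulrBl -(yeq a as_) addrC addKr.
  rewrite exprMn ler_wpM2r ?sqr_ge0//.
  have : 2 * B + 1 <= D a - Lambda.
    have := ler_norm (Lambda - lambda); have := ler_norm lambda; lra.
  have : 0 <= 2 * B + 1 by lra.
  nra.
move: h schur; move: (\sum_(a <- s N | _) _) (\sum_(a <- s N) _ ^+ 2) => X Y h1 h2.
have : (2 * B + 1) ^+ 2 * X <= B ^+ 2 by lra.
move=> h3; rewrite leNgt; apply/negP => X4; nra.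
Qed.

Theorem eigenvalue_near lambda eps : 0 <= eps ->
  (\forall N \near \oo, exists x, [/\ act_invariant x, (forall a, a \notin s N -> x a = 0),
     0 < \sum_(a <- s N) x a ^+ 2 &
     \sum_(a <- s N) (D a * x a + \sum_(b <- s N) W a b * x b - lambda * x a) ^+ 2 <=
       eps ^+ 2 * \sum_(a <- s N) x a ^+ 2]) ->
  exists Lambda y, [/\ `|Lambda - lambda| <= eps, act_invariant y,
    (forall a, `|y a| <= 1), (exists a, y a != 0) &
    forall a, D a * y a + usum (fun b => W a b * y b) = Lambda * y a].
Proof.
move=> eps0 [N0 _ hN].
have /choice[Ly LyP] : forall N, exists Ly : R * (T -> R), [/\ `|Ly.1 - lambda| <= eps,
    act_invariant Ly.2, (forall a, a \notin s (N + N0)%N -> Ly.2 a = 0),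
    \sum_(a <- s (N + N0)%N) Ly.2 a ^+ 2 = 1 &
    forall a, a \in s (N + N0)%N -> D a * Ly.2 a + \sum_(b <- s (N + N0)%N) W a b * Ly.2 b
      = Ly.1 * Ly.2 a].
  move=> N; have [x [xi xs x0 xres]] := hN (N + N0)%N (leq_addl _ _).
  have [L [y [h1 h2 h3 h4 h5]]] := finite_eigenpair xi xs x0 eps0 xres.
  by exists (L, y).
pose s' N := s (N + N0)%N; pose L N := (Ly N).1; pose y N := (Ly N).2.
have s'_exh a : \forall N \near \oo, a \in s' N.
  have [N1 _ h] := s_exh a; exists N1 => // N N1N; apply: h => /=.
  exact: leq_trans N1N (leq_addr _ _).
have [F [FU oF]] := ultra_nat; have PF : ProperFilter F by exact: ultra_proper.
have y1 N a : `|y N a| <= 1.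
  have [_ _ ys E _] := LyP N.
  case: (boolP (a \in s' N)) => as_; last by rewrite /y ys// normr0.
  have : y N a ^+ 2 <= \sum_(a <- s' N) y N a ^+ 2.
    by rewrite (big_rem a)//= lerDl sumr_ge0// => b _; rewrite sqr_ge0.
  by rewrite E -[X in _ <= X](expr1n _ 2) -real_normK ?num_real// ler_pXn2r ?nnegrE.
have /choice[z zP] : forall a, exists l : R, y k a @[k --> F] --> l.
  by move=> a; exact: (ultra_cvg FU (y1^~ a)).
have Lb N : `|L N| <= `|lambda| + eps.
  have [h _ _ _ _] := LyP N; rewrite -[L N](subrK lambda) addrC.
  by apply: le_trans (ler_normD _ _) _; rewrite lerD2l.
have [Lam LamP] := ultra_cvg FU Lb.
have cvgF (u : nat -> R) (l : R) : u @ \oo --> l -> u k @[k --> F] --> l.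
  by move=> h A /h; exact: oF.
have z1 a : `|z a| <= 1.
  have h : `|y k a| @[k --> F] --> `|z a| by apply: cvg_norm; exact: zP.
  by apply: (cvgr_to_le h); apply: nearW => k.
exists Lam, z; split => //.
- have h : `|L k - lambda| @[k --> F] --> `|Lam - lambda|.
    by apply: cvg_norm; apply: cvgB => //; exact: cvg_cst.
  by apply: (cvgr_to_le h); apply: nearW => k; case: (LyP k).
- move=> g a; apply: (cvg_unique (@Rhausdorff R) (zP (act g a))).
  rewrite (_ : (fun k => _) = (fun k => y k a)); first exact: zP.
  by apply/funext => k; have [_ yi _ _ _] := LyP k; exact: yi.
- have [t ut tD] := Dfin (`|lambda| + eps + 2 * B + 1).
  have h : \sum_(a <- t) y k a ^+ 2 @[k --> F] --> \sum_(a <- t) z a ^+ 2.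
    apply: cvg_big => [|a _]; first exact: add_continuous.
    by rewrite expr2; under eq_fun do rewrite expr2; apply: cvgM; exact: zP.
  (* The finite set [t] does not depend on k and carries 3/4 of the mass of every truncated
     eigenvector, so the limit is not zero. *)
  have : 3 / 4 <= \sum_(a <- t) z a ^+ 2.
    apply: (cvgr_to_ge h); apply: nearW => k; have [Lk _ ys yk yeq] := LyP k.
    have := tail_small Lk yk yeq.
    have : \sum_(a <- s' k | ~~ (`|lambda| + eps + 2 * B + 1 < D a)) y k a ^+ 2
        <= \sum_(a <- t) y k a ^+ 2.
      rewrite -big_filter; apply: ler_sum_subset => //; last by move=> a; rewrite sqr_ge0.
        exact/filter_uniq/s_uniq.
      by move=> a; rewrite mem_filter -leNgt => /andP[/tD].
    by move: yk; rewrite (bigID (fun a => `|lambda| + eps + 2 * B + 1 < D a))/= -/(y k); lra.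
  move=> h34; apply: contrapT => /forallNP z0; move: h34.
  rewrite big1 => [|a _]; first by rewrite leNgt => /negP[]; rewrite divr_gt0.
  by have /negP := z0 a; rewrite negbK => /eqP ->; rewrite expr0n.
- move=> a; have zB : sums_le (fun b => W a b * z b) B.
    apply: le_sums_le (WB a) => b; rewrite normrM -[leRHS]mulr1.
    by rewrite ler_wpM2l.
  have E : D a * y k a + \sum_(b <- s' k) W a b * y k b @[k --> F] -->
      D a * z a + usum (fun b => W a b * z b).
    apply: cvgD; first by apply: cvgM; [exact: cvg_cst|exact: zP].
    apply/cvgrPdist_le => e e0.
    have e3 : 0 < e / 3 by rewrite divr_gt0.
    (* The tail of the row is small uniformly in k, because all coordinates are bounded by 1; on the
       remaining finite set coordinatewise convergence suffices. *)
    have [t0 ut0 ht0] := sums_le_tail (WB a) e3.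
    have [t1 ut1 ht1] := usum_approx zB e3.
    pose t := undup (t0 ++ t1).
    have h : \sum_(b <- t) W a b * y k b @[k --> F] --> \sum_(b <- t) W a b * z b.
      apply: cvg_big => [|b _]; first exact: add_continuous.
      by apply: cvgM; [exact: cvg_cst|exact: zP].
    have sub : \forall k \near F, {subset t <= s' k}.
      elim: (t) => [|b t' IH]; first by apply: nearW => k c; rewrite in_nil.
      have hb : \forall k \near F, b \in s' k by exact: oF (s'_exh b).
      near=> k => c; rewrite inE => /predU1P[->|]; first by near: k.
      by move: c; near: k; exact: IH.
    have hk0 := (cvgrPdist_le _ _).1 h _ e3.
    near=> k.
    have tk : {subset t <= s' k} by near: k; exact: sub.
    have hk : `|\sum_(b <- t) W a b * z b - \sum_(b <- t) W a b * y k b| <= e / 3.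
      by near: k; exact: hk0.
    rewrite (big_subseq_split _ (undup_uniq _) (s_uniq _) tk).
    have h1 : `|\sum_(b <- t) W a b * z b - usum (fun b => W a b * z b)| <= e / 3.
      by apply: ht1; [exact: undup_uniq|move=> b bt; rewrite mem_undup mem_cat bt orbT].
    have h2 : `|\sum_(b <- s' k | b \notin t) W a b * y k b| <= e / 3.
      apply: le_trans (ler_norm_sum _ _ _) _; rewrite -big_filter.
      apply: le_trans (ht0 [seq b <- s' k | b \notin t] _ _); last 2 first.
      - exact/filter_uniq/s_uniq.
      - by move=> b; rewrite mem_filter mem_undup mem_cat negb_or => /andP[/andP[]].
      by apply: ler_sum => b _; rewrite normrM -[leRHS]mulr1 ler_wpM2l.
    move: h1 h2 hk; rewrite !ler_norml => /andP[? ?] /andP[? ?] /andP[? ?].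
    by apply/andP; split; lra.
  apply: (cvg_unique (@Rhausdorff R) E).
  have LE : L k * y k a @[k --> F] --> Lam * z a by apply: cvgM => //; exact: zP.
  apply: cvg_trans LE; apply: near_eq_cvg.
  apply: filterS (oF _ (s'_exh a)) => k as_; have [_ _ _ _ yeq] := LyP k.
  by rewrite /L /y -yeq.
Unshelve. all: by end_near. Qed.

End limit.

(** * Quasimodes *)

Section usum_lemmas.
Variables (R : realType) (T : choiceType).
Implicit Types (c : T -> R) (s : seq T).

Lemma usum_unique c M (l : R) : sums_le c M ->
  (forall e, 0 < e -> exists2 s0, uniq s0 & forall s, uniq s -> {subset s0 <= s} ->
    `|\sum_(x <- s) c x - l| <= e) -> usum c = l.
Proof.
move=> cM h; apply/eqP; rewrite -subr_eq0 -normr_le0; apply/ler_addgt0Pl => e e0.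
rewrite addr0; have e2 : 0 < e / 2 by rewrite divr_gt0.
have [s0 us0 h0] := h _ e2; have [s1 us1 h1] := usum_approx cM e2.
have sub0 : {subset s0 <= undup (s0 ++ s1)}.
  by move=> x xs; rewrite mem_undup mem_cat xs.
have sub1 : {subset s1 <= undup (s0 ++ s1)}.
  by move=> x xs; rewrite mem_undup mem_cat xs orbT.
move: (h0 _ (undup_uniq _) sub0) (h1 _ (undup_uniq _) sub1).
by rewrite !ler_norml => /andP[? ?] /andP[? ?]; apply/andP; split; lra.
Qed.

Lemma usum_finite c s : uniq s -> (forall x, x \notin s -> c x = 0) ->
  usum c = \sum_(x <- s) c x.
Proof.
move=> us cs.
have cE t : uniq t -> {subset s <= t} -> \sum_(x <- t) c x = \sum_(x <- s) c x.
  move=> ut st; rewrite (big_subseq_split c us ut st).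
  by rewrite [X in _ + X]big1 ?addr0// => x /cs.
have cM : sums_le c (\sum_(x <- s) `|c x|).
  move=> t ut; rewrite (bigID (mem s))/= [X in _ + X]big1 ?addr0; last first.
    by move=> x xs; rewrite cs ?normr0.
  rewrite -big_filter; apply: ler_sum_subset => //; first exact: filter_uniq.
  by move=> x; rewrite mem_filter => /andP[].
apply: (usum_unique cM) => e e0; exists s => // t ut st.
by rewrite cE// subrr normr0 ltW.
Qed.

Lemma usumD c c' M M' : sums_le c M -> sums_le c' M' ->
  usum (fun x => c x + c' x) = usum c + usum c'.
Proof.
move=> cM cM'; apply: (usum_unique (sums_leD cM cM')) => e e0.
have e2 : 0 < e / 2 by rewrite divr_gt0.
have [s0 us0 h0] := usum_approx cM e2; have [s1 us1 h1] := usum_approx cM' e2.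
exists (undup (s0 ++ s1)); first exact: undup_uniq.
move=> s us ss; rewrite big_split/=.
have sub0 : {subset s0 <= s}.
  by move=> x xs; apply: ss; rewrite mem_undup mem_cat xs.
have sub1 : {subset s1 <= s}.
  by move=> x xs; apply: ss; rewrite mem_undup mem_cat xs orbT.
move: (h0 _ us sub0) (h1 _ us sub1).
by rewrite !ler_norml => /andP[? ?] /andP[? ?]; apply/andP; split; lra.
Qed.

Lemma usum_bij (T' : choiceType) (f : T' -> T) (g : T -> T') c M :
  cancel f g -> cancel g f -> sums_le c M -> usum (fun x => c (f x)) = usum c.
Proof.
move=> fK gK cM; apply/esym; apply: (usum_unique cM) => e e0.
have cM' : sums_le (fun x => c (f x)) M.
  by move=> t ut; exact: (sums_le_inj (can_inj fK) cM).
have [s us h] := usum_approx cM' e0; exists (map f s).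
  by rewrite map_inj_uniq//; exact: can_inj fK.
move=> t ut st; have -> : t = map f (map g t).
  by rewrite -map_comp map_id_in// => x _; exact: gK.
rewrite big_map; apply: h; first by rewrite map_inj_uniq//; exact: can_inj gK.
by move=> x xs; rewrite -[x]fK map_f// st// map_f.
Qed.

End usum_lemmas.

(** * Cutting off an eigenvector far from its eigenvalue *)

Section far.
Variables (R : realType) (T : choiceType) (W : T -> T -> R) (D : T -> R) (B : R).
Variables (ex : nat -> seq T) (mu tau : R) (y : T -> R) (M : R) (t : seq T).
Hypothesis Wsym : forall a b, W a b = W b a.
Hypothesis WB : forall a, sums_le (W a) B.
Hypothesis ex_uniq : forall N, uniq (ex N).
Hypothesis ex_exh : forall a, \forall N \near \oo, a \in ex N.

(** The finite Schur test along the exhaustion [ex], in the limit. *)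
Lemma schur_usum (z : T -> R) Z s : uniq s -> sums_le (fun b => z b ^+ 2) Z ->
  0 <= B ->
  \sum_(a <- s) usum (fun b => W a b * z b) ^+ 2 <= B ^+ 2 * Z.
Proof.
move=> us zZ B0.
have Z0 := sums_le_ge0 zZ.
have z1 b : `|z b| <= Z + 1.
  have := sums_le_term b zZ; rewrite ger0_norm ?sqr_ge0// -real_normK ?num_real//.
  have := normr_ge0 (z b); nra.
have sW a : sums_le (fun b => W a b * z b) (`|Z + 1| * B).
  by under eq_fun do rewrite mulrC; exact: sums_leM_bounded.
have h : \sum_(a <- s) (\sum_(b <- ex N) W a b * z b) ^+ 2 @[N --> \oo] -->
    \sum_(a <- s) usum (fun b => W a b * z b) ^+ 2.
  apply: cvg_big => [|a _]; first exact: add_continuous.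
  rewrite expr2; under eq_fun do rewrite expr2.
  by apply: cvgM; apply: (cvg_usum (sW a)).
apply: (cvgr_to_le h); apply: nearW => N.
apply: (@le_trans _ _ (B * B * \sum_(b <- ex N) z b ^+ 2)).
  apply: schur_test => // [a _|b _]; first exact: WB.
  by under eq_bigr do rewrite Wsym; exact: WB.
rewrite -expr2 ler_wpM2l ?sqr_ge0//; apply: le_trans (zZ _ (ex_uniq N)).
by apply: ler_sum => b _; exact: ler_norm.
Qed.

Hypothesis yM : sums_le (fun a => y a ^+ 2) M.
Hypothesis yeq : forall a, (mu - D a) * y a = usum (fun b => W a b * y b).
Hypothesis tau0 : 0 < tau.
Hypothesis t_uniq : uniq t.
Hypothesis far : forall a, a \notin t -> tau <= `|D a - mu|.
Hypothesis B_small : B <= tau / 2.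

Let Y2 := psum (fun a => y a ^+ 2).

Let y2_ge0 a : 0 <= y a ^+ 2. Proof. exact: sqr_ge0. Qed.

Let yY2 : sums_le (fun a => y a ^+ 2) Y2.
Proof.
move=> s us; under eq_bigr do rewrite ger0_norm ?sqr_ge0//.
exact: (psum_ub yM).
Qed.

Let B0 : (exists a : T, True) -> 0 <= B.
Proof. by move=> [a _]; exact: sums_le_ge0 (WB a). Qed.

(** Outside [t] the equation gives y = W y / (mu - D) with a denominator of at least tau, and W has
    norm at most B. *)
Let far_small s : 0 <= B -> uniq s -> (forall a, a \in s -> a \notin t) ->
  \sum_(a <- s) y a ^+ 2 <= (B / tau) ^+ 2 * Y2.
Proof.
move=> B0' us st; have := schur_usum us yY2 B0'.
have -> : (B / tau) ^+ 2 * Y2 = B ^+ 2 * Y2 / tau ^+ 2 by rewrite expr_div_n mulrAC.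
rewrite ler_pdivlMr ?exprn_gt0//; apply: le_trans.
rewrite mulr_suml big_seq [leRHS]big_seq; apply: ler_sum => a as_.
rewrite -yeq exprMn mulrC ler_wpM2r ?sqr_ge0//.
rewrite -[leRHS]real_normK ?num_real// ler_pXn2r ?nnegrE ?(ltW tau0)//.
by rewrite distrC far// st.
Qed.

Let ratio : 0 <= B -> (B / tau) ^+ 2 <= 4^-1.
Proof.
move=> B0'; have h : B / tau <= 2^-1 by rewrite ler_pdivrMr// mulrC.
have : 0 <= B / tau by rewrite divr_ge0// ltW.
nra.
Qed.

(** The mass outside [t] is at most (B / tau)^2 <= 1/4 of the whole; the constant 2 is a round upper
    bound for 4/3. *)
Lemma near_mass : Y2 <= 2 * \sum_(a <- t) y a ^+ 2.
Proof.
have [B0'|nB] := pselect (0 <= B); last first.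
  have Tempty (a : T) : False by apply: nB; apply: B0; exists a.
  apply: (@le_trans _ _ 0); last by rewrite mulr_ge0 ?sumr_ge0.
  have y0 : sums_le (fun a => y a ^+ 2) (0 : R) by case=> [|a]; [rewrite big_nil|case: (Tempty a)].
  exact: (psum_le y0).
have S0 : 0 <= \sum_(a <- t) y a ^+ 2 by apply: sumr_ge0.
have : Y2 <= \sum_(a <- t) y a ^+ 2 + 4^-1 * Y2; last by lra.
apply: psum_le => s us; under eq_bigr do rewrite ger0_norm ?sqr_ge0//.
rewrite (bigID (mem t))/= lerD//.
  rewrite -big_filter; apply: ler_sum_subset => //; first exact: filter_uniq.
  by move=> x; rewrite mem_filter => /andP[].
rewrite -big_filter; apply: le_trans (far_small B0' _ _) _.
- exact: filter_uniq.
- by move=> x; rewrite mem_filter => /andP[].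
- rewrite ler_wpM2r ?ratio//; exact: sums_le_ge0 yY2.
Qed.

(** By the equation the residual on [t] is - W applied to the part [z] that was cut off. One factor
    B / tau is the size of [z], the other factor B the norm of W. *)
Lemma near_residual : \sum_(a <- t) (D a * y a + \sum_(b <- t) W a b * y b - mu * y a) ^+ 2 <=
  (2 * (B ^+ 2 / tau) ^+ 2) * \sum_(a <- t) y a ^+ 2.
Proof.
have [B0'|nB] := pselect (0 <= B); last first.
  have Tempty (a : T) : False by apply: nB; apply: B0; exists a.
  by case: (t) => [|a]; [rewrite !big_nil mulr0|case: (Tempty a)].
pose z b := if b \in t then 0 else y b.
have zZ : sums_le (fun b => z b ^+ 2) ((B / tau) ^+ 2 * Y2).
  move=> s us; under eq_bigr do rewrite ger0_norm ?sqr_ge0//.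
  rewrite (bigID (mem t))/= big1 ?add0r => [|b bt]; last by rewrite /z bt expr0n.
  rewrite -big_filter; apply: le_trans (far_small B0' (s := [seq b <- s | b \notin t]) _ _).
  - rewrite big_seq [leRHS]big_seq; apply: ler_sum => b.
    by rewrite mem_filter /z => /andP[/negbTE -> _].
  - exact: filter_uniq.
  - by move=> b; rewrite mem_filter => /andP[].
have y1 b : `|y b| <= Y2 + 1.
  have := sums_le_term b yY2; rewrite ger0_norm ?sqr_ge0// -real_normK ?num_real//.
  have := normr_ge0 (y b); have := sums_le_ge0 yY2; nra.
have sW a u : (forall b, `|u b| <= `|y b|) ->
    sums_le (fun b => W a b * u b) (`|Y2 + 1| * B).
  move=> uy; under eq_fun do rewrite mulrC; apply: sums_leM_bounded => // b.
  exact: le_trans (y1 b).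
have E a : D a * y a + \sum_(b <- t) W a b * y b - mu * y a = - usum (fun b => W a b * z b).
  have -> : \sum_(b <- t) W a b * y b =
      usum (fun b => W a b * (if b \in t then y b else 0)).
    rewrite (usum_finite t_uniq) => [|b /negbTE ->]; last by rewrite mulr0.
    by rewrite big_seq [RHS]big_seq; apply: eq_bigr => b ->.
  have := yeq a.
  rewrite (_ : (fun b => W a b * y b) = (fun b =>
     W a b * (if b \in t then y b else 0) + W a b * z b)); last first.
    by apply/funext => b; rewrite /z; case: ifP => _; rewrite mulr0 ?addr0 ?add0r.
  rewrite (usumD (sW a (fun b => if b \in t then y b else 0) _) (sW a z _)).
  - lra.
  - by move=> b; case: ifP => _ //; rewrite normr0.
  - by move=> b; rewrite /z; case: ifP => _ //; rewrite normr0.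
under eq_bigr do rewrite E sqrrN.
apply: le_trans (schur_usum t_uniq zZ B0') _.
have := near_mass => nm.
apply: le_trans (_ : B ^+ 2 * ((B / tau) ^+ 2 * (2 * \sum_(a <- t) y a ^+ 2)) <= _).
  by rewrite !ler_wpM2l ?sqr_ge0.
rewrite le_eqVlt; apply/orP; left; apply/eqP.
by rewrite !expr_div_n; ring.
Qed.

End far.

(** * Correction and symmetrisation of an approximate eigenvector *)

Section quasimode.
Variables (R : realType) (T : choiceType) (G : finType) (act : G -> T -> T).
Variables (W : T -> T -> R) (D : T -> R) (B : R) (s t : seq T).
Variables (chi : T -> R) (lambda tau e1 e2 : R).
Hypothesis actK : forall g, involutive (act g).
Hypothesis act1 : exists g, forall a, act g a = a.
Hypothesis actM : forall h, exists2 hm : G -> G, injective hm &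
  forall g a, act g (act h a) = act (hm g) a.
Hypothesis Wsym : forall a b, W a b = W b a.
Hypothesis Wact : forall g a b, W (act g a) (act g b) = W a b.
Hypothesis Dact : forall g a, D (act g a) = D a.
Hypothesis WB : forall a, sums_le (W a) B.
Hypothesis s_uniq : uniq s.
Hypothesis s_act : forall g a, (act g a \in s) = (a \in s).
Hypothesis t_uniq : uniq t.
Hypothesis ts : {subset t <= s}.
Hypothesis chi_supp : forall a, a \notin t -> chi a = 0.
Hypothesis chi_act : forall g a, a \in t -> chi (act g a) = chi a \/ chi (act g a) = 0.
Hypothesis tau0 : 0 < tau.
Hypothesis B0 : 0 <= B.
Hypothesis Btau : #|G|%:R * (B / tau) <= 2^-1.
Hypothesis e2_ge0 : 0 <= e2.

Let N := \sum_(a <- t) chi a ^+ 2.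
Let bad a := (a \notin t) && (`|D a - lambda| < tau).

Hypothesis res1 :
  \sum_(a <- t) (D a * chi a + \sum_(b <- t) W a b * chi b - lambda * chi a) ^+ 2 <=
  e1 ^+ 2 * N.
Hypothesis bad_row : forall a, bad a -> \sum_(b <- t) `|W a b| <= e2.
Hypothesis bad_col : forall b, b \in t -> forall r, uniq r -> all bad r ->
  \sum_(a <- r) `|W a b| <= e2.

Let w a := \sum_(b <- t) W a b * chi b.
Let good a := [&& a \in s, a \notin t & tau <= `|D a - lambda|].
(* First-order perturbation theory, with the diagonal of the operator only *)
Let eta a := if good a then - (w a / (D a - lambda)) else 0.
Let x a := chi a + eta a.
Let res x a := D a * x a + \sum_(b <- s) W a b * x b - lambda * x a.
Let K : R := #|G|%:R.

Let N0 : 0 <= N. Proof. by apply: sumr_ge0 => a _; exact: sqr_ge0. Qed.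

Let w_le r : uniq r -> \sum_(a <- r) w a ^+ 2 <= B * B * N.
Proof.
move=> ur; apply: schur_test => // [a _|b _]; first exact: WB.
by under eq_bigr do rewrite Wsym; exact: WB.
Qed.

Let eta_le : \sum_(a <- s) eta a ^+ 2 <= (B / tau) ^+ 2 * N.
Proof.
have -> : (B / tau) ^+ 2 * N = B * B * N / tau ^+ 2 by rewrite expr_div_n mulrAC expr2.
rewrite ler_pdivlMr ?exprn_gt0//; apply: le_trans (w_le s_uniq).
rewrite mulr_suml; apply: ler_sum => a _; rewrite /eta.
case: ifPn => [/and3P[_ _ h]|_]; last by rewrite expr0n mul0r sqr_ge0.
have d0 : 0 < `|D a - lambda| := lt_le_trans tau0 h.
rewrite sqrrN expr_div_n mulrAC ler_pdivrMr.
  rewrite ler_wpM2l ?sqr_ge0// -[leRHS]real_normK ?num_real//.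
  by rewrite ler_pXn2r ?nnegrE ?(ltW tau0).
by rewrite -real_normK ?num_real// exprn_gt0.
Qed.

(** At good sites the correction cancels W chi exactly. What remains is the residual of [chi] on [t]
    ([r1]), the uncorrected W chi at the bad sites ([r2]) and the second order term W eta ([r3]). *)
Let res_x_le : \sum_(a <- s) res x a ^+ 2 <=
  3 * (e1 ^+ 2 + e2 ^+ 2 + (B ^+ 2 / tau) ^+ 2) * N.
Proof.
pose r1 a := if a \in t then D a * chi a + w a - lambda * chi a else 0.
pose r2 a := if bad a then w a else 0.
pose r3 a := \sum_(b <- s) W a b * eta b.
have resE a : a \in s -> res x a = r1 a + r2 a + r3 a.
  move=> as_; have -> : res x a = (D a - lambda) * chi a + w a + (D a - lambda) * eta a + r3 a.
    have wE : w a = \sum_(b <- s) W a b * chi b.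
      rewrite (big_subseq_split _ t_uniq s_uniq ts) [X in _ + X]big1 ?addr0// => b bt.
      by rewrite chi_supp ?mulr0.
    rewrite /res /r3 wE /x; under eq_bigr do rewrite mulrDr.
    by rewrite big_split/=; ring.
  congr (_ + _); rewrite /r1 /r2 /bad /eta /good as_/=.
  case: (boolP (a \in t)) => at_ /=; first by ring.
  rewrite chi_supp//; case: ltP => h /=; first by ring.
  have d0 : D a - lambda != 0 by rewrite -normr_gt0 (lt_le_trans tau0 h).
  by rewrite mulrN mulrCA divff// mulr1 mulr0 add0r subrr addr0.
have r1_le : \sum_(a <- s) r1 a ^+ 2 <= e1 ^+ 2 * N.
  apply: le_trans res1; rewrite (big_subseq_split _ t_uniq s_uniq ts).
  rewrite [X in _ + X]big1 ?addr0 => [|a at_]; last by rewrite /r1 (negbTE at_) expr0n.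
  by rewrite big_seq [leRHS]big_seq; apply: ler_sum => a at_; rewrite /r1 at_.
have r2_le : \sum_(a <- s) r2 a ^+ 2 <= e2 ^+ 2 * N.
  have -> : \sum_(a <- s) r2 a ^+ 2 = \sum_(a <- [seq a <- s | bad a]) w a ^+ 2.
    rewrite big_filter (bigID bad)/= [X in _ + X]big1 ?addr0.
      by apply: eq_bigr => a ba; rewrite /r2 ba.
    by move=> a nba; rewrite /r2 (negbTE nba) expr0n.
  rewrite expr2; apply: schur_test => // [a|b bt].
    by rewrite mem_filter => /andP[ba _]; exact: bad_row.
  by apply: bad_col => //; [exact: filter_uniq|exact: filter_all].
have r3_le : \sum_(a <- s) r3 a ^+ 2 <= (B ^+ 2 / tau) ^+ 2 * N.
  apply: (@le_trans _ _ (B * B * \sum_(b <- s) eta b ^+ 2)).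
    apply: schur_test => // [a _|b _]; first exact: WB.
    by under eq_bigr do rewrite Wsym; exact: WB.
  apply: le_trans (ler_wpM2l _ eta_le) _; first by rewrite mulr_ge0.
  by rewrite le_eqVlt !expr_div_n; apply/orP; left; apply/eqP; ring.
apply: (@le_trans _ _ (3 * (\sum_(a <- s) r1 a ^+ 2 + \sum_(a <- s) r2 a ^+ 2 +
    \sum_(a <- s) r3 a ^+ 2))).
  rewrite -!big_split/= mulr_sumr big_seq [leRHS]big_seq; apply: ler_sum => a as_.
  rewrite resE//; move: (r1 a) (r2 a) (r3 a) => u v z.
  have := sqr_ge0 (u - v); have := sqr_ge0 (v - z); have := sqr_ge0 (u - z); nra.
by rewrite -mulrA ler_wpM2l// !mulrDl !lerD.
Qed.

Let sumG y a := \sum_(g : G) y (act g a) : R.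

Let sum_act (y : T -> R) g : \sum_(a <- s) y (act g a) = \sum_(a <- s) y a.
Proof.
rewrite -(big_map (act g) xpredT y); apply: perm_big; apply: uniq_perm => //.
  by rewrite map_inj_uniq//; exact: (can_inj (actK g)).
by move=> b; rewrite -[in LHS](actK g b) (mem_map (can_inj (actK g))) s_act.
Qed.

Let sumG_le y : \sum_(a <- s) sumG y a ^+ 2 <= K ^+ 2 * \sum_(a <- s) y a ^+ 2.
Proof.
apply: (@le_trans _ _ (\sum_(a <- s) K * \sum_(g : G) y (act g a) ^+ 2)).
  apply: ler_sum => a _.
  have := @weighted_cauchy R G (index_enum G) (fun=> 1) (fun g => y (act g a)) (fun=> ler01).
  rewrite -/(sumG y a) sumr_const -/K.
  by under eq_bigr do rewrite mul1r; under [X in _ * X]eq_bigr do rewrite mul1r.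
rewrite -mulr_sumr exchange_big/=.
under eq_bigr do rewrite (sum_act (fun a => y a ^+ 2)).
by rewrite sumr_const -[X in _ * X]mulr_natl -/K mulrA -expr2.
Qed.

(** Composition with [h] only permutes the terms of the sum, through [hm]. *)
Let sumG_inv y : act_invariant act (sumG y).
Proof.
move=> h a; have [hm hmI hmE] := actM h.
rewrite /sumG [RHS](reindex_inj hmI)/=; apply: eq_bigr => g _.
by rewrite hmE.
Qed.

(** Each term is chi a or 0, and the identity contributes chi a, so the sum is a multiple of chi a
    by a number at least 1: there is no cancellation. *)
Let sumG_chi a : a \in t -> chi a ^+ 2 <= sumG chi a ^+ 2.
Proof.
move=> at_; have [g0 g0E] := act1.
have : exists2 c : R, 1 <= c & sumG chi a = c * chi a.
  exists (\sum_(g : G) (chi (act g a) == chi a)%:R).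
    rewrite (bigD1 g0)//= g0E eqxx lerDl sumr_ge0// => g _.
  rewrite /sumG mulr_suml; apply: eq_bigr => g _.
  have [->|/eqP ne] := eqVneq (chi (act g a)) (chi a); first by rewrite mul1r.
  by rewrite mul0r; case: (chi_act g at_).
move=> [c c1 ->]; rewrite exprMn -[leLHS]mul1r ler_wpM2r ?sqr_ge0//.
nra.
Qed.

Lemma quasimode : exists y, [/\ act_invariant act y, (forall a, a \notin s -> y a = 0),
  N <= 4 * \sum_(a <- s) y a ^+ 2 &
  \sum_(a <- s) (D a * y a + \sum_(b <- s) W a b * y b - lambda * y a) ^+ 2 <=
  K ^+ 2 * (3 * (e1 ^+ 2 + e2 ^+ 2 + (B ^+ 2 / tau) ^+ 2)) * N].
Proof.
exists (sumG x); split.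
- exact: sumG_inv.
- move=> a as_; apply: big1 => g _; have gs : act g a \notin s by rewrite s_act.
  rewrite /x /eta /good (negbTE gs)/= addr0 chi_supp//.
  by apply: contra gs; exact: ts.
- have h1 : N <= \sum_(a <- s) sumG chi a ^+ 2.
    apply: (@le_trans _ _ (\sum_(a <- t) sumG chi a ^+ 2)).
      by rewrite /N big_seq [leRHS]big_seq; apply: ler_sum => a at_; exact: sumG_chi.
    by apply: ler_sum_subset => // a; exact: sqr_ge0.
  have h2 : \sum_(a <- s) sumG eta a ^+ 2 <= 4^-1 * N.
    apply: le_trans (sumG_le _) _.
    apply: le_trans (ler_wpM2l _ eta_le) _; first exact: sqr_ge0.
    rewrite mulrA -exprMn ler_wpM2r//.
    have : 0 <= K * (B / tau) by rewrite mulr_ge0 ?ler0n// divr_ge0// ltW.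
    move: Btau; rewrite -/K; nra.
  (* From u^2 / 2 <= (u + v)^2 + v^2. As the symmetrised correction has mass at most N / 4, at least
     N / 4 remains. *)
  have : 2^-1 * \sum_(a <- s) sumG chi a ^+ 2 <=
      \sum_(a <- s) sumG x a ^+ 2 + \sum_(a <- s) sumG eta a ^+ 2.
    rewrite -big_split mulr_sumr /=; apply: ler_sum => a _.
    rewrite /sumG /x big_split/= -/(sumG chi a) -/(sumG eta a).
    have := sqr_ge0 (sumG chi a + 2 * sumG eta a); nra.
  lra.
(* The operator commutes with the action, so the residual of the sum is the sum of the residuals and
   its norm grows by a factor [K] at most. *)
have E a : D a * sumG x a + \sum_(b <- s) W a b * sumG x b - lambda * sumG x a =
    sumG (res x) a.
  rewrite [RHS](_ : _ = \sum_g (D a * x (act g a)) +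
      \sum_g \sum_(b <- s) W (act g a) b * x b - \sum_g lambda * x (act g a)); last first.
    by rewrite -big_split -sumrB; apply: eq_bigr => g _; rewrite /res Dact.
  rewrite -!mulr_sumr; congr (_ + _ - _).
  transitivity (\sum_(b <- s) \sum_(g : G) W a b * x (act g b)).
    by apply: eq_bigr => b _; rewrite mulr_sumr.
  rewrite exchange_big/=; apply: eq_bigr => g _.
  rewrite -(sum_act (fun b => W (act g a) b * x b) g).
  by apply: eq_bigr => b _; rewrite Wact.
under eq_bigr do rewrite E.
apply: le_trans (sumG_le _) _; rewrite -mulrA ler_wpM2l ?sqr_ge0//.
Qed.

End quasimode.

(** * Decay of coefficients and eigenvectors *)

Section weights.
Variables (R : realType) (d : nat).

Lemma cauchy_schwarz (I : Type) (s : seq I) (x y : I -> R) :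
  (\sum_(b <- s) x b * y b) ^+ 2 <=
  (\sum_(b <- s) x b ^+ 2) * (\sum_(b <- s) y b ^+ 2).
Proof.
have := weighted_cauchy s (fun b => y b / x b) (fun b => sqr_ge0 (x b)).
have -> : \sum_(b <- s) x b ^+ 2 * (y b / x b) = \sum_(b <- s) x b * y b.
  apply: eq_bigr => b _; have [->|x0] := eqVneq (x b) 0.
    by rewrite expr0n !mul0r.
  by rewrite expr2 -mulrA [y b / _]mulrC mulVKf.
move=> /le_trans; apply; rewrite ler_wpM2l ?sumr_ge0// => [b _|]; first exact: sqr_ge0.
apply: ler_sum => b _; have [->|x0] := eqVneq (x b) 0.
  by rewrite expr0n mul0r sqr_ge0.
by rewrite expr_div_n mulrC divfK// expf_neq0.
Qed.

Lemma enorm_ge0 (x : 'rV[R]_d) : 0 <= enorm x.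
Proof. exact: sqrtr_ge0. Qed.

Lemma ler_enormD (x y : 'rV[R]_d) : enorm (x + y) <= enorm x + enorm y.
Proof.
rewrite -(@ler_pXn2r _ 2)// ?nnegrE ?addr_ge0 ?enorm_ge0//.
rewrite sqrrD !enorm_sqr /dot.
have -> : \sum_k (x + y) 0 k * (x + y) 0 k = \sum_k x 0 k * x 0 k +
   2 * (\sum_k x 0 k * y 0 k) + \sum_k y 0 k * y 0 k.
  rewrite mulr_sumr -!big_split/=; apply: eq_bigr => k _; rewrite !mxE; ring.
rewrite lerD2r lerD2l mulr_natl lerMn2r/=.
apply: le_trans (ler_norm _) _.
rewrite -(@ler_pXn2r _ 2)// ?nnegrE ?mulr_ge0 ?enorm_ge0//.
rewrite real_normK ?num_real// exprMn !enorm_sqr /dot.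
have := cauchy_schwarz (index_enum _) (fun k => x 0 k) (fun k => y 0 k).
by congr (_ <= _ * _); apply: eq_bigr => k _; rewrite expr2.
Qed.

Lemma enormN (x : 'rV[R]_d) : enorm (- x) = enorm x.
Proof. by congr Num.sqrt; apply: eq_bigr => k _; rewrite !mxE mulrNN. Qed.

Lemma enorm_flip s (x : 'rV[R]_d) : enorm (flip s x) = enorm x.
Proof.
congr Num.sqrt; apply: eq_bigr => k _; rewrite !mxE.
by case: (s k); rewrite ?expr0 ?expr1 ?mul1r// !mulN1r mulrNN.
Qed.

Variable a : 'I_d -> R.
Hypothesis a0 : forall k, 0 < a k.
Local Notation hl := (half_lattice_vec a).

Definition wt (z : 'rV[int]_d) : R := 1 + enorm (hl z).

Lemma wt_ge1 z : 1 <= wt z.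
Proof. by rewrite lerDl enorm_ge0. Qed.

Lemma wt_gt0 z : 0 < wt z.
Proof. exact: lt_le_trans ltr01 (wt_ge1 z). Qed.

Lemma wtM z w : wt (z + w) <= wt z * wt w.
Proof.
rewrite /wt half_lattice_vecD; have := ler_enormD (hl z) (hl w).
have := enorm_ge0 (hl z); have := enorm_ge0 (hl w); nra.
Qed.

Lemma sum_inv_sqr_le N : \sum_(i < N) (1 + i%:R ^+ 2)^-1 <= 3 :> R.
Proof.
(* The term subtracted on the right makes the induction work, since 1 / (1 + (u+1)^2) <= 2 / (u+1) -
   2 / (u+2). *)
suff h M : \sum_(i < M.+1) (1 + i%:R ^+ 2)^-1 <= 3 - 2 * M.+1%:R^-1 :> R.
  case: N => [|N]; first by rewrite big_ord0.
  by apply: le_trans (h N) _; rewrite lerBlDr lerDl mulr_ge0// invr_ge0 ler0n.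
elim: M => [|M IH]; first by rewrite big_ord1 expr0n /= addr0 !invr1; lra.
rewrite big_ord_recr/=; apply: le_trans (lerD IH (lexx _)) _.
have M0 : 0 <= M%:R :> R by rewrite ler0n.
have -> : M.+2%:R = M%:R + 2 :> R by rewrite -addn2 natrD.
have -> : M.+1%:R = M%:R + 1 :> R by rewrite -addn1 natrD.
move: (M%:R) M0 => u u0.
have h : (1 + (u + 1) ^+ 2)^-1 <= 2 / (u + 1) - 2 / (u + 2).
  have -> : 2 / (u + 1) - 2 / (u + 2) = 2 / ((u + 1) * (u + 2)).
    by field; apply/andP; split; apply: lt0r_neq0; lra.
  rewrite ler_pdivlMr ?mulr_gt0//; [|lra|lra].
  by rewrite mulrC ler_pdivrMr; nra.
lra.
Qed.

Lemma sum_inv_sqr_cube N : \sum_(i < N.*2.+1) (1 + ((i : nat)%:Z - N%:Z)%:~R ^+ 2)^-1 <= 6 :> R.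
Proof.
rewrite (_ : N.*2.+1 = N + N.+1)%N; last by rewrite -addnn addnS.
rewrite big_split_ord/= (_ : 6 = 3 + 3) ?lerD//; last 2 first.
- rewrite (eq_bigr (fun i : 'I_N.+1 => (1 + i%:R ^+ 2)^-1)); first exact: sum_inv_sqr_le.
  by move=> i _; rewrite PoszD addrAC subrr add0r.
- by rewrite -natrD.
rewrite (reindex_inj rev_ord_inj)/=.
apply: le_trans (sum_inv_sqr_le N.+1).
rewrite big_ord_recl/= -[leLHS]add0r lerD ?invr_ge0 ?addr_ge0 ?sqr_ge0//.
apply: ler_sum => i _; rewrite /bump/= add1n.
have -> : ((N - i.+1)%N%:Z - N%:Z)%:~R = - i.+1%:R :> R.
  by rewrite -subzn// addrAC subrr add0r intrN.
by rewrite sqrrN.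
Qed.

Let prodw (z : 'rV[int]_d) : R := \prod_k (1 + (z 0 k)%:~R ^+ 2)^-1.

Let prodw_ge0 z : 0 <= prodw z.
Proof. by apply: prodr_ge0 => k _; rewrite invr_ge0 addr_ge0 ?sqr_ge0. Qed.

(** Over a cube the sum factors into [d] one-dimensional sums, each at most 6. *)
Lemma sum_prodw : sums_le prodw (6 ^+ d).
Proof.
move=> s us; under eq_bigr do rewrite ger0_norm//.
have [N sN] : exists N, {subset s <= cube d N}.
  elim: s {us} => [|z s [N IH]]; first by exists 0%N.
  have [N1 _ h] := near_mem_cube z; exists (N + N1)%N => w.
  rewrite inE => /predU1P[->|/IH]; first by apply: h; exact: leq_addl.
  rewrite !mem_cube => /forallP wN; apply/forallP => k.
  by apply: le_trans (wN k) _; rewrite lez_nat leq_addr.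
apply: le_trans (ler_sum_subset us (cube_uniq d N) sN prodw_ge0) _.
rewrite /cube big_map big_enum/=.
under eq_bigr do (rewrite /prodw; under eq_bigr do rewrite mxE).
rewrite -(bigA_distr_bigA (fun (k : 'I_d) (i : 'I_(N.*2.+1)) =>
  (1 + ((i : nat)%:Z - N%:Z)%:~R ^+ 2)^-1))/=.
rewrite prodr_const card_ord lerXn2r ?nnegrE//; last exact: sum_inv_sqr_cube.
by apply: sumr_ge0 => i _; rewrite invr_ge0 addr_ge0 ?sqr_ge0.
Qed.

(** One factor wt^2 per coordinate: each of the [d] factors dominates 1 + (gamma^k)^2. *)
Lemma wt_prodw : exists2 C, 0 < C & forall z, (wt z ^+ (2 * d))^-1 <= C * prodw z.
Proof.
pose c k := 1 + (a k / pi) ^+ 2.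
have c0 k : 0 < c k by rewrite ltr_wpDr ?sqr_ge0.
exists (\prod_k c k); first by apply: prodr_gt0 => k _; exact: c0.
move=> z; rewrite exprM -exprVn.
have -> : ((wt z ^+ 2)^-1) ^+ d = \prod_(k < d) (wt z ^+ 2)^-1.
  by rewrite prodr_const card_ord.
rewrite /prodw -big_split/=; apply: ler_prod => k _.
have w0 : 0 < wt z ^+ 2 by rewrite exprn_gt0// wt_gt0.
rewrite invr_ge0 (ltW w0)/=.
have D0 : 0 < 1 + (z 0 k)%:~R ^+ 2 :> R by rewrite ltr_wpDr ?sqr_ge0.
rewrite ler_pdivlMr// [leLHS]mulrC ler_pdivrMr//.
have zE : (z 0 k)%:~R = hl z 0 k * (a k / pi).
  by rewrite mxE mulrA divfK ?(gt_eqF (a0 k))// mulfK// gt_eqF// pi_gt0.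
have h1 : 1 + hl z 0 k ^+ 2 <= wt z ^+ 2.
  rewrite /wt sqrrD expr1n mul1r; have := coord_sqr_le (hl z) k.
  by have := enorm_ge0 (hl z); rewrite mulr2n; lra.
rewrite zE exprMn /c.
have := sqr_ge0 (hl z 0 k); have := sqr_ge0 (a k / pi); nra.
Qed.

Lemma sums_le_wt : exists M, sums_le (fun z => (wt z ^+ (2 * d))^-1) M.
Proof.
have [C C0 h] := wt_prodw; exists (`|C| * 6 ^+ d).
apply: le_sums_le (sums_leZ C sum_prodw) => z.
rewrite [leRHS]ger0_norm ?mulr_ge0 ?prodw_ge0 ?(ltW C0)//.
by rewrite ger0_norm// invr_ge0 exprn_ge0// ltW// wt_gt0.
Qed.

(** Write the term as u v with u = wt^(t+d) |q_z| and v = wt^-d. Both are square summable, u by the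
    smoothness and v by [sums_le_wt], and u v <= (u^2 + v^2) / 2. The [d] extra derivatives are the
    price of passing from square summability to summability. *)
Lemma smooth_coefs_moment l q t : (t + d)%:R <= l -> smooth_coefs a l q ->
  exists M, sums_le (fun z => wt z ^+ t * coef a q (hl z)) M.
Proof.
move=> tl; rewrite /smooth_coefs => qfin.
have [S0 hS] : exists S0 : R, forall s, uniq s ->
    \sum_(z <- s) `|coef a q (hl z)| ^+ 2 * (1 + enorm (hl z) `^ (2 * l)) <= S0.
  exists (fine (\esum_(n in [set: 'rV[int]_d])
    (`|coef a q (hl n)| ^+ 2 * (1 + enorm (hl n) `^ (2 * l)))%:E)) => s us.
  rewrite -lee_fin fineK; last first.
    rewrite ge0_fin_numE// esum_ge0// => z _.
    by rewrite lee_fin mulr_ge0 ?sqr_ge0// addr_ge0 ?powR_ge0.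
  apply: esum_ge; exists [set` s].
    by split; [exact: finite_seq|].
  by rewrite -fsbig_seq// sumEFin.
have [M hM] := sums_le_wt.
exists (2^-1 * (4 ^+ (t + d) * S0) + 2^-1 * M) => s us.
apply: (@le_trans _ _ (\sum_(z <- s) (2^-1 * (4 ^+ (t + d) *
   (`|coef a q (hl z)| ^+ 2 * (1 + enorm (hl z) `^ (2 * l)))) +
   2^-1 * `|(wt z ^+ (2 * d))^-1|))); last first.
  rewrite big_split/= -!mulr_sumr lerD// ler_wpM2l ?invr_ge0// ?hM//.
  by rewrite ler_wpM2l ?hS.
apply: ler_sum => z _; rewrite normrM (ger0_norm (exprn_ge0 _ (ltW (wt_gt0 z)))).
rewrite [X in _ + _ * X]ger0_norm ?invr_ge0 ?exprn_ge0 ?(ltW (wt_gt0 z))//.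
have pw : wt z ^+ (2 * (t + d)) <= 4 ^+ (t + d) * (1 + enorm (hl z) `^ (2 * l)).
  have e0 := enorm_ge0 (hl z).
  have [e1|e1] := leP (enorm (hl z)) 1.
    apply: (@le_trans _ _ (4 ^+ (t + d))); last first.
      by rewrite ler_peMr ?exprn_ge0// lerDl powR_ge0.
    rewrite exprM lerXn2r ?nnegrE ?sqr_ge0// /wt.
    by move: e0 e1; move: (enorm (hl z)) => e e0 e1; nra.
  apply: (@le_trans _ _ (4 ^+ (t + d) * enorm (hl z) ^+ (2 * (t + d)))).
    rewrite exprM [enorm _ ^+ _]exprM -exprMn lerXn2r ?nnegrE ?sqr_ge0 ?mulr_ge0 ?sqr_ge0// /wt.
    by move: e0 e1; move: (enorm (hl z)) => e e0 e1; nra.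
  rewrite ler_wpM2l ?exprn_ge0//.
  apply: (@le_trans _ _ (enorm (hl z) `^ (2 * l))); last by rewrite lerDr.
  rewrite -powR_mulrn//; apply: ler_powR; first exact: ltW.
  by rewrite natrM ler_wpM2l.
have w0 := wt_gt0 z.
have wd0 : 0 < wt z ^+ d by rewrite exprn_gt0.
set u := wt z ^+ (t + d) * `|coef a q (hl z)|; set v := (wt z ^+ d)^-1.
have -> : wt z ^+ t * `|coef a q (hl z)| = u * v.
  by rewrite /u /v exprD (mulrAC (wt z ^+ t)) mulfK// gt_eqF.
have -> : (wt z ^+ (2 * d))^-1 = v ^+ 2 by rewrite /v exprVn -exprM mulnC.
apply: (@le_trans _ _ (2^-1 * u ^+ 2 + 2^-1 * v ^+ 2)).
  by have := sqr_ge0 (u - v); nra.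
rewrite lerD2r ler_wpM2l ?invr_ge0// /u exprMn -exprM mulnC.
by rewrite mulrC mulrCA ler_wpM2l ?sqr_ge0.
Qed.

End weights.

Section pairs.
Variables (R : realType) (m : nat).

Lemma sums_le_pair (T : choiceType) (c : T -> 'I_m -> R) (M : 'I_m -> R) :
  (forall j, sums_le (c^~ j) (M j)) ->
  sums_le (fun x : T * 'I_m => c x.1 x.2) (\sum_j M j).
Proof.
move=> cM s us.
have -> : \sum_(x <- s) `|c x.1 x.2| =
    \sum_j \sum_(z <- [seq x.1 | x <- s & x.2 == j]) `|c z j|.
  rewrite (partition_big (fun x : T * 'I_m => x.2) xpredT)//=; apply: eq_bigr => j _.
  by rewrite big_map big_filter; apply: eq_bigr => x /eqP <-.
apply: ler_sum => j _; apply: cM; rewrite map_inj_in_uniq ?filter_uniq//.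
move=> [z j1] [w j2]; rewrite !mem_filter/= => /andP[/eqP -> _] /andP[/eqP -> _] ->.
by [].
Qed.

Definition pcube n N : seq ('rV[int]_n * 'I_m) :=
  [seq (z, j) | z <- cube n N, j <- enum 'I_m].

Lemma pcube_uniq n N : uniq (pcube n N).
Proof.
apply: allpairs_uniq; [exact: cube_uniq|exact: enum_uniq|].
by move=> [z1 j1] [z2 j2] _ _ /= [-> ->].
Qed.

Lemma mem_pcube n N (x : 'rV[int]_n * 'I_m) : (x \in pcube n N) = (x.1 \in cube n N).
Proof.
case: x => z j; apply/allpairsP/idP => [[[w i] /= [wN _ [-> _]]]//|zN].
by exists (z, j); split => //=; rewrite mem_enum.
Qed.

Lemma near_mem_pcube n (x : 'rV[int]_n * 'I_m) : \forall N \near \oo, x \in pcube n N.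
Proof. by apply: filterS (near_mem_cube x.1) => N; rewrite mem_pcube. Qed.

Lemma usum_pair n (c : 'rV[int]_n -> 'I_m -> R) (M : 'I_m -> R) :
  (forall j, sums_le (c^~ j) (M j)) ->
  usum (fun x : 'rV[int]_n * 'I_m => c x.1 x.2) = \sum_j usum (c^~ j).
Proof.
move=> cM; apply: (cvg_unique (@Rhausdorff R)
  (cvg_usum (sums_le_pair cM) (@pcube_uniq n) (@near_mem_pcube n))).
apply: (@eq_seq_cvg _ (fun N => \sum_j \sum_(z <- cube n N) c z j)) => [N|].
  by rewrite big_allpairs exchange_big/= big_enum.
apply: cvg_big => [|j _]; first exact: add_continuous.
exact: cvg_cube (cM j).
Qed.

Lemma usumZ (T : choiceType) (c : T -> R) M (b : R) : sums_le c M ->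
  usum (fun x => b * c x) = b * usum c.
Proof.
move=> cM; apply: (usum_unique (sums_leZ b cM)) => e e0.
have b0 : 0 < `|b| + 1 by rewrite ltr_wpDl.
have [s us h] := usum_approx cM (divr_gt0 e0 b0).
exists s => // t ut st; rewrite -mulr_sumr -mulrBr normrM.
apply: le_trans (ler_wpM2l (normr_ge0 _) (h t ut st)) _.
by rewrite mulrCA ler_piMr ?(ltW e0)// ler_pdivrMr// mul1r lerDl.
Qed.

End pairs.

(** * The matrix of L(V) and the decay of its eigenvectors *)

Section kernel.
Variables (R : realType) (d m : nat) (a : 'I_d -> R).
Hypothesis a0 : forall k, 0 < a k.
Local Notation hl := (half_lattice_vec a).
Local Notation T := ('rV[int]_d * 'I_m)%type.
Variables (v : 'I_m -> 'I_m -> 'rV[int]_d -> R) (t0 : nat) (B : R).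
Hypothesis v_sym : forall i j z, v i j z = v j i z.
Hypothesis v_even : forall i j s z, v i j (flip s z) = v i j z.
Hypothesis v_moment : forall i, sums_le (fun x : T => wt a x.1 ^+ t0 * v i x.2 x.1) B.

Definition conv_kernel (x y : T) : R := v x.2 y.2 (x.1 - y.1).
Definition lap_symbol (x : T) : R := enorm (hl x.1) ^+ 2.
Definition pflip (s : {ffun 'I_d -> bool}) (x : T) : T := (flip s x.1, x.2).

Lemma v_neg i j z : v i j (- z) = v i j z.
Proof. by rewrite -flipN v_even. Qed.

Lemma conv_kernel_sym x y : conv_kernel x y = conv_kernel y x.
Proof. by rewrite /conv_kernel v_sym -v_neg opprB. Qed.

Lemma pflipK s : involutive (pflip s).
Proof. by move=> [z j]; rewrite /pflip/= flipK. Qed.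

Lemma pflip_kernel s x y : conv_kernel (pflip s x) (pflip s y) = conv_kernel x y.
Proof. by rewrite /conv_kernel/= -flipB v_even. Qed.

Lemma pflip_symbol s x : lap_symbol (pflip s x) = lap_symbol x.
Proof. by rewrite /lap_symbol/= half_lattice_vec_flip enorm_flip. Qed.

Lemma wtX_ge1 z t : 1 <= wt a z ^+ t.
Proof. by rewrite exprn_ege1// wt_ge1. Qed.

Lemma wtX_ge0 z t : 0 <= wt a z ^+ t.
Proof. exact: le_trans ler01 (wtX_ge1 z t). Qed.

Lemma conv_kernel_moment x : sums_le (fun y => wt a (x.1 - y.1) ^+ t0 * conv_kernel x y) B.
Proof.
move=> s us; pose f (y : T) : T := (x.1 - y.1, y.2).
have fI : injective f by move=> [z j] [w k] [] /= /subrI -> ->.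
exact: (sums_le_inj fI (v_moment x.2) us).
Qed.

Lemma conv_kernel_le x : sums_le (conv_kernel x) B.
Proof.
apply: le_sums_le (conv_kernel_moment x) => y; rewrite normrM.
by rewrite -[leLHS]mul1r ler_wpM2r// ger0_norm ?wtX_ge1// (le_trans ler01)// wtX_ge1.
Qed.

Lemma lap_symbol_fin r : exists2 t, uniq t & forall x, lap_symbol x <= r -> x \in t.
Proof.
have [N hN] : exists N : nat, forall k, Num.sqrt `|r| * (a k / pi) < N%:R.
  pose f k := (Num.truncn (Num.sqrt `|r| * (a k / pi))).+1.
  exists (\max_k f k) => k.
  have h : Num.sqrt `|r| * (a k / pi) < (f k)%:R.
    by apply: truncnS_gt; rewrite mulr_ge0 ?sqrtr_ge0// divr_ge0 ?pi_ge0 ?ltW.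
  by apply: lt_le_trans h _; rewrite ler_nat leq_bigmax.
exists (pcube m d N); first exact: pcube_uniq.
move=> x xr; rewrite mem_pcube mem_cube; apply/forallP => k.
have : hl x.1 0 k ^+ 2 <= r by apply: le_trans (coord_sqr_le _ _) xr.
move=> hr.
have : `|hl x.1 0 k| <= Num.sqrt `|r|.
  rewrite -sqrtr_sqr ler_wsqrtr//; apply: le_trans hr (ler_norm _).
rewrite mxE normrM normrM normfV (gtr0_norm (a0 k)) (gtr0_norm (pi_gt0 R)).
rewrite ler_pdivrMr// -ler_pdivlMr ?pi_gt0// -mulrA => h.
have := le_lt_trans h (hN k).
by rewrite -intr_norm (_ : N%:R = (N%:Z)%:~R)// ltr_int => /ltW.
Qed.

Section decay.
Variables (y : T -> R) (Lambda : R).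
Hypothesis y1 : forall x, `|y x| <= 1.
Hypothesis yeq : forall x, lap_symbol x * y x + usum (fun b => conv_kernel x b * y b) = Lambda * y x.

(** A bootstrap: by the equation |gamma|^2 |y| is at most |Lambda| |y| + |W y|, and convolution with
    coefficients having moments of order t0 preserves decay up to that order because [wt] is
    submultiplicative. Each round gains two powers, the last one starting at most at order t0. *)
Lemma eigenvector_decay k : (2 * k <= t0.+2)%N ->
  exists C, forall x, wt a x.1 ^+ (2 * k) * `|y x| <= C.
Proof.
elim: k => [|k IH] kt; first by exists 1 => x; rewrite mul1r.
have kt0 : (2 * k <= t0)%N by lia.
have [C hC] := IH (leq_trans kt0 (leqW (leqnSn _))).
pose t := (2 * k)%N.
exists (2 * (1 + `|Lambda|) * C + 2 * (B * C)) => x.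
have C0 : 0 <= C by apply: le_trans (hC x); rewrite mulr_ge0// (le_trans ler01)// wtX_ge1.
have w0 : 0 < wt a x.1 ^+ t := lt_le_trans ltr01 (wtX_ge1 x.1 t).
have us : wt a x.1 ^+ t * `|usum (fun b => conv_kernel x b * y b)| <= B * C.
  rewrite mulrC -ler_pdivlMr//; apply: usum_le => s us.
  rewrite ler_pdivlMr// mulrC mulr_sumr.
  apply: le_trans (_ : \sum_(b <- s) `|wt a (x.1 - b.1) ^+ t0 * conv_kernel x b| * C <= _); last first.
    by rewrite -mulr_suml ler_wpM2r// conv_kernel_moment.
  apply: ler_sum => b _; rewrite !normrM mulrA (ger0_norm (ltW (lt_le_trans ltr01 (wtX_ge1 _ t0)))).
  apply: (@le_trans _ _ ((wt a (x.1 - b.1) ^+ t * wt a b.1 ^+ t) * `|conv_kernel x b| * `|y b|)).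
    rewrite ler_wpM2r// ler_wpM2r// -exprMn lerXn2r ?nnegrE ?mulr_ge0 ?(ltW (wt_gt0 _ _))//.
    by have := wtM a (x.1 - b.1) b.1; rewrite subrK.
  rewrite (_ : _ * _ * _ * _ = (wt a (x.1 - b.1) ^+ t * `|conv_kernel x b|) *
    (wt a b.1 ^+ t * `|y b|)); last by ring.
  apply: ler_pM => //.
  - by rewrite mulr_ge0 ?wtX_ge0.
  - by rewrite mulr_ge0 ?wtX_ge0.
  by rewrite ler_wpM2r// ler_weXn2l// wt_ge1.
have e : `|lap_symbol x * y x| <= `|Lambda| * `|y x| + `|usum (fun b => conv_kernel x b * y b)|.
  have -> : lap_symbol x * y x = Lambda * y x - usum (fun b => conv_kernel x b * y b).
    by rewrite -yeq addrK.
  by apply: le_trans (ler_normB _ _) _; rewrite normrM.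
rewrite mulnS addnC exprD -/t.
have wsq : wt a x.1 ^+ 2 <= 2 * (1 + lap_symbol x).
  by rewrite /wt /lap_symbol; have := sqr_ge0 (enorm (hl x.1) - 1); nra.
have s0 : 0 <= lap_symbol x by exact: sqr_ge0.
move: e; rewrite normrM (ger0_norm s0) => e.
have h1 := hC x; rewrite -/t in h1.
have h2 : wt a x.1 ^+ t * (lap_symbol x * `|y x|) <=
    `|Lambda| * (wt a x.1 ^+ t * `|y x|) + wt a x.1 ^+ t * `|usum (fun b => conv_kernel x b * y b)|.
  by apply: le_trans (ler_wpM2l (ltW w0) e) _; rewrite mulrDr mulrCA.
have h3 : wt a x.1 ^+ t * wt a x.1 ^+ 2 * `|y x| <=
   2 * (wt a x.1 ^+ t * `|y x| + wt a x.1 ^+ t * (lap_symbol x * `|y x|)).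
  have := ler_wpM2l (mulr_ge0 (ltW w0) (normr_ge0 (y x))) wsq.
  by move: (wt a x.1 ^+ t) (wt a x.1 ^+ 2) => W1 W2; lra.
have h4 : `|Lambda| * (wt a x.1 ^+ t * `|y x|) <= `|Lambda| * C by exact: ler_wpM2l.
lra.
Qed.

End decay.
End kernel.

(** * From eigenvectors of the matrix to eigenfunctions of L(V) *)

Section eigenfunction.
Variables (R : realType) (d m : nat) (a : 'I_d -> R).
Hypothesis a0 : forall k, 0 < a k.
Local Notation mu := (rV_lebesgue R d).
Local Notation F := (box a).
Local Notation hl := (half_lattice_vec a).
Local Notation T := ('rV[int]_d * 'I_m)%type.

Let mF : measurable F. Proof. exact: measurable_box. Qed.

Lemma box_volume_gt0 : 0 < fine (mu F).
Proof.
rewrite rV_lebesgue_box => [|k]; last exact: ltW.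
by rewrite /= prodr_gt0.
Qed.

Lemma L2_dot_coef q z : L2_dot a q (ufun (hl z)) = coef a q (hl z) * fine (mu F).
Proof. by rewrite /coef divfK// gt_eqF// box_volume_gt0. Qed.

Lemma coef_flip q s z : coef a q (hl (flip s z)) = coef a q (hl z).
Proof.
rewrite /coef; congr (_ / _); apply: eq_Rintegral => x _.
by rewrite half_lattice_vec_flip ufun_flip.
Qed.

Lemma ae_eq0_coef (f : 'rV[R]_d -> R) z : {ae mu, forall x, F x -> f x = 0} ->
  measurable_fun F f -> L2_dot a f (ufun (hl z)) = 0.
Proof.
move=> f0 mf; rewrite /L2_dot /Rintegral.
have mfu : measurable_fun F (EFin \o (fun x => f x * ufun (hl z) x)).
  apply/measurable_EFinP; apply: measurable_funM => //.
  exact: measurable_ufun.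
have m0 : measurable_fun F (fun=> 0 : \bar R)%E by exact: measurable_cst.
rewrite (ae_eq_integral _ _ mF mfu m0); first by rewrite integral0.
by apply: filterS f0 => x fx Fx; rewrite /= fx// mul0r.
Qed.

Variable V : 'rV[R]_d -> 'M[R]_m.
Hypothesis VL2 : forall i k, L2 a (fun x => V x i k).

Definition vcoef (i k : 'I_m) (z : 'rV[int]_d) : R := coef a (fun x => V x i k) (hl z).

Variables (Lambda : R) (y : T -> R) (M Mv : R).
Hypothesis y_even : forall s x, y (pflip s x) = y x.
Hypothesis yM : forall i, sums_le (fun z => (1 + enorm (hl z) ^+ 2) * y (z, i)) M.
Hypothesis vM : forall i k, sums_le (vcoef i k) Mv.
Hypothesis yeq : forall x,
  lap_symbol a x * y x + usum (fun b => conv_kernel vcoef x b * y b) = Lambda * y x.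
Hypothesis y_neq0 : exists x, y x != 0.

Let c i z := y (z, i).

Let c_even i s z : c i (flip s z) = c i z.
Proof. exact: (y_even s (z, i)). Qed.

Let cM i : sums_le (c i) M.
Proof.
apply: le_sums_le (yM i) => z; rewrite normrM -[leLHS]mul1r ler_wpM2r//.
by rewrite ger0_norm ?lerDl ?addr_ge0// sqr_ge0.
Qed.

Let h i z := - enorm (hl z) ^+ 2 * c i z.

Let hM i : sums_le (h i) M.
Proof.
apply: le_sums_le (yM i) => z; rewrite !normrM ler_wpM2r// normrN.
by rewrite !ger0_norm ?lerDr ?addr_ge0// sqr_ge0.
Qed.

Let h_even i s z : h i (flip s z) = h i z.
Proof. by rewrite /h c_even half_lattice_vec_flip enorm_flip. Qed.

Let ivp i j : mu.-integrable F (EFin \o (fun x => V x i j * cos_series a (c j) x)).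
Proof.
apply: integrable_boundedM.
- exact: (L2_integrable a0 (VL2 i j)).
- exact: (cos_series_measurable (@cM j)).
- exact: (cos_series_bounded a (@cM j)).
Qed.

Let product_coef i z :
  \sum_j L2_dot a (fun x => V x i j * cos_series a (c j) x) (ufun (hl z)) =
  fine (mu F) * usum (fun b => conv_kernel vcoef (z, i) b * y b).
Proof.
have vb k j : `|vcoef i j (z - k)| <= Mv by exact: sums_le_term.
have S j : sums_le (fun k => vcoef i j (z - k) * c j k) (`|Mv| * M).
  by apply: sums_leM_bounded => // k; exact: vb.
have -> : usum (fun b => conv_kernel vcoef (z, i) b * y b) =
    \sum_j usum (fun k => vcoef i j (z - k) * c j k).
  rewrite -(usum_pair S); congr usum; apply/funext => -[k j].
  by rewrite /conv_kernel.
rewrite mulr_sumr; apply: eq_bigr => j _; rewrite -(usumZ _ (S j)).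
transitivity (L2_dot a (cos_series a (c j)) (fun x => V x i j * ufun (hl z) x)).
  by apply: eq_Rintegral => x _; ring.
rewrite (cos_series_mul_coef (@cM j) (@c_even j))//; last exact: (L2_integrable a0 (VL2 i j)).
by congr usum; apply/funext => k; rewrite L2_dot_coef -/(vcoef i j _); ring.
Qed.

(** The entries of [V] are only known as L2 functions, so V Phi is not summed as a series: the
    difference of the two sides of the eigenvalue equation is integrable, all its cosine
    coefficients vanish by [yeq], and completeness makes it 0 almost everywhere. Conversely the
    coefficients of [Phi] are [y], so [Phi] is not 0. *)
Theorem cosine_eigenfunction : schrodinger_eigenvalue a 1 V Lambda.
Proof.
pose Phi x : 'cV[R]_m := \col_i cos_series a (c i) x.
pose H x : 'cV[R]_m := \col_i cos_series a (h i) x.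
have PhiE i : (fun x => Phi x i 0) = cos_series a (c i).
  by apply/funext => x; rewrite mxE.
have HE i : (fun x => H x i 0) = cos_series a (h i).
  by apply/funext => x; rewrite mxE.
have PhiL2 i : L2 a (cos_series a (c i)) := cos_series_L2 a0 (@cM i).
exists Phi; split.
  move=> Phi0; have [[z i] /eqP yz] := y_neq0; apply: yz.
  have f0 : {ae mu, forall x, F x -> cos_series a (c i) x = 0}.
    by apply: filterS Phi0 => x Px Fx; rewrite -PhiE Px// mxE.
  have := ae_eq0_coef z f0 (cos_series_measurable (@cM i)).
  rewrite (cos_series_coef a0 (@cM i) (@c_even i)) => /eqP.
  by rewrite mulf_eq0 (gt_eqF box_volume_gt0) orbF => /eqP.
split=> [i|].
  have -> : (fun x => (Lambda *: Phi x) i 0) = (fun x => Lambda * cos_series a (c i) x).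
    by apply/funext => x; rewrite !mxE.
  apply: (L2_bounded a0).
    by apply: measurable_funM; [exact: measurable_cst|exact: (cos_series_measurable (@cM i))].
  by apply: bounded_onM; [exact: bounded_on_cst|exact: (cos_series_bounded a (@cM i))].
exists H; split=> [i|].
  by rewrite PhiE HE; exact: neumann_cos_series (yM i).
have g0 i : {ae mu, forall x, F x -> Lambda * cos_series a (c i) x + cos_series a (h i) x
    - \sum_j V x i j * cos_series a (c j) x = 0}.
  have i1 : mu.-integrable F (EFin \o (fun x => Lambda * cos_series a (c i) x)).
    apply: (eq_integrable mF) (integrableZl mF Lambda (L2_integrable a0 (PhiL2 i))) => //.
  have i2 := L2_integrable a0 (cos_series_L2 a0 (@hM i)).
  have i3 : mu.-integrable F (EFin \o (fun x => \sum_j V x i j * cos_series a (c j) x)).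
    have := integrable_sum mF (index_enum _) (P := xpredT) (fun j _ => ivp i j).
    by apply: eq_integrable => // x _ /=; rewrite sumEFin.
  have i12 := integrableD mF i1 i2.
  apply: cosines_complete => //.
    by have := integrableB mF i12 i3; apply: eq_integrable.
  move=> z; have bu := bounded_on_ufun a (hl z); have mu_ := @measurable_ufun R d F (hl z).
  have E x : (Lambda * cos_series a (c i) x + cos_series a (h i) x -
      \sum_j V x i j * cos_series a (c j) x) * ufun (hl z) x =
      (Lambda * (cos_series a (c i) x * ufun (hl z) x) + cos_series a (h i) x * ufun (hl z) x) -
      \sum_j V x i j * cos_series a (c j) x * ufun (hl z) x.
    by rewrite mulrBl mulrDl -mulrA mulr_suml.
  under eq_Rintegral do rewrite E.
  have j1 := integrable_boundedM (L2_integrable a0 (PhiL2 i)) mu_ bu.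
  have j2 := integrable_boundedM i2 mu_ bu.
  have j3 j := integrable_boundedM (ivp i j) mu_ bu.
  have k1 : mu.-integrable F (EFin \o (fun x => Lambda * (cos_series a (c i) x * ufun (hl z) x))).
    by apply: (eq_integrable mF) (integrableZl mF Lambda j1).
  rewrite RintegralB//; last 2 first.
  - by have := integrableD mF k1 j2; apply: eq_integrable.
  - have := integrable_sum mF (index_enum _) (P := xpredT) (fun j _ => j3 j).
    by apply: eq_integrable => // x _ /=; rewrite sumEFin.
  rewrite RintegralD// RintegralZl// Rintegral_sum//.
  have /= := product_coef i z; rewrite /L2_dot => ->.
  have := cos_series_coef a0 (@cM i) (@c_even i) z; rewrite /L2_dot => ->.
  have := cos_series_coef a0 (@hM i) (@h_even i) z; rewrite /L2_dot => ->.
  have := yeq (z, i); rewrite /lap_symbol/= -/(c i z) /h.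
  by set S := usum _; set e := enorm _ ^+ 2; move=> E1; rewrite mulrA -E1; ring.
have g1 : {ae mu, forall x, forall i, F x -> Lambda * cos_series a (c i) x +
    cos_series a (h i) x - \sum_j V x i j * cos_series a (c j) x = 0}.
  exact: (@filter_forall _ _ _ (almost_everywhere mu) _ g0).
apply: filterS g1 => x gx Fx.
apply/colP => i; have E := gx i Fx.
have VPhi : (V x *m Phi x) i 0 = \sum_j V x i j * cos_series a (c j) x.
  by rewrite mxE; apply: eq_bigr => j _; rewrite mxE.
rewrite [RHS]mxE VPhi !mxE mulN1r; lra.
Qed.

End eigenfunction.

(** * The operator T(P(s)) in the basis of cosines *)

Section int_sums.
Variable R : realType.

Lemma sum_cube1 N (c : int -> R) :
  \sum_(z <- cube 1 N) c (z 0 0) = \sum_(t < N.*2.+1) c (t%:Z - N%:Z).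
Proof.
pose f (t : 'I_(N.*2.+1)) : 'rV[int]_1 := const_mx (t%:Z - N%:Z).
transitivity (\sum_(z <- [seq f t | t : 'I_(N.*2.+1)]) c (z 0 0)).
  apply: perm_big; apply: uniq_perm; first exact: cube_uniq.
    rewrite map_inj_uniq ?enum_uniq// => t1 t2 /rowP/(_ 0); rewrite !mxE.
    by move=> /addIr[]/val_inj.
  move=> z; apply/idP/mapP => [|[t _ ->]].
    rewrite /cube => /mapP[g _ ->]; exists (g 0); first by rewrite mem_enum.
    by apply/rowP => k; rewrite !mxE (ord1 k).
  rewrite mem_cube; apply/forallP => k; rewrite mxE ler_norml.
  by have tN := ltn_ord t; apply/andP; split; move: tN; move: (t : nat) => w; lia.
by rewrite big_map big_enum/=; apply: eq_bigr => t _; rewrite mxE.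
Qed.

Lemma int_sum_usum (c : int -> R) M : sums_le (fun z : 'rV[int]_1 => c (z 0 0)) M ->
  int_sum c = usum (fun z : 'rV[int]_1 => c (z 0 0)).
Proof.
move=> cM; apply: cvg_lim => //.
by apply: eq_seq_cvg (cvg_cube cM) => N; rewrite sum_cube1.
Qed.

End int_sums.

Section one_dimensional.
Variables (R : realType) (d m : nat) (a : 'I_d -> R).
Hypothesis a0 : forall k, 0 < a k.
Variables (V : 'rV[R]_d -> 'M[R]_m) (i0 : 'I_d).

Local Notation pi1 := (fun _ : 'I_1 => pi : R).
Local Notation hl1 := (half_lattice_vec pi1).
Local Notation mu1 := (rV_lebesgue R 1).

Definition line (k : int) : 'rV[int]_d := k *: delta_mx 0 i0.

Lemma half_lattice_vec_line k : half_lattice_vec a (line k) = k%:~R *: evec a i0.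
Proof.
apply/rowP => j; rewrite !mxE; have [->|ji] := eqVneq j i0; rewrite !eqxx/=.
  by rewrite !mulr1 -mulrA.
by rewrite !mulr0 mulr0z !mul0r.
Qed.

Lemma half_lattice_vec_pi z : hl1 z 0 0 = (z 0 0)%:~R.
Proof. by rewrite mxE mulfK// gt_eqF// pi_gt0. Qed.

Definition pcoef i j (z : 'rV[int]_1) := vcoef a V i j (line (z 0 0)).

Variable Mp : R.
Hypothesis pM : forall i j, sums_le (pcoef i j) Mp.

(** Absolute summability identifies the limit of symmetric partial sums in [int_sum] with an
    unordered sum over one-dimensional frequencies. *)
Lemma Pmx_cos_series i j :
  (fun x : 'rV[R]_1 => Pmx a V (evec a i0) (x 0 0) i j) = cos_series pi1 (pcoef i j).
Proof.
apply/funext => x; rewrite mxE.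
have E z : pcoef i j z * ufun (hl1 z) x =
    coef a (fun x => V x i j) ((z 0 0)%:~R *: evec a i0) * cos ((z 0 0)%:~R * x 0 0).
  by rewrite /pcoef /vcoef half_lattice_vec_line /ufun big_ord1 half_lattice_vec_pi.
rewrite (int_sum_usum (M := Mp)).
  by congr usum; apply/funext => z; rewrite E.
apply: le_sums_le (pM i j) => z; rewrite -E normrM -[leRHS]mulr1.
by rewrite ler_wpM2l// ufun_le1.
Qed.

Lemma pcoef_flip i j s z : pcoef i j (flip s z) = pcoef i j z.
Proof.
rewrite /pcoef /vcoef mxE; case: (s 0); rewrite ?expr0 ?mul1r// expr1 mulN1r.
rewrite -(coef_flip _ _ [ffun => true]) flipN; congr coef; congr half_lattice_vec.
by rewrite /line scaleNr opprK.
Qed.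

Let p0 (k : 'I_1) : 0 < pi1 k. Proof. exact: pi_gt0. Qed.

Let mF : measurable (box pi1). Proof. exact: measurable_box. Qed.

(** The equation is tested against each cosine of [0, pi]: the second derivative gives the diagonal,
    multiplication by P the convolution. An eigenvector with all coefficients 0 would vanish by
    completeness. *)
Lemma T_eigenvalue_coefs lam : T_eigenvalue a V (evec a i0) lam ->
  exists y : 'rV[int]_1 * 'I_m -> R, [/\ forall s x, y (pflip s x) = y x,
    exists x, y x != 0, exists M, sums_le (fun x => y x ^+ 2) M &
    forall x : 'rV[int]_1 * 'I_m, (lam - enorm (evec a i0) ^+ 2 * (x.1 0 0)%:~R ^+ 2) * y x =
      usum (fun b => conv_kernel pcoef x b * y b)].
Proof.
move=> [phi [phi_n0 [_ [H [nH eH]]]]].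
set kap := enorm _ ^+ 2 in eH *.
pose f i (x : 'rV[R]_1) := phi x i 0.
have fL2 i : L2 pi1 (f i) by have [_ [G [[]]]] := nH i.
have hL2 i : L2 pi1 (fun x => H x i 0) by have [] := nH i.
have fI i := L2_integrable p0 (fL2 i).
have hI i := L2_integrable p0 (hL2 i).
pose y (x : 'rV[int]_1 * 'I_m) := L2_dot pi1 (f x.2) (ufun (hl1 x.1)).
pose Y := \sum_i \int[mu1]_(x in box pi1) `|f i x|.
have yY x : `|y x| <= Y.
  have Y0 i : 0 <= \int[mu1]_(x in box pi1) `|f i x| by exact: Rintegral_ge0.
  apply: (@le_trans _ _ (\int[mu1]_(u in box pi1) `|f x.2 u|)); last first.
    by rewrite /Y (bigD1 x.2)//= lerDl sumr_ge0.
  have iu : mu1.-integrable (box pi1) (EFin \o (fun u => f x.2 u * ufun (hl1 x.1) u)).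
    by apply: integrable_boundedM => //; [exact: measurable_ufun|exact: bounded_on_ufun].
  apply: le_trans (le_normr_Rintegral mF iu) _; apply: le_Rintegral => //.
  - exact: integrable_norm iu.
  - exact: integrable_norm (fI _).
  by move=> u _; rewrite /= normrM -[leRHS]mulr1 ler_wpM2l// ufun_le1.
have kM (x : 'rV[int]_1 * 'I_m) : sums_le (fun b => conv_kernel pcoef x b) (\sum_(j < m) Mp).
  pose g (b : 'rV[int]_1 * 'I_m) := (x.1 - b.1, b.2).
  have gI : injective g by move=> [z j] [w k] [] /= /subrI -> ->.
  by move=> s us; exact: (sums_le_inj gI (sums_le_pair (pM x.2)) us).
have kyM (x : 'rV[int]_1 * 'I_m) : sums_le (fun b => conv_kernel pcoef x b * y b) (`|Y| * \sum_(j < m) Mp).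
  by under eq_fun do rewrite mulrC; exact: sums_leM_bounded.
have yeq (x : 'rV[int]_1 * 'I_m) : (lam - kap * (x.1 0 0)%:~R ^+ 2) * y x =
    usum (fun b => conv_kernel pcoef x b * y b).
  case: x => k i; rewrite /y/=.
  have pb j : bounded_on pi1 (cos_series pi1 (pcoef i j)) by exact: cos_series_bounded (pM i j).
  have pm j : measurable_fun (box pi1) (cos_series pi1 (pcoef i j)) by exact: cos_series_measurable (pM i j).
  have fpI j : mu1.-integrable (box pi1) (EFin \o (fun x => f j x * cos_series pi1 (pcoef i j) x)).
    exact: integrable_boundedM.
  pose g x := lam * f i x + kap * H x i 0 - \sum_j f j x * cos_series pi1 (pcoef i j) x.
  have g0 : {ae mu1, forall x, box pi1 x -> g x = 0}.
    apply: filterS eH => x Ex Fx; have := Ex Fx => /(congr1 (fun M : 'cV[R]_m => M i 0)).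
    rewrite mxE [X in _ = X]mxE [X in _ = X + _]mxE => E.
    have S : \sum_j f j x * cos_series pi1 (pcoef i j) x =
        (Pmx a V (evec a i0) (x 0 0) *m phi x) i 0.
      by rewrite [RHS]mxE; apply: eq_bigr => j _; rewrite -Pmx_cos_series mulrC.
    by rewrite /g S /f E; ring.
  have mg : measurable_fun (box pi1) g.
    apply: measurable_funB.
      apply: measurable_funD; apply: measurable_funM; try exact: measurable_cst.
        by case: (fL2 i).
      by case: (hL2 i).
    by apply: measurable_sum => j; apply: measurable_funM; case: (fL2 j).
  have := ae_eq0_coef k g0 mg.
  have bu := bounded_on_ufun pi1 (hl1 k); have mu_ := @measurable_ufun R 1 (box pi1) (hl1 k).
  have j1 := integrable_boundedM (fI i) mu_ bu.
  have j2 := integrable_boundedM (hI i) mu_ bu.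
  have j3 j := integrable_boundedM (fpI j) mu_ bu.
  have k1 : mu1.-integrable (box pi1) (EFin \o (fun x => lam * (f i x * ufun (hl1 k) x))).
    by apply: (eq_integrable mF) (integrableZl mF lam j1).
  have k2 : mu1.-integrable (box pi1) (EFin \o (fun x => kap * (H x i 0 * ufun (hl1 k) x))).
    by apply: (eq_integrable mF) (integrableZl mF kap j2).
  have E x : g x * ufun (hl1 k) x = (lam * (f i x * ufun (hl1 k) x) +
      kap * (H x i 0 * ufun (hl1 k) x)) -
      \sum_j f j x * cos_series pi1 (pcoef i j) x * ufun (hl1 k) x.
    by rewrite mulrBl mulrDl -!mulrA mulr_suml.
  rewrite /L2_dot; under eq_Rintegral do rewrite E.
  rewrite RintegralB//; last 2 first.
  - by have := integrableD mF k1 k2; apply: eq_integrable.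
  - have := integrable_sum mF (index_enum _) (P := xpredT) (fun j _ => j3 j).
    by apply: eq_integrable => // x _ /=; rewrite sumEFin.
  rewrite RintegralD// !RintegralZl// Rintegral_sum//.
  have := neumann_laplacian_coef1 k p0 (nH i); rewrite /L2_dot => ->.
  have -> : enorm (hl1 k) ^+ 2 = (k 0 0)%:~R ^+ 2.
    by rewrite enorm_sqr /dot big_ord1 half_lattice_vec_pi expr2.
  have S j : sums_le (fun z => pcoef i j (k - z) * y (z, j)) (`|Y| * Mp).
    under eq_fun do rewrite mulrC; apply: sums_leM_bounded => // s us.
    pose h (z : 'rV[int]_1) := k - z.
    have hI' : injective h by move=> z w /subrI.
    exact: (sums_le_inj hI' (pM i j) us).
  have -> : usum (fun b => conv_kernel pcoef (k, i) b * L2_dot pi1 (f b.2) (ufun (hl1 b.1))) =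
      \sum_j \int[mu1]_(x in box pi1) (f j x * cos_series pi1 (pcoef i j) x * ufun (hl1 k) x).
    transitivity (\sum_j usum (fun z => pcoef i j (k - z) * y (z, j))).
      by rewrite -(usum_pair S).
    apply: eq_bigr => j _.
    transitivity (L2_dot pi1 (cos_series pi1 (pcoef i j)) (fun x => f j x * ufun (hl1 k) x)); last first.
      by apply: eq_Rintegral => x _; ring.
    rewrite (cos_series_mul_coef (pM i j) (pcoef_flip i j) k (fI j)).
    rewrite -(usum_bij (f := fun z => k - z) (g := fun z => k - z) _ _ (S j)).
    - by congr usum; apply/funext => z; rewrite subKr.
    - by move=> z; rewrite subKr.
    - by move=> z; rewrite subKr.
  by rewrite /L2_dot; set S1 := \sum_j _; set I1 := Rintegral _ _ _; lra.
exists y; split => //.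
- by move=> s [z j]; apply: eq_Rintegral => x _; rewrite /= half_lattice_vec_flip ufun_flip.
- apply: contrapT => /forallNP y0; apply: phi_n0.
  have fz i : {ae mu1, forall x, box pi1 x -> f i x = 0}.
    apply: cosines_complete => // z.
    by have /negP := y0 (z, i); rewrite negbK => /eqP.
  have fz1 : {ae mu1, forall x, forall i, box pi1 x -> f i x = 0}.
    exact: (@filter_forall _ _ _ (almost_everywhere mu1) _ fz).
  by apply: filterS fz1 => x fx Fx; apply/colP => i; rewrite [RHS]mxE; exact: fx.
have kap0 : 0 < kap.
  rewrite /kap enorm_sqr /dot (bigD1 i0)//= ltr_wpDr ?sumr_ge0//.
    by move=> j _; rewrite -expr2 sqr_ge0.
  by rewrite !mxE !eqxx mulr1 mulr_gt0// divr_gt0// pi_gt0.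
(* Square summability comes from the equation rather than from Bessel's inequality: y and W y are
   bounded, so n^2 y_n is bounded too. *)
pose K := `|Y| * \sum_(j < m) Mp.
pose C := Y + (K + `|lam| * Y) / kap.
have yC (x : 'rV[int]_1 * 'I_m) : (1 + (x.1 0 0)%:~R ^+ 2) * `|y x| <= C.
  have h1 : `|(lam - kap * (x.1 0 0)%:~R ^+ 2) * y x| <= K by rewrite yeq; exact: usum_le.
  have e0 : 0 <= (x.1 0 0)%:~R ^+ 2 :> R by exact: sqr_ge0.
  rewrite mulrDl mul1r lerD// ler_pdivlMr//.
  move: h1 e0 (yY x); rewrite normrM; move: (_ ^+ 2) => e h1 e0 yx.
  have h2 : kap * e - `|lam| <= `|lam - kap * e|.
    have := ler_norm (lam - (lam - kap * e)); have := ler_normB lam (lam - kap * e); lra.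
  have h3 : (kap * e - `|lam|) * `|y x| <= K by apply: le_trans h1; rewrite ler_wpM2r.
  have h4 : `|lam| * `|y x| <= `|lam| * Y by rewrite ler_wpM2l.
  lra.
exists (\sum_(j < m) C ^+ 2 * 6) => s us.
have H1 (j : 'I_m) : sums_le (fun z => y (z, j) ^+ 2) (`|C ^+ 2| * 6 ^+ 1).
  apply: le_sums_le (sums_leZ (C ^+ 2) (@sum_prodw R 1)) => z.
  rewrite big_ord1 ger0_norm ?sqr_ge0// ger0_norm; last first.
    by rewrite mulr_ge0 ?sqr_ge0// invr_ge0 addr_ge0 ?sqr_ge0.
  have := yC (z, j) => /=; have : 0 <= (z 0 0)%:~R ^+ 2 :> R by exact: sqr_ge0.
  rewrite -[y _ ^+ 2]real_normK ?num_real//; move: (_ ^+ 2) (normr_ge0 (y (z, j))).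
  move: `|y _| => u e u0 e0 h; rewrite ler_pdivlMr ?ltr_wpDr//.
  have uC : u <= C by apply: le_trans h; rewrite mulrDl mul1r lerDl mulr_ge0.
  have e1 : 0 <= 1 + e by rewrite addr_ge0.
  by rewrite !expr2 -mulrA [u * (1 + e)]mulrC; apply: ler_pM => //; exact: mulr_ge0.
have := sums_le_pair H1 us; by rewrite expr1 ger0_norm ?sqr_ge0.
Qed.

End one_dimensional.

(** * Eigenvalues of L(V) from approximate eigenvectors on cubes *)

Section spectrum.
Variables (R : realType) (d m : nat) (a : 'I_d -> R).
Hypothesis a0 : forall k, 0 < a k.
Variable V : 'rV[R]_d -> 'M[R]_m.
Hypothesis VL2 : forall i k, L2 a (fun x => V x i k).
Hypothesis Vsym : forall x, box a x -> (V x)^T = V x.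
Local Notation T := ('rV[int]_d * 'I_m)%type.
Local Notation v := (vcoef a V).
Local Notation W := (conv_kernel v).
Local Notation D := (lap_symbol a (m := m)).
Variables (t0 : nat) (B : R).
Hypothesis t0_ge : (2 * d <= t0)%N.
Hypothesis v_moment : forall i, sums_le (fun x : T => wt a x.1 ^+ t0 * v i x.2 x.1) B.

Lemma vcoef_sym i j z : v i j z = v j i z.
Proof.
rewrite /vcoef /coef; congr (_ / _); apply: eq_Rintegral => x /set_mem xF.
by congr (_ * _); rewrite -[in LHS](Vsym xF) mxE.
Qed.

Lemma vcoef_even i j s z : v i j (flip s z) = v i j z.
Proof. exact: coef_flip. Qed.

Lemma vcoef_le i j : sums_le (v i j) B.
Proof.
move=> s us; pose f (z : 'rV[int]_d) : T := (z, j).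
have fI : injective f by move=> z w [].
apply: le_trans (sums_le_inj fI (v_moment i) us); apply: ler_sum => z _ /=.
by rewrite [leRHS]normrM (ger0_norm (wtX_ge0 _ _ _)) ler_peMl ?wtX_ge1.
Qed.

Theorem eigenvalue_of_quasimodes lambda eps : 0 <= eps ->
  (\forall N \near \oo, exists x, [/\ act_invariant (@pflip d m) x,
     (forall z, z \notin pcube m d N -> x z = 0),
     0 < \sum_(z <- pcube m d N) x z ^+ 2 &
     \sum_(z <- pcube m d N)
       (D z * x z + \sum_(w <- pcube m d N) W z w * x w - lambda * x z) ^+ 2 <=
       eps ^+ 2 * \sum_(z <- pcube m d N) x z ^+ 2]) ->
  exists Lambda, schrodinger_eigenvalue a 1 V Lambda /\ `|Lambda - lambda| <= eps.
Proof.
move=> eps0 H.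
have WB z : sums_le (W z) B by exact: conv_kernel_le v_moment z.
have s_act N g z : (pflip g z \in pcube m d N) = (z \in pcube m d N).
  by rewrite !mem_pcube mem_cube_flip.
have [Lambda [y [Le yinv y1 yn0 yeq]]] := eigenvalue_near (@pflipK d m)
  (conv_kernel_sym vcoef_sym vcoef_even) (pflip_kernel vcoef_even)
  (@pflip_symbol R d m a) WB (@lap_symbol_fin R d m a a0) (@pcube_uniq m d)
  s_act (@near_mem_pcube m d) eps0 H.
exists Lambda; split => //.
(* Of the 2 d + 2 powers of decay, two absorb the Laplacian and 2 d make the series summable; this
   is where 2 d <= t0 is used. *)
have [C hC] := eigenvector_decay v_moment y1 yeq (k := d.+1) ltac:(lia).
have [M hM] := @sums_le_wt R d a a0.
apply: (@cosine_eigenfunction R d m a a0 V VL2 Lambda y (`|C| * M) B) => //.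
  move=> i; apply: le_sums_le (sums_leZ C hM) => z.
  have w0 : 0 < wt a z ^+ (2 * d) by rewrite exprn_gt0// wt_gt0.
  have C0 : 0 <= C by apply: le_trans (hC (z, i)); rewrite mulr_ge0 ?wtX_ge0.
  rewrite [leRHS]ger0_norm ?mulr_ge0// ?invr_ge0 ?(ltW w0)// ler_pdivlMr//.
  apply: le_trans (hC (z, i)); rewrite /= normrM mulnS exprD [leLHS]mulrAC.
  apply: ler_wpM2r => //; apply: ler_wpM2r; first exact: ltW.
  rewrite ger0_norm ?addr_ge0 ?sqr_ge0// /wt.
  by have := enorm_ge0 (half_lattice_vec a z); nra.
exact: vcoef_le.
Qed.

End spectrum.

(** * Nonresonance outside E_2 *)

Section nonresonance.
Variables (R : realType) (d : nat) (a : 'I_d -> R).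
Hypothesis a0 : forall k, 0 < a k.
Local Notation hl := (half_lattice_vec a).

Lemma seq_argmin (T : eqType) (f : T -> R) (s : seq T) x0 : x0 \in s ->
  exists2 x, x \in s & forall y, y \in s -> f x <= f y.
Proof.
elim: s x0 => // u [|w s] IH x0 _.
  by exists u; rewrite ?mem_head// => y; rewrite inE => /eqP ->.
have [x xs xm] := IH w (mem_head _ _).
have [ux|xu] := leP (f u) (f x).
  exists u; rewrite ?mem_head// => y; rewrite inE => /predU1P[->//|/xm]; exact: le_trans.
exists x; first by rewrite inE xs orbT.
by move=> y; rewrite inE => /predU1P[->|/xm //]; exact: ltW.
Qed.

Lemma dotDl n (x y z : 'rV[R]_n) : dot (x + y) z = dot x z + dot y z.
Proof. by rewrite -big_split; apply: eq_bigr => k _; rewrite !mxE mulrDl. Qed.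

Lemma dotC n (x y : 'rV[R]_n) : dot x y = dot y x.
Proof. by apply: eq_bigr => k _; rewrite mulrC. Qed.

Lemma dotZl n c (x y : 'rV[R]_n) : dot (c *: x) y = c * dot x y.
Proof. by rewrite mulr_sumr; apply: eq_bigr => k _; rewrite !mxE mulrA. Qed.

Lemma enormZ n c (x : 'rV[R]_n) : enorm (c *: x) = `|c| * enorm x.
Proof.
by rewrite /enorm dotZl dotC dotZl mulrA -expr2 sqrtrM ?sqr_ge0// sqrtr_sqr.
Qed.

Lemma enorm_sqrD n (x y : 'rV[R]_n) :
  enorm (x + y) ^+ 2 = enorm x ^+ 2 + 2 * dot x y + enorm y ^+ 2.
Proof. by rewrite !enorm_sqr dotDl ![dot _ (x + y)]dotC !dotDl (dotC y x); ring. Qed.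

Lemma half_lattice_vecZ (c : int) z : hl (c *: z) = c%:~R *: hl z.
Proof. by apply/rowP => k; rewrite !mxE intrM !mulrA. Qed.

Lemma half_lattice_vec_eq0 z : (hl z == 0) = (z == 0).
Proof.
apply/eqP/eqP => [/rowP h|->]; last by apply/rowP => k; rewrite !mxE !mul0r.
apply/rowP => k; move: (h k); rewrite !mxE => /eqP.
by rewrite !mulf_eq0 invr_eq0 (gt_eqF (a0 k)) (gt_eqF (pi_gt0 R)) !orbF intr_eq0 => /eqP.
Qed.

Lemma enorm_gt0 n (x : 'rV[R]_n) : x != 0 -> 0 < enorm x.
Proof.
move=> x0; rewrite sqrtr_gt0 lt_def sumr_ge0 ?andbT => [|k _]; last by rewrite -expr2 sqr_ge0.
apply: contra x0; rewrite psumr_eq0 => [/allP h|k _]; last by rewrite -expr2 sqr_ge0.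
by apply/eqP/rowP => k; have := h k (mem_index_enum k); rewrite mulf_eq0 orbb mxE => /eqP.
Qed.

(** Division with remainder: [b1] minus the integral multiple of [g] given by the floor is on the
    same line and shorter than [g], hence 0. A shortest [g] exists since finitely many half lattice
    vectors are not longer than [b1]. *)
Lemma shortest_on_line b1 : b1 != 0 -> exists g (n : int),
  [/\ g != 0, b1 = n *: g, n != 0 &
   forall z, z != 0 -> (exists t, hl z = t *: hl g) -> enorm (hl g) <= enorm (hl z)].
Proof.
move=> b10; have hb0 : hl b1 != 0 by rewrite half_lattice_vec_eq0.
have [s us hs] := @lap_symbol_fin R d 1 a a0 (enorm (hl b1) ^+ 2).
pose P z := (z != 0) && `[<exists t, hl z = t *: hl b1>].
pose L := [seq z <- map fst s | P z].
have inL z : P z -> enorm (hl z) <= enorm (hl b1) -> z \in L.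
  move=> Pz zb; rewrite mem_filter Pz; apply/mapP; exists (z, ord0) => //; apply: hs.
  by rewrite /lap_symbol/= ler_pXn2r ?nnegrE ?enorm_ge0.
have Pb : P b1 by rewrite /P b10; apply/asboolP; exists 1; rewrite scale1r.
have [g gL gmin] := seq_argmin (fun z => enorm (hl z)) (inL _ Pb (lexx _)).
move: (gL); rewrite mem_filter => /andP[/andP[g0 /asboolP[t gt]] _].
have min z : P z -> enorm (hl g) <= enorm (hl z).
  move=> Pz; have [|zb] := leP (enorm (hl z)) (enorm (hl b1)); first by move/(inL _ Pz)/gmin.
  by apply: le_trans (gmin _ (inL _ Pb (lexx _))) (ltW zb).
have t0 : t != 0.
  by apply: contraNneq g0 => t0; rewrite -half_lattice_vec_eq0 gt t0 scale0r.
have bt : hl b1 = t^-1 *: hl g by rewrite gt scalerA mulVf// scale1r.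
pose n := Num.floor t^-1.
have rE : hl (b1 - n *: g) = (t^-1 - n%:~R) *: hl g.
  by rewrite half_lattice_vecB half_lattice_vecZ bt scalerBl.
have bn : b1 = n *: g.
  apply/eqP; rewrite -subr_eq0; apply: contraT => r0; rewrite -(ltxx (enorm (hl g))).
  have : enorm (hl g) <= enorm (hl (b1 - n *: g)).
    apply: min; rewrite /P r0; apply/asboolP; exists ((t^-1 - n%:~R) * t).
    by rewrite rE gt scalerA.
  move=> h; apply: le_lt_trans h _; rewrite rE enormZ gtr_pMl ?enorm_gt0 ?half_lattice_vec_eq0//.
  have := floor_itv t^-1; rewrite -/n intrD => /andP[h1 h2].
  by rewrite ger0_norm ?subr_ge0// ltrBlDl.
exists g, n; split => //.
  by apply: contraNneq b10 => n0; rewrite bn n0 scale0r.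
move=> z z0 [u zu]; apply: min; rewrite /P z0; apply/asboolP; exists (u * t).
by rewrite zu gt scalerA.
Qed.

(** A nonzero vector of Gamma on this line is twice a half lattice vector with a nonzero integral
    i0-th index, so even half of it is as long as [evec a i0]. *)
Lemma minimal_on_line_evec i0 : minimal_on_line a (evec a i0).
Proof.
move=> v [_ [z _ <-] <-] [t zt] v0; rewrite enormZ.
have e k : 2 * ((z 0 k)%:~R * pi / a k) = t * (pi / a i0) * (k == i0)%:R.
  by move/rowP/(_ k): zt; rewrite !mxE/= mulrA.
have zi0 : z 0 i0 != 0.
  apply: contraNneq v0 => zi0; rewrite scaler_eq0 half_lattice_vec_eq0; apply/orP; right.
  have := e i0; rewrite zi0 !mul0r mulr0 eqxx mulr1 => /esym e0.
  apply/eqP/rowP => k; have := e k; rewrite e0 mul0r => /eqP.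
  rewrite !mulf_eq0 invr_eq0 (gt_eqF (a0 k)) (gt_eqF (pi_gt0 R)) !orbF pnatr_eq0 intr_eq0/=.
  by move=> /eqP ->; rewrite mxE.
have pa : 0 < pi / a i0 by rewrite divr_gt0 ?pi_gt0.
have edelta : enorm (delta_mx 0 i0 : 'rV[R]_d) = 1.
  rewrite /enorm /dot (bigD1 i0)//= big1 ?addr0 => [|k /negbTE ki]; rewrite !mxE eqxx/= ?eqxx ?ki ?mulr0//.
  by rewrite mulr1 sqrtr1.
rewrite {1}/evec enormZ edelta mulr1 !gtr0_norm//.
have : pi / a i0 <= enorm (hl z).
  apply: le_trans (_ : `|hl z 0 i0| <= _); last first.
    by rewrite -[leLHS]sqrtr_sqr ler_wsqrtr// -enorm_sqr coord_sqr_le.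
  rewrite mxE -mulrA normrM (gtr0_norm pa) ler_peMl ?(ltW pa)//.
  rewrite -intr_norm (_ : 1 = 1%:~R)// ler_int; lia.
have := enorm_ge0 (hl z); lra.
Qed.

Lemma nonresonance i0 (b b1 : 'rV[int]_d) (j : int) r T :
  b 0 i0 = 0 -> b1 0 i0 = 0 -> b1 != 0 ->
  enorm (hl b1) < r -> enorm (evec a i0) < r ->
  resonance (evec a i0) T (hl b + j%:~R *: evec a i0) ->
  ~ double_resonance a r T (hl b + j%:~R *: evec a i0) ->
  T - 2 * r ^+ 2 <= `|enorm (hl b + hl b1) ^+ 2 - enorm (hl b) ^+ 2|.
Proof.
set delta := evec a i0; set gamma := _ + _ *: _.
move=> bi0 b1i0 b10 b1r dr res ndres.
have [g [n [g0 bn n0 gmin]]] := shortest_on_line b10.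
have gi0 : g 0 i0 = 0.
  by move: b1i0; rewrite bn mxE => /eqP; rewrite mulf_eq0 (negbTE n0) => /eqP.
have hg0 : hl g != 0 by rewrite half_lattice_vec_eq0.
have dg : dot delta (hl g) = 0.
  by rewrite dotZl /dot big1 ?mulr0// => k _; rewrite !mxE/=; case: eqP => [->|]; rewrite ?gi0 ?mul0r ?mulr0.
have d0 : delta != 0.
  apply/eqP => /rowP/(_ i0); rewrite !mxE !eqxx mulr1 => /eqP.
  by rewrite mulf_eq0 invr_eq0 (gt_eqF (a0 i0)) (gt_eqF (pi_gt0 R)).
have nn : 1 <= `|n%:~R : R| by rewrite -intr_norm (_ : 1 = 1%:~R)// ler_int; lia.
have b1E : hl b1 = n%:~R *: hl g by rewrite bn half_lattice_vecZ.
have gb : enorm (hl g) <= enorm (hl b1) by rewrite b1E enormZ ler_peMl ?enorm_ge0.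
have ballg : lattice_ball a r (hl g).
  by split; [exists g|rewrite enorm_gt0//= (le_lt_trans gb)].
have balld : lattice_ball a r delta.
  split; last by rewrite enorm_gt0.
  exists (delta_mx 0 i0) => //; apply/rowP => k; rewrite !mxE eqxx/=.
  by case: eqP => [->|_]; rewrite ?mul1r ?mulr1 ?mul0r ?mulr0.
have ming : minimal_on_line a (hl g).
  move=> w [_ [z _ <-] <-] [t zt] w0.
  have zz : 2 *: hl z = hl (z + z) by rewrite half_lattice_vecD scaler_nat mulr2n.
  rewrite zz; apply: gmin; first by rewrite -half_lattice_vec_eq0 -zz.
  by exists t; rewrite -zz.
have gg : dot gamma (hl g) = dot (hl b) (hl g) by rewrite dotDl dotZl dg mulr0 addr0.
have nresg : T <= `|2 * dot (hl b) (hl g) + enorm (hl g) ^+ 2|.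
  rewrite leNgt; apply/negP => h; apply: ndres; exists delta, (hl g); split => //.
  - by split=> //; exact: minimal_on_line_evec.
  - rewrite free_cons seq1_free hg0 andbT span_seq1; apply/vlineP => -[k /rowP/(_ i0)].
    rewrite !mxE !eqxx mulr1 gi0 !mul0r mulr0 => /eqP.
    by rewrite mulf_eq0 invr_eq0 (gt_eqF (a0 i0)) (gt_eqF (pi_gt0 R)).
  split=> //; rewrite /resonance/= enorm_sqrD gg.
  move: h; rewrite -normrN; congr (`|_| < _); ring.
rewrite enorm_sqrD b1E (dotC (hl b)) dotZl (dotC _ (hl b)) enormZ exprMn real_normK ?num_real//.
have b1r2 : n%:~R ^+ 2 * enorm (hl g) ^+ 2 <= r ^+ 2.
  rewrite -[n%:~R ^+ 2]real_normK ?num_real// -exprMn -enormZ -b1E.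
  by rewrite ler_pXn2r ?nnegrE ?enorm_ge0 ?ltW// (le_lt_trans _ b1r) ?enorm_ge0.
(* [A] is the change of the square norm under the step g, the same from gamma as from b because
   delta is orthogonal to g. The step n g changes it by n A + (n^2 - n) |g|^2, whose second term is
   at most 2 |b1|^2 <= 2 r^2. *)
set A := 2 * dot _ _ + _ in nresg.
rewrite [X in `|X|](_ : _ = n%:~R * A + (n%:~R ^+ 2 - n%:~R) * enorm (hl g) ^+ 2); last first.
  rewrite /A; move: (enorm (hl b)) (enorm (hl g)) (dot (hl b) (hl g)) => e1 e2 e3. ring.
have h1 : T <= `|n%:~R * A|.
  by rewrite normrM; apply: le_trans nresg _; rewrite ler_peMl.
have h2 : `|(n%:~R ^+ 2 - n%:~R) * enorm (hl g) ^+ 2| <= 2 * r ^+ 2.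
  rewrite normrM (ger0_norm (sqr_ge0 (enorm _))).
  apply: (@le_trans _ _ (2 * (n%:~R ^+ 2 * enorm (hl g) ^+ 2))); last by rewrite ler_wpM2l.
  rewrite mulrA; apply: ler_wpM2r; first exact: sqr_ge0.
  apply: le_trans (ler_normB _ _) _; rewrite normrX.
  have -> : (n%:~R : R) ^+ 2 = `|n%:~R| ^+ 2 by rewrite real_normK ?num_real.
  nra.
have := lerB_normD (n%:~R * A) ((n%:~R ^+ 2 - n%:~R) * enorm (hl g) ^+ 2); lra.
Qed.
End nonresonance.

(** Here P = X^9, l is the eigenvalue of T(P(s)) and Q the diagonal contribution along the line: a
    site of the line whose diagonal entry is close to lambda belongs to the piece kept. *)
Lemma far_on_line (R : realType) (P l e Q : R) : `|l| <= P / 64 ->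
  `|e + Q - (l + e)| < P / 64 -> Q <= P / 32.
Proof. by rewrite ler_norml ltr_norml => /andP[? ?] /andP[? ?]; lra. Qed.

(** Here f - e is the change of the diagonal by a step off the line, k and q are the indices along
    the line of the two sites. At distance below X, kap k^2 <= 2 X^2 + 2 kap q^2 <= 3 P / 16, too
    little to compensate a change of P / 2. *)
Lemma far_off_line (R : realType) (P l e f k q q' kap X : R) : `|l| <= P / 64 ->
  `|f + kap * k ^+ 2 - (l + e)| < P / 64 -> P / 2 <= `|f - e| -> 0 <= kap -> 0 <= q' ->
  kap * q ^+ 2 <= P / 32 -> X ^+ 2 <= P / 16 ->
  q' + kap * (k - q) ^+ 2 < X ^+ 2 -> False.
Proof.
rewrite ler_norml ltr_norml => /andP[l1 l2] /andP[h1 h2] h kap0 q'0 qP XP dist.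
have kk : k ^+ 2 <= 2 * (k - q) ^+ 2 + 2 * q ^+ 2.
  by have := sqr_ge0 (k - 2 * q); nra.
have {}kk := ler_wpM2l kap0 kk.
have k20 : 0 <= kap * k ^+ 2 by rewrite mulr_ge0 ?sqr_ge0.
have P0 : 0 <= P by have := sqr_ge0 X; lra.
have : P / 2 <= P / 64 + P / 64 + kap * k ^+ 2.
  by apply: le_trans h _; rewrite ler_norml; apply/andP; split; lra.
lra.
Qed.

(** The factor 4 on the left is the loss of mass in [quasimode]; the inequality is 12 (x^2 + y^2 +
    z^2) <= 16 (x + y + z)^2. *)
Lemma residual_constant (R : realType) (k x y z : R) : 0 <= x -> 0 <= y -> 0 <= z ->
  k ^+ 2 * (3 * (x ^+ 2 + y ^+ 2 + z ^+ 2)) * 4 <= (4 * k * (x + y + z)) ^+ 2.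
Proof.
move=> x0 y0 z0.
have -> : k ^+ 2 * (3 * (x ^+ 2 + y ^+ 2 + z ^+ 2)) * 4 =
  k ^+ 2 * (12 * (x ^+ 2 + y ^+ 2 + z ^+ 2)) by ring.
have -> : (4 * k * (x + y + z)) ^+ 2 = k ^+ 2 * (16 * (x + y + z) ^+ 2) by ring.
rewrite ler_wpM2l ?sqr_ge0//.
have := mulr_ge0 x0 y0; have := mulr_ge0 x0 z0; have := mulr_ge0 y0 z0.
by have := sqr_ge0 x; have := sqr_ge0 y; have := sqr_ge0 z; nra.
Qed.

(** * The approximate eigenvector built on a line of frequencies *)

Section line_quasimode.
Variables (R : realType) (d m : nat) (a : 'I_d -> R).
Hypothesis a0 : forall k, 0 < a k.
Variable V : 'rV[R]_d -> 'M[R]_m.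
Hypothesis VL2 : forall i k, L2 a (fun x => V x i k).
Hypothesis Vsym : forall x, box a x -> (V x)^T = V x.
Local Notation T := ('rV[int]_d * 'I_m)%type.
Local Notation T1 := ('rV[int]_1 * 'I_m)%type.
Local Notation hl := (half_lattice_vec a).
Local Notation v := (vcoef a V).
Local Notation W := (conv_kernel v).
Local Notation D := (lap_symbol a (m := m)).
Variables (t0 : nat) (B : R).
Hypothesis t0_ge : (2 * d <= t0)%N.
Hypothesis t0_ge9 : (9 <= t0)%N.
Hypothesis B0 : 0 <= B.
Hypothesis v_moment : forall i, sums_le (fun x : T => wt a x.1 ^+ t0 * v i x.2 x.1) B.

Variables (i0 : 'I_d) (b : 'rV[int]_d) (lamj X : R).
Local Notation delta := (evec a i0).
Local Notation kap := (enorm delta ^+ 2).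
Local Notation lam := (lamj + enorm (hl b) ^+ 2).
Local Notation tau := (X ^+ 9 / 64).
Local Notation W1 := (conv_kernel (pcoef a V i0)).
Let K : R := #|{ffun 'I_d -> bool}|%:R.

Hypothesis b_i0 : b 0 i0 = 0.
Hypothesis X_ge1 : 1 <= X.
Hypothesis lamj_le : `|lamj| <= tau.
Hypothesis B_small : B <= tau / 2.
Hypothesis KB_small : K * (B / tau) <= 2^-1.
Hypothesis X_large : X ^+ 2 <= X ^+ 9 / 16.
Hypothesis nonres : forall b1 : 'rV[int]_d, b1 0 i0 = 0 -> b1 != 0 -> enorm (hl b1) < X ->
  X ^+ 9 / 2 <= `|enorm (hl b + hl b1) ^+ 2 - enorm (hl b) ^+ 2|.
Hypothesis lamj_eigen : T_eigenvalue a V delta lamj.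

Let emb (x : T1) : T := (b + line i0 (x.1 0 0), x.2).

Let tau0 : 0 < tau.
Proof. by rewrite divr_gt0// exprn_gt0// (lt_le_trans ltr01). Qed.

Let kap0 : 0 < kap.
Proof.
rewrite exprn_gt0// enorm_gt0//; apply/eqP => /rowP/(_ i0); rewrite !mxE !eqxx mulr1 => /eqP.
by rewrite mulf_eq0 invr_eq0 (gt_eqF (a0 i0)) (gt_eqF (pi_gt0 R)).
Qed.

Let line_i0 k : line i0 k 0 i0 = k.
Proof. by rewrite !mxE !eqxx mulr1. Qed.

Let lineB k k' : line i0 k - line i0 k' = line i0 (k - k').
Proof. by rewrite /line scalerBl. Qed.

Let emb_inj : injective emb.
Proof.
move=> [z j] [w k] [] /addrI/rowP/(_ i0); rewrite !line_i0 => h ->.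
by congr pair; apply/rowP => l; rewrite ord1.
Qed.

Let W_emb x y : W (emb x) (emb y) = W1 x y.
Proof.
by rewrite /conv_kernel/= opprD addrACA subrr add0r lineB /pcoef !mxE.
Qed.

Let D_line (u : 'rV[int]_d) k : u 0 i0 = 0 -> enorm (hl (u + line i0 k)) ^+ 2 = enorm (hl u) ^+ 2 + kap * k%:~R ^+ 2.
Proof.
move=> ui; rewrite half_lattice_vecD half_lattice_vec_line enorm_sqrD (dotC (hl u)) !dotZl.
rewrite /dot big1 => [|l _]; last first.
  by rewrite !mxE/=; case: eqP => [->|]; rewrite ?ui ?mul0r ?mulr0.
by rewrite !mulr0 addr0 enormZ exprMn real_normK ?num_real// mulrC.
Qed.

Let D_emb x : D (emb x) = enorm (hl b) ^+ 2 + kap * (x.1 0 0)%:~R ^+ 2.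
Proof. exact: D_line. Qed.

Let W_sym x y : W x y = W y x.
Proof. exact: (conv_kernel_sym (vcoef_sym Vsym) (@vcoef_even R d m a V)). Qed.

Let W_le x : sums_le (W x) B.
Proof. exact: conv_kernel_le v_moment x. Qed.

Let W_far x s : uniq s -> (forall y, y \in s -> X <= enorm (hl (x.1 - y.1))) ->
  \sum_(y <- s) `|W x y| <= B / X ^+ 9.
Proof.
move=> us sX; rewrite ler_pdivlMr; last by rewrite exprn_gt0// (lt_le_trans ltr01).
apply: le_trans (conv_kernel_moment v_moment x us).
rewrite mulr_suml big_seq [leRHS]big_seq; apply: ler_sum => y ys.
rewrite [leRHS]normrM mulrC ler_wpM2r// ger0_norm ?wtX_ge0//.
apply: (@le_trans _ _ (wt a (x.1 - y.1) ^+ 9)); last by rewrite ler_weXn2l// wt_ge1.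
rewrite lerXn2r ?nnegrE ?(le_trans ler01)// ?wt_ge1//.
by rewrite /wt; have := sX y ys; lra.
Qed.

Let W1_le x : sums_le (W1 x) B.
Proof.
move=> s us; under eq_bigr do rewrite -W_emb.
exact: (sums_le_inj emb_inj (W_le (emb x)) us).
Qed.

Let far_from_line (t1 : seq T1) z :
  (forall x : T1, (x \in t1) = (kap * (x.1 0 0)%:~R ^+ 2 <= X ^+ 9 / 32)) ->
  z \notin map emb t1 -> `|D z - lam| < tau ->
  forall w, w \in map emb t1 -> X <= enorm (hl (z.1 - w.1)).
Proof.
move=> t1P zt Dz w /mapP[x xt ->] /=; rewrite leNgt; apply/negP => h.
pose k := z.1 0 i0; pose b1 := z.1 - b - line i0 k.
have b1i : b1 0 i0 = 0 by rewrite !mxE b_i0 !eqxx mulr1 subr0 subrr.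
have zE : z.1 = (b + b1) + line i0 k by rewrite -addrA /b1 subrK addrC subrK.
have bb1 : (b + b1) 0 i0 = 0 by rewrite mxE b_i0 b1i.
move: Dz; rewrite /lap_symbol zE D_line// => Dz.
move: h; rewrite zE opprD addrACA [b + b1]addrC addrK lineB => h.
have : enorm (hl b1) ^+ 2 + kap * (k - x.1 0 0)%:~R ^+ 2 < X ^+ 2.
  by rewrite -D_line// ltr_pXn2r ?nnegrE ?enorm_ge0// (le_trans ler01).
move: xt; rewrite t1P intrB => xt dist.
have b1X : enorm (hl b1) < X.
  rewrite -(@ltr_pXn2r _ 2) ?nnegrE ?enorm_ge0// ?(le_trans ler01)//.
  by apply: le_lt_trans dist; rewrite lerDl mulr_ge0 ?sqr_ge0.
(* If b1 = 0 the site is on the line, and its diagonal entry puts it in the piece, against [zt].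
   Otherwise [nonres] moves the diagonal too far. *)
have [b1e|b1n] := eqVneq b1 0.
  move/negP: zt; apply; apply/mapP; exists (const_mx k, z.2); last first.
    by rewrite /emb/= mxE [LHS]surjective_pairing zE b1e addr0.
  rewrite t1P/= mxE; rewrite b1e addr0 in Dz.
  exact: far_on_line lamj_le Dz.
apply: far_off_line lamj_le Dz _ (ltW kap0) (sqr_ge0 (enorm (hl b1))) xt X_large dist.
by rewrite half_lattice_vecD; exact: nonres.
Qed.

Lemma near_subset_pcube n (s : seq ('rV[int]_n * 'I_m)) :
  \forall N \near \oo, {subset s <= pcube m n N}.
Proof.
elim: s => [|x s IH]; first exact: nearW.
near=> N => y; rewrite inE => /predU1P[->|]; last by move: y; near: N.
by near: N; exact: near_mem_pcube.
Unshelve. all: by end_near. Qed.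

Lemma line_quasimode : exists Lambda, schrodinger_eigenvalue a 1 V Lambda /\
  `|Lambda - lam| <= 4 * K * (2 * (B ^+ 2 * 64) + B + B ^+ 2 * 64) / X ^+ 9.
Proof.
have pM i j : sums_le (pcoef a V i0 i j) B.
  have lI : injective (fun z : 'rV[int]_1 => line i0 (z 0 0)).
    by move=> z w /rowP/(_ i0); rewrite !line_i0 => h; apply/rowP => l; rewrite ord1.
  by move=> s us; exact: (sums_le_inj lI (vcoef_le v_moment i j) us).
have [y [yflip [xy yn0] [M yM] yeq]] := T_eigenvalue_coefs a0 pM lamj_eigen.
pose D1 (x : T1) := kap * (x.1 0 0)%:~R ^+ 2.
have p0 (k : 'I_1) : 0 < (pi : R) by exact: pi_gt0.
have [s1 us1 hs1] := @lap_symbol_fin R 1 m _ p0 (X ^+ 9 / 32 / kap).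
(* The threshold is 2 tau: as |lamj| <= tau, every index left out has its diagonal entry at least
   tau away from [lamj]. *)
pose t1 : seq T1 := [seq x : T1 <- s1 | kap * (x.1 0 0)%:~R ^+ 2 <= X ^+ 9 / 32].
have t1P (x : T1) : (x \in t1) = (kap * (x.1 0 0)%:~R ^+ 2 <= X ^+ 9 / 32).
  rewrite mem_filter andb_idr// => h; apply: hs1.
  rewrite /lap_symbol ler_pdivlMr// mulrC; apply: le_trans h.
  by rewrite (enorm_sqr (half_lattice_vec _ _)) /dot big_ord1 half_lattice_vec_pi expr2.
have ut1 : uniq t1 by exact: filter_uniq.
have W1sym x w : W1 x w = W1 w x by rewrite -!W_emb W_sym.
have far x : x \notin t1 -> tau <= `|D1 x - lamj|.
  rewrite t1P; apply: contraNT; rewrite -ltNge => h.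
  by apply: (far_on_line (e := 0) lamj_le); rewrite add0r addr0.
have res1 := near_residual W1sym W1_le (@pcube_uniq m 1) (@near_mem_pcube m 1)
  yM yeq tau0 ut1 far B_small.
have mass := near_mass W1sym W1_le (@pcube_uniq m 1) (@near_mem_pcube m 1)
  yM yeq tau0 ut1 far B_small.
have {mass} N0 : 0 < \sum_(x <- t1) y x ^+ 2.
  have h := psum_ub yM (s := [:: xy]) isT; rewrite big_seq1 in h.
  rewrite -(@pmulr_rgt0 _ 2)//; apply: lt_le_trans (le_trans h mass).
  by rewrite exprn_even_gt0.
pose t := map emb t1; have ut : uniq t by rewrite map_inj_uniq.
pose chi z := if z \in t then y (const_mx (z.1 0 i0), z.2) else 0.
have chi_emb x : x \in t1 -> chi (emb x) = y x.
  move=> xt; rewrite /chi map_f//= !mxE b_i0 add0r !eqxx mulr1.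
  by congr y; rewrite [RHS]surjective_pairing; congr pair; apply/rowP => l; rewrite !mxE ord1.
have chi_sum f : \sum_(z <- t) f z * chi z = \sum_(x <- t1) f (emb x) * y x.
  by rewrite big_map big_seq [RHS]big_seq; apply: eq_bigr => x /chi_emb ->.
have chi2 : \sum_(z <- t) chi z ^+ 2 = \sum_(x <- t1) y x ^+ 2.
  by rewrite big_map big_seq [RHS]big_seq; apply: eq_bigr => x /chi_emb ->.
have act1 : exists g, forall x, @pflip d m g x = x.
  by exists [ffun=> false] => -[z j]; rewrite /pflip/= flip0.
have actM h : exists2 hm : {ffun 'I_d -> bool} -> {ffun 'I_d -> bool}, injective hm &
    forall g x, @pflip d m g (pflip h x) = pflip (hm g) x.
  exists (fun g => [ffun k => g k (+) h k]) => [g g' /ffunP e|g [z j]].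
    by apply/ffunP => k; have := e k; rewrite !ffunE => /addIb.
  by congr pair; apply/rowP => k; rewrite !mxE ffunE mulrA signr_addb.
have s_act N g z : (pflip g z \in pcube m d N) = (z \in pcube m d N).
  by rewrite !mem_pcube mem_cube_flip.
(* On [t] the value of [chi] depends on the i0-th index and the component only. As b has i0-th index
   0, a sign change turns the index k into k or - k, and y is even. *)
have chi_act g z : z \in t -> chi (pflip g z) = chi z \/ chi (pflip g z) = 0.
  move=> /mapP[x xt ->]; rewrite chi_emb// /chi; case: ifP => _; [left|by right].
  rewrite -(yflip [ffun=> g i0] x); congr y; rewrite /pflip/=; congr pair.
  by apply/rowP => l; rewrite !mxE !ffunE b_i0 add0r !eqxx mulr1 ord1.
set e1 := 2 * (B ^+ 2 / tau); set e2 := B / X ^+ 9.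
have X9 : 0 < X ^+ 9 by rewrite exprn_gt0// (lt_le_trans ltr01).
have e10 : 0 <= e1 by rewrite mulr_ge0// divr_ge0 ?sqr_ge0// ltW.
have e20 : 0 <= e2 by rewrite divr_ge0// ltW.
have {}res1 : \sum_(z <- t) (D z * chi z + \sum_(w <- t) W z w * chi w - lam * chi z) ^+ 2 <=
    e1 ^+ 2 * \sum_(z <- t) chi z ^+ 2.
  (* The factor 2 of [near_residual] stands outside the square; the 2 inside [e1] gives 4 and avoids
     a square root. *)
  rewrite chi2 big_map; apply: le_trans (le_trans res1 _); last first.
    by rewrite ler_wpM2r ?(ltW N0)// /e1 (exprMn _ 2) ler_wpM2r ?sqr_ge0// -natrX ler_nat.
  rewrite le_eqVlt; apply/orP; left; apply/eqP; rewrite big_seq [RHS]big_seq.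
  apply: eq_bigr => x xt; rewrite chi_emb// chi_sum D_emb; congr (_ ^+ 2).
  under eq_bigr do rewrite W_emb.
  by rewrite /D1; ring.
have bad_row z : (z \notin t) && (`|D z - lam| < tau) -> \sum_(w <- t) `|W z w| <= e2.
  by move=> /andP[zt Dz]; apply: W_far => //; exact: far_from_line t1P zt Dz.
have bad_col w : w \in t -> forall r, uniq r ->
    all (fun z => (z \notin t) && (`|D z - lam| < tau)) r -> \sum_(z <- r) `|W z w| <= e2.
  move=> wt r ur /allP bad; under eq_bigr do rewrite W_sym; apply: W_far => // z /bad/andP[zt Dz].
  by rewrite half_lattice_vecB -enormN opprB -half_lattice_vecB; exact: far_from_line t1P zt Dz _ wt.
set eps := _ / X ^+ 9.
have epsE : eps = 4 * K * (e1 + e2 + B ^+ 2 / tau).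
  by rewrite /eps /e1 /e2; field; rewrite gt_eqF// (lt_le_trans ltr01).
have K0 : 0 <= K by exact: ler0n.
have bt0 : 0 <= B ^+ 2 / tau by rewrite divr_ge0 ?sqr_ge0// ltW.
apply: (eigenvalue_of_quasimodes a0 VL2 Vsym t0_ge v_moment).
  by rewrite epsE; apply: mulr_ge0; [apply: mulr_ge0|apply: addr_ge0 => //; exact: addr_ge0].
near=> N.
have ts : {subset t <= pcube m d N} by near: N; exact: near_subset_pcube.
have chi_supp z : z \notin t -> chi z = 0 by rewrite /chi => /negbTE ->.
have [x [xinv xs xN xres]] := quasimode (@pflipK d m) act1 actM W_sym
  (pflip_kernel (@vcoef_even R d m a V)) (@pflip_symbol R d m a) W_le
  (@pcube_uniq m d N) (s_act N) ut ts chi_supp chi_act tau0 B0 KB_small e20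
  res1 bad_row bad_col.
exists x; split => //; first by rewrite -(@pmulr_rgt0 _ 4)// (lt_le_trans _ xN)// chi2.
apply: le_trans xres _; rewrite epsE.
apply: le_trans (ler_wpM2l _ xN) _.
  by rewrite mulr_ge0 ?sqr_ge0// mulr_ge0// !addr_ge0 ?sqr_ge0.
rewrite [leLHS]mulrA; apply: ler_wpM2r; first by apply: sumr_ge0 => z _; exact: sqr_ge0.
exact: residual_constant.
Unshelve. all: by end_near. Qed.

End line_quasimode.

(** * Choice of the constants *)

Lemma powR_scale (R : realType) (x y : R) n : x `^ (n%:R * y) = (x `^ y) ^+ n.
Proof. by rewrite mulrC powRrM powR_mulrn// powR_ge0. Qed.

Lemma smooth_potential_moment (R : realType) (d m : nat) (a : 'I_d -> R) (V : 'rV[R]_d -> 'M[R]_m) t l :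
  (forall k, 0 < a k) -> (t + d)%:R <= l ->
  (forall i k, smooth_coefs a l (fun x => V x i k)) ->
  exists2 B, 0 <= B & forall i, sums_le
    (fun x : 'rV[int]_d * 'I_m => wt a x.1 ^+ t * vcoef a V i x.2 x.1) B.
Proof.
move=> a0 tl Vs.
have /choice[M hM] : forall ik : 'I_m * 'I_m, exists M,
    sums_le (fun z => wt a z ^+ t * vcoef a V ik.1 ik.2 z) M.
  by move=> [i k]; exact: smooth_coefs_moment tl (Vs i k).
have M0 ik : 0 <= M ik by exact: sums_le_ge0 (hM ik).
exists (\sum_i \sum_j M (i, j)) => [|i]; first by do 2! (apply: sumr_ge0 => ? _).
move=> s us; apply: le_trans (_ : \sum_j M (i, j) <= _); last first.
  by rewrite [leRHS](bigD1 i)//= lerDl; do 2! (apply: sumr_ge0 => ? _).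
exact: (sums_le_pair (c := fun z j => wt a z ^+ t * vcoef a V i j z) (fun j => hM (i, j))).
Qed.

(** The left side of the hypothesis is |gamma + delta|^2 - |gamma|^2 for gamma = beta + j delta;
    since j is an integer, |j| <= |2 j + 1|. *)
Lemma resonant_index (R : realType) (P kap : R) (j : int) : 0 < kap ->
  `|kap * (2 * j%:~R + 1)| < P -> kap * j%:~R ^+ 2 <= P ^+ 2 / kap.
Proof.
move=> k0 h; rewrite ler_pdivlMr//.
have P0 : 0 <= P by apply: le_trans (ltW h).
have jj : `|j%:~R : R| <= `|2 * j%:~R + 1|.
  have -> : 2 * j%:~R + 1 = (2 * j + 1)%:~R :> R by rewrite intrD intrM.
  by rewrite -!intr_norm ler_int; lia.
apply: le_trans (_ : `|kap * (2 * j%:~R + 1)| ^+ 2 <= _); last first.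
  by rewrite ler_pXn2r ?nnegrE ?(ltW h).
rewrite normrM exprMn (gtr0_norm k0) mulrAC -expr2 ler_wpM2l ?sqr_ge0//.
by rewrite -[leLHS]real_normK ?num_real// ler_pXn2r ?nnegrE.
Qed.

Theorem theorem1 (R : realType) (d m : nat) (hd : (2 <= d)%N) (hm : (2 <= m)%N)
    (a : 'I_d -> R) (ha : forall k, 0 < a k)
    (V : 'rV[R]_d -> 'M[R]_m)
    (VL2 : forall i k, L2 a (fun x => V x i k))
    (Vsym : forall x, box a x -> (V x)^T = V x)
    (l : R)
    (hl : (d%:R + 20) * (d%:R - 1) / 2 + d%:R + 3 < l)
    (Vsmooth : forall i k, smooth_coefs a l (fun x => V x i k))
    (alpha : R) (halpha : 0 < alpha < (d%:R + 20)^-1)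
    (c1 c2 : R) (hc1 : 0 < c1) (hc2 : 0 < c2)
    (i : 'I_d) :
  let p := l - d%:R in
  let alpha_ (k : nat) := 3 ^+ k * alpha in
  let delta := evec a i in
  exists C rho0 : R, forall rho : R, rho0 <= rho ->
    forall (j : int) (beta : 'rV[R]_d) (lam : R),
      half_lattice a beta -> dot beta delta = 0 ->
      LP_eigenvalue_at a V delta j beta lam ->
      let gamma := beta + j%:~R *: delta in
      c1 * rho < enorm gamma < c2 * rho ->
      resonance delta (rho `^ alpha_ 1%N) gamma ->
      ~ double_resonance a (p * rho `^ alpha) (rho `^ alpha_ 2%N) gamma ->
      exists Lam : R, schrodinger_eigenvalue a 1 V Lam /\
        `| Lam - lam | <= C * rho `^ (- alpha_ 2%N).

Proof.
move=> p alpha_ delta.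
have d2 : 2 <= d%:R :> R by rewrite ler_nat.
have p1 : 1 <= p by rewrite /p; nra.
(* The order 2 d + 9 of the moments, plus the [d] derivatives lost in [smooth_coefs_moment]. For d =
   2 the bound on [l] exceeds 16, against the 15 required. *)
have tl : (2 * d + 9 + d)%:R <= l.
  by apply: ltW; apply: le_lt_trans hl; rewrite (natrD _ _ d) (natrD _ _ 9) natrM; nra.
have [B B0 v_moment] := smooth_potential_moment ha tl Vsmooth.
set kap := enorm delta ^+ 2.
have kap0 : 0 < kap.
  rewrite exprn_gt0// enorm_gt0//; apply/eqP => /rowP/(_ i); rewrite !mxE !eqxx mulr1 => /eqP.
  by rewrite mulf_eq0 invr_eq0 (gt_eqF (ha i)) (gt_eqF (pi_gt0 R)).
set S := `|Pmx_sup a V delta|.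
set K : R := #|{ffun 'I_d -> bool}|%:R.
have K0 : 0 <= K by exact: ler0n.
(* One summand per requirement on X: 17 for X^2 <= X^9 / 16, the length of delta for its place in
   the ball of radius p X, then the bounds on [lamj], on B / tau and on K B / tau, and 4 p^2 for the
   loss in [nonresonance]. *)
pose X0 : R := 17 + enorm delta + 64 * (S + kap^-1) + 128 * B + 128 * (K * B) + 4 * p ^+ 2.
exists (4 * K * (2 * (B ^+ 2 * 64) + B + B ^+ 2 * 64)), (X0 `^ alpha^-1).
move=> rho rho_large j beta lam [b _ <-] bd [_ [lamj [lamT lamS] ->]] gamma _.
have /andP[al0 _] := halpha.
have aE n : rho `^ alpha_ n = (rho `^ alpha) ^+ (3 ^ n) by rewrite /alpha_ -natrX powR_scale.
rewrite powRN !aE; set X := rho `^ alpha => res nres.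
have dn0 := enorm_ge0 delta.
have KB0 : 0 <= K * B by exact: mulr_ge0.
have Sk0 : 0 <= S + kap^-1 by rewrite addr_ge0// ?normr_ge0// invr_ge0 ltW.
have p20 := sqr_ge0 p.
have XX0 : X0 <= X.
  have X00 : 0 <= X0 by rewrite /X0; lra.
  have -> : X0 = (X0 `^ alpha^-1) `^ alpha by rewrite -powRrM mulVf ?gt_eqF// powRr1.
  by rewrite ge0_ler_powR ?nnegrE ?powR_ge0 ?(ltW al0)// (le_trans (powR_ge0 _ _) rho_large).
have X17 : 17 <= X by apply: le_trans XX0; rewrite /X0; lra.
have Xd : enorm delta < X by apply: lt_le_trans XX0; rewrite /X0; lra.
have XS : 64 * (S + kap^-1) <= X by apply: le_trans XX0; rewrite /X0; lra.
have XB : 128 * B <= X by apply: le_trans XX0; rewrite /X0; lra.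
have XKB : 128 * (K * B) <= X by apply: le_trans XX0; rewrite /X0; lra.
have Xp : 4 * p ^+ 2 <= X by apply: le_trans XX0; rewrite /X0; lra.
have X1 : 1 <= X by lra.
have X0' : 0 < X by lra.
have Xn n : (0 < n)%N -> X <= X ^+ n by move=> n0; rewrite -[leLHS]expr1 ler_weXn2l.
have X79 : X ^+ 7 * X ^+ 2 = X ^+ 9 by rewrite -exprD.
have X2 : 0 <= X ^+ 2 by exact: sqr_ge0.
have b0 : b 0 i = 0.
  move: bd; rewrite /dot (bigD1 i)//= big1 ?addr0 => [|k /negbTE ki]; last first.
    by rewrite !mxE ki/= !mulr0.
  rewrite !mxE !eqxx mulr1 => /eqP.
  by rewrite !mulf_eq0 invr_eq0 (gt_eqF (ha i)) (gt_eqF (pi_gt0 R)) !orbF intr_eq0 => /eqP.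
(* Resonance at scale X^3 gives kap j^2 <= X^6 / kap, and [lamj] differs from kap j^2 by at most
   [S]; the remaining X^3 absorbs 64 (S + 1 / kap). *)
have lamX : `|lamj| <= X ^+ 9 / 64.
  have jX : kap * j%:~R ^+ 2 <= (X ^+ 3) ^+ 2 / kap.
    apply: resonant_index => //; apply: le_lt_trans res.
    rewrite enorm_sqrD /gamma dotDl bd add0r dotZl -enorm_sqr -normrN le_eqVlt; apply/orP; left.
    by apply/eqP; congr `|_|; rewrite -/kap; ring.
  have {lamS} lamS : `|lamj - kap * j%:~R ^+ 2| <= S.
    apply: le_trans (ler_norm _); rewrite -[kap * _]mulrC -[j%:~R ^+ 2]real_normK ?num_real//.
    by rewrite -exprMn -enormZ.
  have h1 : `|lamj| <= S + (X ^+ 3) ^+ 2 / kap.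
    rewrite -[lamj](subrK (kap * j%:~R ^+ 2)); apply: le_trans (ler_normD _ _) _.
    by rewrite lerD// ger0_norm// mulr_ge0 ?sqr_ge0// ltW.
  have X6 : 1 <= (X ^+ 3) ^+ 2 by rewrite -exprM exprn_ege1.
  apply: le_trans h1 (le_trans (_ : _ <= (X ^+ 3) ^+ 2 * (S + kap^-1)) _).
    by rewrite mulrDr lerD2r ler_peMl// normr_ge0.
  have -> : X ^+ 9 = (X ^+ 3) ^+ 2 * X ^+ 3 by rewrite -exprM -exprD.
  rewrite -mulrA ler_wpM2l ?sqr_ge0// ler_pdivlMr// mulrC.
  exact: le_trans XS (Xn 3%N isT).
apply: (line_quasimode ha VL2 Vsym _ _ B0 v_moment b0 X1 lamX) => //.
- by rewrite leq_addr.
- by rewrite leq_addl.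
- by have := Xn 9%N isT; lra.
- rewrite invf_div !mulrA ler_pdivrMr ?exprn_gt0//.
  by have := Xn 9%N isT; lra.
- rewrite -X79; have := Xn 7%N isT; nra.
- move=> b1 b1i b1n b1X.
  have Xr : X <= p * X by rewrite ler_peMl// ltW.
  (* Resonance with delta is assumed at scale X^3, but membership in E_2 is tested at scale X^9. *)
  have res9 : resonance delta (X ^+ 9) gamma.
    by apply: lt_le_trans res _; rewrite ler_weXn2l.
  have := nonresonance ha b0 b1i b1n (lt_le_trans b1X Xr) (lt_le_trans Xd Xr) res9 nres.
  (* With r = p X the loss is 2 p^2 X^2, at most X^9 / 2 because 4 p^2 <= X <= X^7. *)
  apply: le_trans; rewrite -X79 exprMn; have := Xn 7%N isT; nra.
Qed.
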